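(* Let $U\subset\mathbb{R}^d$ be a bounded open set with locally Lipschitz boundary, $u:\bar U\to[0,\infty)$ bounded and smooth with $\Delta u<0$ in $U$, $f:\mathbb{R}^d\to(0,\infty)$ bounded measurable, and $\mu$ a measure with bounded density supported in $\bar U$ with $\mu(U)\le\int_Uf\,dx$. Define $$P(\mu,f,u)=\inf\Big\{\int u\,d\nu:\ \tau\le\tau^U,\ W_\tau\sim\nu\le f\chi_U,\ W_0\sim\mu\Big\}$$ and $$D(\mu,f,u)=\sup_{(\phi,\psi)\in\mathcal D}\Big[\int\phi(y)f(y)\,dy-\int\psi\,d\mu\Big],$$ where $\mathcal D$ is the set of pairs $(\phi,\psi)$ of functions in $L^1(U)$ with $\phi\le0$, $\psi\ge\phi-u$ in $U$, and $\psi$ superharmonic in $U$. Then $D(\mu,f,u)\le P(\mu,f,u)$.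
   Context: The infimum in $P$ is over (randomized) stopping times $\tau$ (maps from $\Omega$ to probability measures on $\mathbb{R}_+$ with $\omega\mapsto\tau(\omega)([0,t])$ $\mathcal F_t$-measurable) with $\tau\le\tau^U:=\inf\{t>0:W_t\notin U\}$, Brownian motion started with law $\mu$, and terminal law $\nu$ (i.e. $\mathbb E[\int g(W_t)\tau(dt)]=\int g\,d\nu$) having density $\le f\chi_U$. Superharmonic: lower semicontinuous with the super-mean value property on balls. *)

(* Defs.v *)
(* Points of R^d are row vectors 'rV[R]_d with d = n.+1. *)
From HB Require Import structures.
From mathcomp Require Import all_boot all_order all_algebra.
From mathcomp Require Import all_classical all_reals all_analysis.
From mathcomp Require Import measurable_realfun.

Set Implicit Arguments.
Unset Strict Implicit.
Unset Printing Implicit Defensive.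

Import Order.TTheory GRing.Theory Num.Theory.
Import numFieldNormedType.Exports.

Local Open Scope classical_set_scope.
Local Open Scope ring_scope.

Notation Rd R n := (g_sigma_algebraType (@open 'rV[R]_(n.+1))).

Section Defs.
Variables (R : realType) (n : nat).
Local Notation V := 'rV[R]_(n.+1).

Definition Rplus : set R := `[0, +oo[%classic.

Definition sqnorm {m} (x : 'rV[R]_m) : R := \sum_(i < m) (x ord0 i) ^+ 2.
Definition cball_e (x : V) (r : R) : set V := [set y | sqnorm (y - x) <= r ^+ 2].

(* Lebesgue measure on R^d: the (unique) Borel measure giving closed boxes
   their volume. *)
Definition is_lebesgue_d (lam : {measure set (Rd R n) -> \bar R}) : Prop :=
  forall a b : V, (forall i, a ord0 i <= b ord0 i) ->
    lam [set x : V | forall i, a ord0 i <= x ord0 i <= b ord0 i]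
    = (\prod_(i < n.+1) (b ord0 i - a ord0 i))%:E.

(* locally Lipschitz boundary: near each boundary point, after a rigid motion
   (orthogonal change of coordinates), U is the region strictly above the graph
   of a Lipschitz function of the first d-1 coordinates. *)
Definition lipschitz_fun {m} (g : 'rV[R]_m -> R) : Prop :=
  exists L : R, forall a b, (g a - g b) ^+ 2 <= L ^+ 2 * sqnorm (a - b).

Definition locally_lipschitz_boundary (U : set V) : Prop :=
  forall x : V, closure U x -> ~ U x ->
  exists r : R, exists Q : 'M[R]_(n.+1), exists g : 'rV[R]_n -> R,
    [/\ 0 < r, Q *m Q^T = 1%:M, lipschitz_fun g &
      forall y : V, sqnorm (y - x) < r ^+ 2 ->
        (U y <-> let z := (y - x) *m Q in
                 g (\row_(j < n) z ord0 (widen_ord (leqnSn n) j)) < z ord0 ord_max)].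

Fixpoint dirderiv (vs : seq V) (f : V -> R) : V -> R :=
  match vs with
  | [::] => f
  | v :: vs' => 'D_v (dirderiv vs' f)
  end.

Definition smooth_on (A : set V) (f : V -> R) : Prop :=
  forall (vs : seq V) (x : V), A x ->
    (forall v : V, derivable (dirderiv vs f) x v) /\
    {for x, continuous (dirderiv vs f)}.

Definition smooth_on_closure (U : set V) (f : V -> R) : Prop :=
  exists O : set V, [/\ open O, closure U `<=` O & smooth_on O f].

Definition unit_vec (i : 'I_n.+1) : V := delta_mx ord0 i.

Definition laplacian (f : V -> R) (x : V) : R :=
  \sum_(i < n.+1) dirderiv [:: unit_vec i; unit_vec i] f x.

Definition superharmonic_in (lam : {measure set (Rd R n) -> \bar R})
    (U : set V) (psi : V -> \bar R) : Prop :=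
  [/\ (forall x, U x -> (-oo < psi x)%E),
      (forall x, U x -> forall a : R, (a%:E < psi x)%E ->
          exists2 W, nbhs x W & forall y, W y -> (a%:E < psi y)%E) &
      (forall x r, U x -> 0 < r -> cball_e x r `<=` U ->
          ((fine (lam (cball_e x r)))^-1%:E *
             \int[lam]_(y in (cball_e x r : set (Rd R n))) psi y <= psi x)%E)].

Definition gauss_density (t : R) (x : V) : R :=
  ((Num.sqrt (2 * pi * t)) ^+ n.+1)^-1 * expR (- sqnorm x / (2 * t)).

Definition gauss (lam : {measure set (Rd R n) -> \bar R}) (t : R)
  (B : set (Rd R n)) : \bar R :=
  \int[lam]_(x in B) (gauss_density t x)%:E.

Section Process.
Context {dO : measure_display} {Omega : measurableType dO}.

Definition filtration (F : R -> set (set Omega)) : Prop :=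
  [/\ forall t, sigma_algebra setT (F t),
      forall s t, s <= t -> F s `<=` F t &
      forall t, F t `<=` measurable].

(* F-Brownian motion in R^d (under a finite measure P, not necessarily of
   mass one): continuous paths, adapted, and for 0 <= s < t the increment
   W_t - W_s is independent of F_s with law N(0, (t-s) I). *)
Definition brownian_motion (lam : {measure set (Rd R n) -> \bar R})
    (P : {measure set Omega -> \bar R}) (F : R -> set (set Omega))
    (W : R -> Omega -> V) : Prop :=
  [/\ forall w, {within Rplus, continuous (fun t => W t w)},
      forall t, 0 <= t ->
        @measurable_fun _ _ (g_sigma_algebraType (F t)) (Rd R n) setT (W t) &
      forall s t (A : set Omega) (B : set (Rd R n)), 0 <= s -> s < t ->
        F s A -> measurable B ->
        P (A `&` [set w | B (W t w - W s w)]) = (P A * gauss lam (t - s) B)%E].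

Definition exit_time (U : set V) (W : R -> Omega -> V) (w : Omega) : \bar R :=
  ereal_inf [set t%:E | t in [set t : R | 0 < t /\ ~ U (W t w)]].

Definition randomized_stopping_time (F : R -> set (set Omega))
    (tau : Omega -> probability R R) : Prop :=
  (forall w, tau w Rplus = 1%E) /\
  (forall t, 0 <= t ->
     @measurable_fun _ _ (g_sigma_algebraType (F t)) (\bar R) setT
       (fun w => tau w `[0, t]%classic)).

Definition before_exit (U : set V) (W : R -> Omega -> V)
    (tau : Omega -> probability R R) : Prop :=
  forall w, tau w [set t : R | (exit_time U W w < t%:E)%E] = 0%E.

Definition terminal_law (P : {measure set Omega -> \bar R})
    (W : R -> Omega -> V) (tau : Omega -> probability R R)
    (nu : {measure set (Rd R n) -> \bar R}) : Prop :=
  forall g : Rd R n -> R, measurable_fun setT g -> (forall x, 0 <= g x) ->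
    (\int[P]_w \int[tau w]_(t in Rplus) (g (W t w))%:E
     = \int[nu]_x (g x)%:E)%E.

Definition density_below (lam : {measure set (Rd R n) -> \bar R})
    (nu : {measure set (Rd R n) -> \bar R}) (f : V -> R) (U : set V) : Prop :=
  exists h : Rd R n -> R, [/\ measurable_fun setT h,
    forall x, 0 <= h x /\ h x <= (if asbool (U x) then f x else 0) &
    forall A : set (Rd R n), measurable A -> nu A = (\int[lam]_(x in A) (h x)%:E)%E].

Definition primal_value (lam : {measure set (Rd R n) -> \bar R})
    (P : {measure set Omega -> \bar R}) (F : R -> set (set Omega))
    (W : R -> Omega -> V) (f u : V -> R) (U : set V) : \bar R :=
  ereal_inf [set (\int[nu]_(x in (U : set (Rd R n))) (u x)%:E)%E
    | nu in [set nu : {measure set (Rd R n) -> \bar R} |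
        exists tau : Omega -> probability R R,
          [/\ randomized_stopping_time F tau, before_exit U W tau,
              density_below lam nu f U & terminal_law P W tau nu]]].

End Process.

Definition dual_feasible (lam : {measure set (Rd R n) -> \bar R})
    (u : V -> R) (U : set V) (phi : V -> R) (psi : V -> \bar R) : Prop :=
  [/\ lam.-integrable (U : set (Rd R n)) (fun x => (phi x)%:E),
      lam.-integrable (U : set (Rd R n)) psi,
      forall x, U x -> phi x <= 0,
      forall x, U x -> ((phi x - u x)%:E <= psi x)%E &
      superharmonic_in lam U psi].

Definition dual_value (lam : {measure set (Rd R n) -> \bar R})
    (mu : {measure set (Rd R n) -> \bar R}) (f u : V -> R) (U : set V) : \bar R :=
  ereal_sup [set (\int[lam]_(y in (U : set (Rd R n))) (p.1 y * f y)%:E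
                  - \int[mu]_(x in (U : set (Rd R n))) p.2 x)%E
    | p in [set p : (V -> R) * (V -> \bar R) | dual_feasible lam u U p.1 p.2]].

End Defs.

(* Main.v *)
Require Import Defs.
From HB Require Import structures.
From mathcomp Require Import all_boot all_order all_algebra.
From mathcomp Require Import all_classical all_reals all_analysis.
From mathcomp Require Import measurable_realfun.
From mathcomp Require Import ring lra.
Import Order.TTheory GRing.Theory Num.Theory.
Import numFieldNormedType.Exports.
Local Open Scope classical_set_scope.
Local Open Scope ring_scope.
Set Implicit Arguments.
Unset Strict Implicit.
Unset Printing Implicit Defensive.

(* Write [nu = h dx] and [mu = m dx].  Since [phi <= 0] and [h <= f], we have
   [phi f <= phi h <= (psi + u) h], so everything reduces to the inequality
   [int psi h <= int psi m] for [psi] superharmonic and integrable on U.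

   Let P_t be the heat semigroup and [v = d (P_d + P_2d + ... + P_S) (m - h)] the
   discretised potential of [m - h], so that [P_d v - v = d P_d w] with w close to
   [h - m] for S large.  The Markov property and the rounding of tau to the grid
   identify [P_theta v], up to o(1), with the occupation density of Brownian
   motion before tau smoothed at scale theta.  Hence v is bounded, [v >= -o(1)],
   and [v <= o(1)] off U; the Lipschitz boundary is used only for the last bound,
   to approximate points off U by exterior points.

   It remains to see that [int psi (P_d v - v) <= o(d)] for such a v.  One replaces
   v by [H(v)], where H is convex, vanishes for small arguments, and has as
   derivative a logarithmic ramp from 0 at [b^2] to 1 at [b].  As [H(v)] is
   supported well inside U, the super mean value property, applied to the balls
   that are the superlevel sets of the Gaussian, gives
   [int psi (P_d H(v) - H(v)) <= o(d)].  The remainder [v - H(v)] is at most b;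
   averaging over times up to a fixed theta, by continuity of P_t in L^1, its
   contribution is O(b), while the Bregman error of H is O(d) uniformly in b
   thanks to the log-Lipschitz bound
   [|v(x+z) - v(x)|^2 <= C |z|^2 v(x) ln (1/v(x))]. *)

(** * Integrals of real functions *)

(** [psi] is only lower semicontinuous and integrable: it may be infinite at points and is
    uncontrolled near the boundary, so it is never evaluated along the Brownian path. It enters
    through integrals against bounded functions, and through the mean value inequality on balls
    inside U. The latter demands a test function vanishing near the boundary, whereas v is merely
    small there; hence the truncation. The ramp is logarithmic because |grad v|^2 is only known to
    be O(v ln (1/v)). A cutoff with H'' of order 1/b would cost |grad v|^2 / b, that is ln (1/b);
    with H'' = 1/(s ln (1/b)) the cost at level s is ln (1/s) / ln (1/b), bounded on [b^2, b].
    Bounded is enough: the averaging time theta is then fixed before b, and the removed part, of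
    size b, contributes b / theta. The order of the constants shapes the rest. The bounds on v and w
    come before b, and S comes after b; so v must be bounded uniformly in S, and its regularity at
    the scale of b must follow from those two bounds alone, not from the number of terms that define
    v. *)

Section RealIntegrals.
Context (d : measure_display) (T : measurableType d) (R : realType).
Variable mu : {measure set T -> \bar R}.
Implicit Types f g h : T -> R.

Definition rint f := mu.-integrable setT (EFin \o f).

Lemma rint_measurable f : rint f -> measurable_fun setT f.
Proof. by move=> /integrableP[/measurable_EFinP]. Qed.

Lemma rintD f g : rint f -> rint g -> rint (fun x => f x + g x).
Proof. by move=> fi gi; have := integrableD measurableT fi gi. Qed.

Lemma rintB f g : rint f -> rint g -> rint (fun x => f x - g x).
Proof. by move=> fi gi; have := integrableB measurableT fi gi. Qed.

Lemma rintZ (c : R) f : rint f -> rint (fun x => c * f x).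
Proof. by move=> fi; have := integrableZl measurableT c fi. Qed.

Lemma rint0 : rint (fun=> 0).
Proof. exact: integrable0. Qed.

Lemma rint_sum (I : Type) (s : seq I) (F : I -> T -> R) :
  (forall i, rint (F i)) -> rint (fun x => \sum_(i <- s) F i x).
Proof.
move=> Fi; elim: s => [|i s ih].
  by rewrite (_ : (fun _ => _) = fun=> 0) ?rint0//; apply/funext => x; rewrite big_nil.
rewrite (_ : (fun _ => _) = fun x => F i x + \sum_(i <- s) F i x).
  exact: rintD.
by apply/funext => x; rewrite big_cons.
Qed.

Lemma le_rint f g : measurable_fun setT f -> (forall x, `|f x| <= g x) ->
  rint g -> rint f.
Proof.
move=> mf fg gi; apply: (le_integrable measurableT _ _ gi).
  exact/measurable_EFinP.
by move=> x _ /=; rewrite lee_fin (le_trans (fg x))// ler_norm.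
Qed.

Lemma rint_norm f : rint f -> rint (fun x => `|f x|).
Proof. exact: integrable_norm. Qed.

Lemma rintM f h (M : R) : rint f -> measurable_fun setT h ->
  (forall x, `|h x| <= M) -> rint (fun x => f x * h x).
Proof.
move=> fi mh hM; apply: (@le_rint _ (fun x => M * `|f x|)).
- by apply: measurable_funM => //; exact: rint_measurable.
- by move=> x; rewrite normrM mulrC ler_wpM2r.
- exact/rintZ/rint_norm.
Qed.

Lemma rint_cst (c : R) : (mu setT < +oo)%E -> rint (fun=> c).
Proof.
move=> fin; apply: measurable_bounded_integrable => //.
exact: bounded_cst.
Qed.

Lemma bounded_rint f (M : R) : (mu setT < +oo)%E -> measurable_fun setT f ->
  (forall x, `|f x| <= M) -> rint f.
Proof. by move=> fin mf fM; apply: (@le_rint _ (fun=> M)) => //; exact: rint_cst. Qed.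

Lemma RintE f : rint f -> (\int[mu]_x f x)%:E = (\int[mu]_x (f x)%:E)%E.
Proof. by move=> fi; rewrite fineK//; exact: integrable_fin_num. Qed.

Lemma RintD f g : rint f -> rint g ->
  \int[mu]_x (f x + g x) = \int[mu]_x f x + \int[mu]_x g x.
Proof. exact: RintegralD. Qed.

Lemma RintB f g : rint f -> rint g ->
  \int[mu]_x (f x - g x) = \int[mu]_x f x - \int[mu]_x g x.
Proof. exact: RintegralB. Qed.

Lemma RintZ (c : R) f : rint f -> \int[mu]_x (c * f x) = c * \int[mu]_x f x.
Proof. by move=> fi; apply: RintegralZl. Qed.

Lemma Rint_sum (I : Type) (s : seq I) (F : I -> T -> R) :
  (forall i, rint (F i)) ->
  \int[mu]_x (\sum_(i <- s) F i x) = \sum_(i <- s) \int[mu]_x F i x.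
Proof.
move=> Fi; elim: s => [|i s ih].
  rewrite big_nil (_ : (fun _ => _) = fun=> 0).
    by rewrite Rintegral_cst// mul0r.
  by apply/funext => x; rewrite big_nil.
rewrite big_cons -ih -RintD//; last exact: rint_sum.
by congr Rintegral; apply/funext => x; rewrite big_cons.
Qed.

Lemma le_Rint f g : rint f -> rint g -> (forall x, f x <= g x) ->
  \int[mu]_x f x <= \int[mu]_x g x.
Proof. by move=> fi gi fg; apply: le_Rintegral. Qed.

Lemma norm_Rint_le f g : rint f -> rint g -> (forall x, `|f x| <= g x) ->
  `|\int[mu]_x f x| <= \int[mu]_x g x.
Proof.
move=> fi gi fg; apply: (le_trans (le_normr_Rintegral measurableT fi)).
exact: (le_Rint (rint_norm fi) gi).
Qed.

Lemma eq_Rint f g : f =1 g -> \int[mu]_x f x = \int[mu]_x g x.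
Proof. by move=> fg; congr Rintegral; apply/funext. Qed.

Lemma Rint_ge0 f : (forall x, 0 <= f x) -> 0 <= \int[mu]_x f x.
Proof. by move=> f0; apply: Rintegral_ge0. Qed.

Lemma ae_eq_Rint f g : rint f -> measurable_fun setT g ->
  {ae mu, forall x, f x = g x} -> \int[mu]_x f x = \int[mu]_x g x.
Proof.
move=> fi mg fg; congr fine; apply: ae_eq_integral => //.
- exact: measurable_int fi.
- exact/measurable_EFinP.
- by apply: filterS fg => x + _ => ->.
Qed.

Lemma ae_dominated_Rint (f_ : nat -> T -> R) f g :
  (forall k, measurable_fun setT (f_ k)) -> measurable_fun setT f ->
  rint g -> {ae mu, forall x k, `|f_ k x| <= g x} ->
  {ae mu, forall x, f_ ^~ x @ \oo --> f x} ->
  (fun k => \int[mu]_x f_ k x) @ \oo --> \int[mu]_x f x.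
Proof.
move=> mf_ mf gi fg cf.
have [fi _ cvgi] : [/\ mu.-integrable setT (EFin \o f),
    [sequence (\int[mu]_x `|(f_ k x)%:E - (f x)%:E|)%E]_k @ \oo --> 0%E &
    [sequence (\int[mu]_x (f_ k x)%:E)%E]_k @ \oo --> (\int[mu]_x (f x)%:E)%E].
  apply: (@dominated_convergence _ _ _ mu setT measurableT
    (fun k x => (f_ k x)%:E) (EFin \o f) (EFin \o g)) => //.
  - by move=> k; exact/measurable_EFinP.
  - exact/measurable_EFinP.
  - apply: filterS cf => x cf _; apply/fine_cvgP; split; [exact: nearW|exact: cf].
  - by apply: filterS fg => x fg k _; rewrite lee_fin.
have E : (\int[mu]_x (f x)%:E)%E \is a fin_num by exact: integrable_fin_num.
by apply: fine_cvg; rewrite fineK.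
Qed.

Lemma dominated_Rint (f_ : nat -> T -> R) f g :
  (forall k, measurable_fun setT (f_ k)) -> measurable_fun setT f ->
  rint g -> (forall k x, `|f_ k x| <= g x) ->
  (forall x, f_ ^~ x @ \oo --> f x) ->
  (fun k => \int[mu]_x f_ k x) @ \oo --> \int[mu]_x f x.
Proof.
move=> mf_ mf gi fg cf; apply: (ae_dominated_Rint mf_ mf gi); exact: aeW.
Qed.

Lemma bounded_cvg_Rint (f_ : nat -> T -> R) f (M : R) : (mu setT < +oo)%E ->
  (forall k, measurable_fun setT (f_ k)) ->
  (forall k x, `|f_ k x| <= M) ->
  (forall x, f_ ^~ x @ \oo --> f x) ->
  (fun k => \int[mu]_x f_ k x) @ \oo --> \int[mu]_x f x.
Proof.
move=> fin mf_ fM cf; apply: (@dominated_Rint _ _ (fun=> M)) => //.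
- exact: (@measurable_fun_cvg _ _ _ _ f_ f mf_ (fun x _ => cf x)).
- exact: rint_cst.
Qed.

End RealIntegrals.

Section AlmostEverywhere.
Context (d : measure_display) (T : measurableType d) (R : realType).
Variable mu : {measure set T -> \bar R}.

Lemma ae_le_Rint (f g : T -> R) : rint mu f -> rint mu g ->
  {ae mu, forall x, f x <= g x} -> \int[mu]_x f x <= \int[mu]_x g x.
Proof.
move=> fi gi fg; rewrite -subr_ge0 -RintB//.
rewrite (@ae_eq_Rint _ _ _ _ _ (fun x => `|g x - f x|)).
- by apply: Rint_ge0 => x.
- exact: rintB.
- by apply: (rint_measurable (mu := mu)); exact/rint_norm/rintB.
- by apply: filterS fg => x fgx; rewrite ger0_norm// subr_ge0.
Qed.

Lemma rint_indic (A : set T) : measurable A -> (mu A < +oo)%E -> rint mu \1_A.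
Proof.
move=> mA Aoo; apply/integrableP; split; first exact/measurable_EFinP.
under eq_integral do rewrite /= ger0_norm//.
by rewrite integral_indic// setIT.
Qed.

Lemma Rint_indicE (A : set T) : measurable A -> \int[mu]_x \1_A x = fine (mu A).
Proof. by move=> mA; rewrite /Rintegral integral_indic// setIT. Qed.

End AlmostEverywhere.

(** * Borel sets and Lebesgue measure *)

Section Lebesgue.
Variables (R : realType) (n : nat).
Local Notation V := 'rV[R]_(n.+1).
Local Notation E := (Rd R n).

Lemma measurable_open (O : set V) : open O -> measurable (O : set E).
Proof. exact: sub_sigma_algebra. Qed.

Lemma measurable_continuous (f : V -> R) :
  continuous f -> measurable_fun setT (f : E -> R).
Proof.
move=> cf; apply: (measurability _ (RGenOInfty.measurableE R)).
move=> _ [_ [a ->] <-]; rewrite setTI; apply: measurable_open.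
by apply: open_comp => [x _|]; [exact: cf|exact: interval_open].
Qed.

Lemma measurable_coord (i : 'I_n.+1) : measurable_fun setT (fun x : E => x ord0 i).
Proof. by apply: measurable_continuous; exact: coord_continuous. Qed.

Lemma measurable_continuous_map (g : V -> V) :
  continuous g -> measurable_fun setT (g : E -> E).
Proof.
move=> cg; refine (@measurability _ _ E E setT g (@open V) erefl _).
move=> _ [A oA <-]; rewrite setTI; apply: measurable_open.
by apply: open_comp.
Qed.

Definition box (a b : V) : set V :=
  [set x : V | forall i, a ord0 i <= x ord0 i <= b ord0 i].

Lemma measurable_box a b : measurable (box a b : set E).
Proof.
suff -> : box a b = \bigcap_(i in [set: 'I_n.+1])
    (fun x : E => x ord0 i) @^-1` `[a ord0 i, b ord0 i].
  apply: fin_bigcap_measurable => // i _.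
  rewrite -[X in measurable X]setTI.
  by apply: (measurable_coord i) => //; exact: measurable_itv.
apply/seteqP; split=> [x xab i _|x xab i] /=.
  by rewrite in_itv /=; exact: xab.
by have := xab i I; rewrite /= in_itv.
Qed.

(** Boxes with rational centre and half-side 1/(k+1) form a countable family. Closed boxes therefore
    generate the Borel sets, and [is_lebesgue_d], which speaks of boxes only, determines [lam]. *)
Lemma open_bigcup_box (O : set V) : open O ->
  O = \bigcup_(p : 'rV[rat]_(n.+1) * nat)
    [set x | box (\row_i (ratr (p.1 ord0 i) - p.2.+1%:R^-1))
                 (\row_i (ratr (p.1 ord0 i) + p.2.+1%:R^-1)) x /\
       box (\row_i (ratr (p.1 ord0 i) - p.2.+1%:R^-1))
           (\row_i (ratr (p.1 ord0 i) + p.2.+1%:R^-1)) `<=` O].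
Proof.
move=> oO; apply/seteqP; split=> [x Ox|x [p _ [px pO]]]; last exact: pO.
have /nbhs_ballP[e /= e0 eO] := oO x Ox.
have e20 : 0 < e / 2 by rewrite divr_gt0.
have [k _ /(_ k (leqnn k)) /= ke] := near_infty_natSinv_lt (PosNum e20).
have kk0 : 0 < k.+1%:R^-1 :> R by rewrite invr_gt0 ltr0n.
have /choice[c cP] : forall i : 'I_n.+1, exists q : rat,
    ratr q \in `]x ord0 i - k.+1%:R^-1, x ord0 i + k.+1%:R^-1[.
  by move=> i; apply: rat_in_itvoo; rewrite ltrD2l gtrN.
exists (\row_i c i, k) => //=; split.
  move=> i; rewrite !mxE; have := cP i; rewrite in_itv /= => /andP[h1 h2].
  move: (ratr _) h1 h2 => q h1 h2; move: (_^-1) {kk0 ke cP} h1 h2 => t h1 h2.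
  by apply/andP; split; lra.
move=> y yc; apply: eO; split => // i j; rewrite ord1 /ball /=.
have := cP j; have := yc j; rewrite !mxE in_itv /= => /andP[h1 h2] /andP[h3 h4].
move: (ratr _) h1 h2 h3 h4 => q h1 h2 h3 h4.
move: (k.+1%:R^-1) {kk0 cP yc} ke h1 h2 h3 h4 => t ke h1 h2 h3 h4.
by rewrite ltr_norml; apply/andP; split; lra.
Qed.

Definition boxes : set (set V) := [set A | exists a b, A = box a b].

Lemma measurable_boxesE : @measurable _ E = <<s boxes >>.
Proof.
apply/seteqP; split; last first.
  apply: smallest_sub; first exact: sigma_algebra_measurable.
  by move=> _ [a [b ->]]; exact: measurable_box.
apply: smallest_sub; first exact: smallest_sigma_algebra.
move=> O oO; rewrite (open_bigcup_box oO).
apply: (@countable_bigcupT_measurable _ (g_sigma_algebraType boxes)) => //.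
move=> p; set B := box _ _.
have [BO|BO] := pselect (B `<=` O).
  rewrite (_ : [set x | _] = B); first by apply: sub_sigma_algebra; do 2 eexists.
  by apply/seteqP; split => [x []|x].
rewrite (_ : [set x | _] = set0); first exact: measurable0.
by apply/seteqP; split => [x []|x].
Qed.

Lemma boxesI : setI_closed boxes.
Proof.
move=> _ _ [a [b ->]] [a' [b' ->]].
exists (\row_i Num.max (a ord0 i) (a' ord0 i)), (\row_i Num.min (b ord0 i) (b' ord0 i)).
apply/seteqP; split=> [x [h h'] i|x h].
  by rewrite !mxE ge_max le_min; have /andP[-> ->] := h i; have /andP[-> ->] := h' i.
split=> i; have := h i; rewrite !mxE ge_max le_min.
  by move=> /andP[/andP[-> _] /andP[-> _]].
by move=> /andP[/andP[_ ->] /andP[_ ->]].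
Qed.

Lemma norm_coord_le (x : V) (i : 'I_n.+1) : `|x ord0 i| <= `|x|.
Proof. by rewrite [leRHS]/Num.Def.normr /= mx_normrE; apply: (Order.TotalTheory.le_bigmax _ _ (ord0, i)). Qed.

Definition cube (k : R) : set V := box (const_mx (- k)) (const_mx k).

Lemma bigcup_cube : \bigcup_k cube k%:R = setT.
Proof.
apply/seteqP; split=> // x _; exists (Num.truncn `|x|).+1 => // i.
rewrite !mxE -ler_norml; apply: (@le_trans _ _ `|x|).
  exact: norm_coord_le.
exact/ltW/truncnS_gt.
Qed.

Variable lam : {measure set E -> \bar R}.
Hypothesis lamE : is_lebesgue_d lam.

Lemma box_empty (a b : V) : ~ (forall i, a ord0 i <= b ord0 i) -> box a b = set0.
Proof.
move=> ab; apply/seteqP; split => // x xab; apply: ab => i.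
by have /andP[/le_trans h /h] := xab i.
Qed.

Lemma lebesgue_box_lty a b : (lam (box a b) < +oo)%E.
Proof.
have [ab|ab] := pselect (forall i, a ord0 i <= b ord0 i).
  by rewrite lamE// ltry.
by rewrite box_empty// measure0.
Qed.

Lemma lebesgue_sigma_finite : sigma_finite setT lam.
Proof.
exists (fun k => cube k%:R); first by rewrite bigcup_cube.
by move=> k; split; [exact: measurable_box|exact: lebesgue_box_lty].
Qed.

(** Uniqueness of measures: [lam] and its translate agree on closed boxes, which are stable under
    intersection, generate the Borel sets and include an exhaustion by cubes of finite measure. *)
Lemma lebesgue_translation (c : V) (A : set E) : measurable A ->
  lam ((fun x : V => x - c) @^-1` A) = lam A.
Proof.
have mt : measurable_fun setT ((fun x : V => x - c) : E -> E).
  by apply: measurable_continuous_map => x; apply: continuousB; [by []|exact: cst_continuous].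
pose T : {mfun E >-> E} := HB.pack ((fun x : V => x - c) : E -> E)
  (isMeasurableFun.Build _ _ _ _ _ mt).
move=> mA; apply/esym.
apply: (@measure_unique _ R E boxes (fun k => cube k%:R) _ _ _ _ lam
  (pushforward lam T)) => //.
- exact: measurable_boxesE.
- exact: boxesI.
- by move=> k; do 2 eexists.
- exact: bigcup_cube.
- move=> _ [a [b ->]] /=; rewrite /pushforward.
  have -> : (fun x => x - c) @^-1` box a b = box (a + c) (b + c).
    by apply/seteqP; split=> x xab i; have := xab i;
       rewrite !mxE /= lerBrDr lerBlDr.
  have [ab|ab] := pselect (forall i, a ord0 i <= b ord0 i).
    rewrite !lamE// => [|i]; last by rewrite !mxE lerD2r.
    by congr (_%:E); apply: eq_bigr => i _; rewrite !mxE; ring.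
  rewrite !box_empty ?measure0// => h; apply: ab => i.
  by have := h i; rewrite !mxE lerD2r.
- by move=> k; exact: lebesgue_box_lty.
Qed.

End Lebesgue.

(** * Gaussian kernel and heat semigroup *)

Section GaussianPointwise.
Variables (R : realType) (n : nat).
Local Notation V := 'rV[R]_(n.+1).
Implicit Types (x y z : V) (s t r k A : R).

Definition dot x y : R := \sum_i x ord0 i * y ord0 i.
Definition enorm x : R := Num.sqrt (sqnorm x).

Lemma sqnorm_ge0 x : 0 <= sqnorm x.
Proof. by apply: sumr_ge0 => i _; rewrite sqr_ge0. Qed.

Lemma enorm_ge0 x : 0 <= enorm x. Proof. exact: sqrtr_ge0. Qed.

Lemma sqr_enorm x : enorm x ^+ 2 = sqnorm x.
Proof. by rewrite sqr_sqrtr// sqnorm_ge0. Qed.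

Lemma sqnormN x : sqnorm (- x) = sqnorm x.
Proof. by apply: eq_bigr => i _; rewrite mxE sqrrN. Qed.

Lemma sqnormBC x y : sqnorm (x - y) = sqnorm (y - x).
Proof. by rewrite -sqnormN opprB. Qed.

Lemma sqnormZ (c : R) x : sqnorm (c *: x) = c ^+ 2 * sqnorm x.
Proof. by rewrite /sqnorm mulr_sumr; apply: eq_bigr => i _; rewrite mxE exprMn. Qed.

Lemma sqnormB x z : sqnorm (x - z) = sqnorm x - 2 * dot x z + sqnorm z.
Proof.
rewrite /sqnorm /dot mulr_sumr -sumrB -big_split /=.
by apply: eq_bigr => i _; rewrite !mxE; ring.
Qed.

Lemma dotZr (c : R) x y : dot x (c *: y) = c * dot x y.
Proof. by rewrite /dot mulr_sumr; apply: eq_bigr => i _; rewrite mxE; ring. Qed.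

Lemma dot_enorm x y : `|dot x y| <= enorm x * enorm y.
Proof.
suff h : dot x y ^+ 2 <= sqnorm x * sqnorm y.
  rewrite -(ger0_norm (mulr_ge0 (enorm_ge0 x) (enorm_ge0 y))) -ler_sqr ?nnegrE//.
  by rewrite !real_normK ?num_real// exprMn !sqr_enorm.
have [x0|x0] := eqVneq (sqnorm x) 0.
  suff -> : dot x y = 0 by rewrite expr0n x0 mul0r.
  rewrite /dot big1// => i _; suff -> : x ord0 i = 0 by rewrite mul0r.
  apply/eqP; rewrite -sqrf_eq0; apply/eqP.
  have /eqP := x0; rewrite psumr_eq0 => [|j _]; last exact: sqr_ge0.
  by move=> /allP /(_ i (mem_index_enum i)) /implyP /(_ isT) /eqP.
have xp : 0 < sqnorm x by rewrite lt_neqAle eq_sym x0 sqnorm_ge0.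
have : 0 <= sqnorm (y - (dot x y / sqnorm x) *: x) by exact: sqnorm_ge0.
rewrite sqnormB sqnormZ dotZr.
have -> : dot y x = dot x y by apply: eq_bigr => i _; rewrite mulrC.
have -> : sqnorm y - 2 * (dot x y / sqnorm x * dot x y) +
  (dot x y / sqnorm x) ^+ 2 * sqnorm x = (sqnorm x * sqnorm y - dot x y ^+ 2) / sqnorm x.
  by field.
by rewrite pmulr_lge0 ?invr_gt0// subr_ge0.
Qed.

Lemma expR_sub1 (u : R) : `|expR u - 1| <= `|u| * expR `|u|.
Proof.
have e1 := expR_ge1Dx u; have e2 := expR_ge1Dx (- u).
have E : expR u * expR (- u) = 1 by rewrite -expRD subrr expR0.
have u0 : 0 < expR u := expR_gt0 u.
have n1 : 1 <= expR `|u| by rewrite -expR0 ler_expR.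
have n2 : expR u <= expR `|u| by rewrite ler_expR ler_norm.
rewrite ler_norml; apply/andP; split.
  have := ler_norm (- u); rewrite normrN => h.
  have : `|u| * 1 <= `|u| * expR `|u| by rewrite ler_wpM2l.
  by lra.
have h : expR u - 1 <= u * expR u by nra.
apply: (le_trans h); apply: (@le_trans _ _ (`|u| * expR u)).
  by rewrite ler_wpM2r// ?ler_norm// ltW.
by rewrite ler_wpM2l.
Qed.

(** The normalising constant of the Gaussian, which is also its maximum. *)
Definition gc (t : R) : R := ((Num.sqrt (2 * pi * t)) ^+ n.+1)^-1.

Lemma gauss_gcE t x : gauss_density t x = gc t * expR (- sqnorm x / (2 * t)).
Proof. by []. Qed.

Lemma gc_gt0 t : 0 < t -> 0 < gc t.
Proof. by move=> t0; rewrite invr_gt0 exprn_gt0// sqrtr_gt0 !mulr_gt0// pi_gt0. Qed.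

Lemma gauss_gt0 t x : 0 < t -> 0 < gauss_density t x.
Proof. by move=> t0; rewrite mulr_gt0 ?gc_gt0// expR_gt0. Qed.

Lemma gauss_le_gc t x : 0 < t -> gauss_density t x <= gc t.
Proof.
move=> t0; rewrite gauss_gcE ler_piMr ?(ltW (gc_gt0 t0))// -expR0 ler_expR.
by rewrite mulNr oppr_le0 divr_ge0 ?sqnorm_ge0// mulr_ge0// ltW.
Qed.

Lemma gc_le s t : 0 < s -> s <= t -> gc t <= gc s.
Proof.
move=> s0 st; have t0 := lt_le_trans s0 st.
rewrite lef_pV2 ?posrE ?exprn_gt0 ?sqrtr_gt0 ?mulr_gt0 ?pi_gt0//.
by apply: lerXn2r; rewrite ?nnegrE ?sqrtr_ge0// ler_wsqrtr// ler_pM2l// mulr_gt0 ?pi_gt0.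
Qed.

Lemma gc_scale k t : 0 < k -> 0 < t -> gc t = Num.sqrt k ^+ n.+1 * gc (k * t).
Proof.
move=> k0 t0; rewrite /gc (_ : 2 * pi * (k * t) = k * (2 * pi * t)); last by ring.
rewrite (sqrtrM (2 * pi * t) (ltW k0)) exprMn invfM mulrA mulfV ?mul1r//.
by rewrite expf_neq0// gt_eqF// sqrtr_gt0.
Qed.

Lemma gauss_scale k t x : 0 < k -> 0 < t -> gauss_density t x =
  Num.sqrt k ^+ n.+1 * gauss_density (k * t) x *
  expR (- sqnorm x / (2 * t) * (1 - k^-1)).
Proof.
move=> k0 t0; rewrite !gauss_gcE (gc_scale k0 t0) -!mulrA -expRD.
congr (_ * (_ * expR _)); field.
by rewrite !gt_eqF.
Qed.

(** This is 2^(d/2), the price of doubling the time in the Gaussian prefactor. *)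
Definition kap : R := Num.sqrt 2 ^+ n.+1.

Lemma kap_ge1 : 1 <= kap.
Proof. by rewrite exprn_ege1// -{1}sqrtr1 ler_wsqrtr// ler1n. Qed.

Lemma gauss_double t x : 0 < t -> gauss_density t x =
  kap * gauss_density (2 * t) x * expR (- (sqnorm x / (4 * t))).
Proof.
move=> t0; rewrite (@gauss_scale 2)//; congr (_ * expR _); field.
by rewrite gt_eqF.
Qed.

(** Half of the Gaussian exponent absorbs the polynomial: [gauss_double] leaves exp (-y) with y =
    |x|^2 / (4 t), and y exp (-y) <= 1. Moments then need no integration beyond the total mass of
    p_2t. *)
Lemma gauss_moment2 t x : 0 < t ->
  sqnorm x * gauss_density t x <= 4 * kap * t * gauss_density (2 * t) x.
Proof.
move=> t0; rewrite gauss_double//; set y := sqnorm x / (4 * t).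
have -> : sqnorm x = 4 * t * y by rewrite /y; field; rewrite gt_eqF.
have t20 : 0 < 2 * t by rewrite mulr_gt0.
rewrite (_ : _ * (_ * _) = 4 * kap * t * gauss_density (2 * t) x * (y * expR (- y))); last by ring.
rewrite ler_piMr//; first by rewrite !mulr_ge0// ?(ltW t0) ?(ltW (gauss_gt0 _ _))// ltW// (lt_le_trans ltr01)// kap_ge1.
rewrite expRN ler_pdivrMr ?expR_gt0// mul1r; have := expR_ge1Dx y; lra.
Qed.

Lemma gauss_moment4 t x : 0 < t ->
  sqnorm x ^+ 2 * gauss_density t x <= 64 * kap * t ^+ 2 * gauss_density (2 * t) x.
Proof.
move=> t0; rewrite gauss_double//; set y := sqnorm x / (4 * t).
have -> : sqnorm x = 4 * t * y by rewrite /y; field; rewrite gt_eqF.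
have t20 : 0 < 2 * t by rewrite mulr_gt0.
have y0 : 0 <= y by rewrite divr_ge0 ?sqnorm_ge0// mulr_ge0// ltW.
rewrite (_ : _ * (_ * _) = 64 * kap * t ^+ 2 * gauss_density (2 * t) x *
   ((y / 2) ^+ 2 * expR (- y))); last by field.
rewrite ler_piMr//; first by rewrite !mulr_ge0 ?sqr_ge0// ?(ltW t0) ?(ltW (gauss_gt0 _ _))// ltW// (lt_le_trans ltr01)// kap_ge1.
rewrite expRN ler_pdivrMr ?expR_gt0// mul1r.
have -> : expR y = expR (y / 2) ^+ 2 by rewrite -expRM_natl; congr expR; field.
have y20 : 0 <= y / 2 by lra.
apply: lerXn2r; rewrite ?nnegrE ?expR_ge0//.
have := expR_ge1Dx (y / 2); lra.
Qed.

(** Complete the square in y. The second factor on the right has mass one in y, so integration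
    yields the convolution rule. *)
Lemma gauss_convolution s r x y : 0 < s -> 0 < r ->
  gauss_density s (x - y) * gauss_density r y =
  gauss_density (s + r) x * gauss_density (s * r / (s + r)) (y - (r / (s + r)) *: x).
Proof.
move=> s0 r0; have sr0 : 0 < s + r by rewrite addr_gt0.
have srr : 0 < s * r / (s + r) by rewrite divr_gt0 ?mulr_gt0.
rewrite !gauss_gcE mulrACA [RHS]mulrACA; congr (_ * _).
  rewrite /gc -!invfM -!exprMn -!sqrtrM ?mulr_ge0 ?pi_ge0 ?(ltW s0) ?(ltW sr0)//.
  by congr ((Num.sqrt _ ^+ _)^-1); field; rewrite gt_eqF.
rewrite -!expRD; congr expR; rewrite !sqnormB sqnormZ dotZr.
have -> : dot y x = dot x y by apply: eq_bigr => i _; rewrite mulrC.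
by field; rewrite !gt_eqF.
Qed.

(** The factor 8^(d/2) is lost in the prefactor between p_t and p_8t. The 6 is the maximum, at X =
    4, of 3 X - 3 X^2 / 8, the exponent left in [gauss_diff] when |x| = X sqrt t with X > A. *)
Definition Cg : R := expR 6 * Num.sqrt 8 ^+ n.+1.

Lemma Cg_ge1 : 1 <= Cg.
Proof.
rewrite mulr_ege1//; first by rewrite -expR0 ler_expR.
by rewrite exprn_ege1// -{1}sqrtr1 ler_wsqrtr// ler1n.
Qed.

(* For |x| <= A sqrt t the exponent moves by O(A |z| / sqrt t); beyond, the extra
   factor is absorbed by passing from t to 8 t, at the gain exp (- A^2 / 16). *)
Lemma gauss_diff t A x z : 0 < t -> 1 <= A -> A * enorm z <= Num.sqrt t ->
  `|gauss_density t (x - z) - gauss_density t x| <=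
  Cg * (enorm z / Num.sqrt t) *
  (A * gauss_density t x + expR (- (A ^+ 2 / 16)) * gauss_density (8 * t) x).
Proof.
move=> t0 A1 Az; set q := Num.sqrt t.
have q0 : 0 < q by rewrite sqrtr_gt0.
have qq : q ^+ 2 = t by rewrite sqr_sqrtr// ltW.
pose a := enorm z / q; pose X := enorm x / q; pose c := dot x z / t.
have a0 : 0 <= a by rewrite divr_ge0 ?enorm_ge0// ltW.
have X0 : 0 <= X by rewrite divr_ge0 ?enorm_ge0// ltW.
have Aa1 : A * a <= 1 by rewrite /a mulrA ler_pdivrMr// mul1r.
have a1 : a <= 1 by apply: le_trans Aa1; rewrite ler_peMl.
have tn0 : t != 0 by rewrite gt_eqF.
have xE : sqnorm x = t * X ^+ 2.
  by rewrite -sqr_enorm /X -qq; field; rewrite gt_eqF.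
have zE : sqnorm z = t * a ^+ 2.
  by rewrite -sqr_enorm /a -qq; field; rewrite gt_eqF.
have dE : dot x z = t * c by rewrite /c; field.
have cX : `|c| <= a * X.
  rewrite /c normrM normfV (gtr0_norm t0) ler_pdivrMr//.
  rewrite (_ : a * X * t = enorm x * enorm z) ?dot_enorm//.
  by rewrite /a /X -qq; field; rewrite gt_eqF.
pose u := c - a ^+ 2 / 2.
have pE : gauss_density t (x - z) = gauss_density t x * expR u.
  rewrite !gauss_gcE -mulrA -expRD; congr (_ * expR _).
  by rewrite sqnormB dE xE zE /u; field.
have uX : `|u| <= a * (X + 2^-1).
  rewrite /u (le_trans (ler_normB _ _))// mulrDr lerD//.
  rewrite ger0_norm ?divr_ge0 ?sqr_ge0//; nra.
rewrite -/a; clearbody u a X c.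
rewrite pE -[X in _ - X]mulr1 -mulrBr normrM (gtr0_norm (gauss_gt0 _ t0)).
have A0 : 0 <= A by lra.
have C0 : 0 <= Cg by rewrite (le_trans ler01)// Cg_ge1.
have p0 := gauss_gt0 x t0.
have t80 : 0 < 8 * t by rewrite mulr_gt0.
have p80 := gauss_gt0 x t80.
have [XA|XA] := leP X A.
  have u32 : `|u| <= a * (3 / 2 * A) by apply: (le_trans uX); rewrite ler_wpM2l//; lra.
  have u3 : `|u| <= 3 / 2 by apply: (le_trans u32); lra.
  have e3 : expR `|u| <= expR (3 / 2) by rewrite ler_expR.
  have e0 := expR_gt0 `|u|.
  have le1 : `|expR u - 1| <= Cg * a * A.
    apply: (le_trans (expR_sub1 u)).
    apply: (@le_trans _ _ (a * (3 / 2 * A) * expR (3 / 2))).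
      by rewrite ler_pM// ltW.
    rewrite [leLHS](_ : _ = (3 / 2 * expR (3 / 2)) * (a * A)); last by ring.
    rewrite [leRHS](_ : _ = Cg * (a * A)); last by ring.
    have aA : 0 <= a * A by rewrite mulr_ge0.
    apply: ler_wpM2r => //.
    apply: (@le_trans _ _ (expR 6)).
      have -> : expR 6 = expR (9 / 2) * expR (3 / 2) :> R.
        by rewrite -expRD; congr expR; field.
      apply: ler_wpM2r; first exact: expR_ge0.
      by have := expR_ge1Dx (9 / 2 : R); lra.
    rewrite /Cg ler_peMr ?expR_ge0// exprn_ege1//.
    by rewrite -{1}sqrtr1 ler_wsqrtr// ler1n.
  apply: (@le_trans _ _ (gauss_density t x * (Cg * a * A))).
    by rewrite ler_wpM2l// ltW.
  rewrite [leLHS](_ : _ = Cg * a * (A * gauss_density t x)); last by ring.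
  by rewrite ler_wpM2l// ?lerDl ?mulr_ge0 ?expR_ge0 ?(ltW p80).
have X1 : 1 < X by apply: le_lt_trans XA.
have u32 : `|u| <= a * (3 / 2 * X) by apply: (le_trans uX); rewrite ler_wpM2l//; lra.
have u3 : `|u| <= 3 / 2 * X by apply: (le_trans u32); rewrite ler_piMl//; lra.
apply: (@le_trans _ _ (Cg * a * (expR (- (A ^+ 2 / 16)) * gauss_density (8 * t) x))); last first.
  by rewrite ler_wpM2l ?lerDr// ?mulr_ge0// ltW.
apply: (@le_trans _ _ (gauss_density t x * (a * (3 / 2 * X) * expR (3 / 2 * X)))).
  rewrite ler_wpM2l ?(ltW p0)//; apply: (le_trans (expR_sub1 u)).
  by rewrite ler_pM ?expR_ge0// ler_expR.
rewrite (@gauss_scale 8)// xE.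
set s8 := Num.sqrt 8 ^+ n.+1.
have s80 : 0 < s8 by rewrite exprn_gt0// sqrtr_gt0.
rewrite (_ : - (t * X ^+ 2) / (2 * t) * (1 - 8^-1) = - (7 / 16 * X ^+ 2)); last by field.
rewrite [leLHS](_ : _ = (s8 * gauss_density (8 * t) x * a) *
   ((3 / 2 * X) * expR (3 / 2 * X) * expR (- (7 / 16 * X ^+ 2)))); last by ring.
rewrite [leRHS](_ : _ = (s8 * gauss_density (8 * t) x * a) *
   (expR 6 * expR (- (A ^+ 2 / 16)))); last by rewrite /Cg -/s8; ring.
rewrite ler_wpM2l ?mulr_ge0 ?(ltW s80) ?(ltW p80)//.
rewrite -expRD; apply: (@le_trans _ _ (expR (3 / 2 * X) * expR (3 / 2 * X) *
    expR (- (7 / 16 * X ^+ 2)))).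
  rewrite !ler_wpM2r ?expR_ge0//; have := expR_ge1Dx (3 / 2 * X); lra.
rewrite -!expRD ler_expR.
have : A ^+ 2 <= X ^+ 2 by rewrite lerXn2r ?nnegrE//; lra.
have := sqr_ge0 (X - 4); nra.
Qed.

Lemma gauss_lipschitz t x z : 0 < t ->
  `|gauss_density t (x - z) - gauss_density t x| <= 2 * Cg * gc t / Num.sqrt t * enorm z.
Proof.
move=> t0; have q0 : 0 < Num.sqrt t by rewrite sqrtr_gt0.
have t80 : 0 < 8 * t by rewrite mulr_gt0.
have g0 := gc_gt0 t0; have C1 := Cg_ge1.
have [zq|qz] := leP (enorm z) (Num.sqrt t).
  have := @gauss_diff t 1 x z t0 (lexx _); rewrite mul1r => /(_ zq) h.
  apply: (le_trans h).
  rewrite (_ : 2 * _ * _ / _ * _ = Cg * (enorm z / Num.sqrt t) * (2 * gc t)); last by ring.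
  have C0 : 0 <= Cg by rewrite (le_trans ler01).
  have e0 : 0 <= enorm z / Num.sqrt t by rewrite divr_ge0 ?enorm_ge0// ltW.
  apply: ler_wpM2l; first by rewrite mulr_ge0.
  rewrite mul1r (_ : 2 * gc t = gc t + gc t); last by ring.
  apply: lerD; first exact: gauss_le_gc.
  apply: (@le_trans _ _ (gauss_density (8 * t) x)).
    apply: ler_piMl; first exact: ltW (gauss_gt0 _ t80).
    by rewrite -[leRHS]expR0 ler_expR; lra.
  apply: (le_trans (gauss_le_gc _ t80)); apply: gc_le => //; lra.
apply: (@le_trans _ _ (gc t)).
  have := gauss_le_gc x t0; have := gauss_le_gc (x - z) t0.
  have := gauss_gt0 x t0; have := gauss_gt0 (x - z) t0.
  by rewrite ler_norml => *; apply/andP; split; lra.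
have e1 : 1 <= enorm z / Num.sqrt t by rewrite ler_pdivlMr// mul1r ltW.
rewrite (_ : 2 * _ * _ / _ * _ = gc t * (2 * Cg * (enorm z / Num.sqrt t))); last by ring.
by rewrite ler_peMr ?(ltW g0)// mulr_ege1//; lra.
Qed.

End GaussianPointwise.

Section Heat.
Variables (R : realType) (n : nat).
Local Notation V := 'rV[R]_(n.+1).
Local Notation E := (Rd R n).
Variable lam : {sigma_finite_measure set E -> \bar R}.
Hypothesis lamE : is_lebesgue_d lam.
Hypothesis lam_gauss : forall t : R, 0 < t -> gauss lam t setT = 1%E.
Implicit Types (x y z : V) (s t r : R) (f g psi : V -> R).

Definition pk t x y : R := gauss_density t (y - x).

Lemma pkC t x y : pk t x y = pk t y x.
Proof. by rewrite /pk !gauss_gcE sqnormBC. Qed.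

Lemma pk_gt0 t x y : 0 < t -> 0 < pk t x y. Proof. exact: gauss_gt0. Qed.

Lemma pk_ge0 t x y : 0 < t -> 0 <= pk t x y.
Proof. by move=> t0; rewrite ltW// pk_gt0. Qed.

Lemma pk_le_gc t x y : 0 < t -> pk t x y <= gc n t. Proof. exact: gauss_le_gc. Qed.

Lemma measurable_sqnorm_sub (d : measure_display) (T : measurableType d)
    (X Y : T -> E) :
  measurable_fun setT X -> measurable_fun setT Y ->
  measurable_fun setT (fun w => sqnorm ((Y w : V) - (X w : V))).
Proof.
move=> mX mY; apply: measurable_sum => i.
rewrite (_ : (fun _ => _) = fun w => ((Y w : V) ord0 i - (X w : V) ord0 i) ^+ 2); last first.
  by apply/funext => w; rewrite !mxE.
apply: measurable_funX; apply: measurable_funB.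
- exact: (measurableT_comp (measurable_coord i) mY).
- exact: (measurableT_comp (measurable_coord i) mX).
Qed.

Lemma measurable_pk_comp (d : measure_display) (T : measurableType d)
    (X Y : T -> E) t :
  measurable_fun setT X -> measurable_fun setT Y ->
  measurable_fun setT (fun w => pk t (X w) (Y w)).
Proof.
move=> mX mY; apply: measurable_funM; first exact: measurable_cst.
apply: measurableT_comp; first exact: measurable_expR.
apply: measurable_funM; last exact: measurable_cst.
by apply: measurable_funN; exact: measurable_sqnorm_sub.
Qed.

Lemma measurable_pk t x : measurable_fun setT (pk t x : E -> R).
Proof. by apply: measurable_pk_comp; [exact: measurable_cst|exact: measurable_id]. Qed.

Lemma measurable_sqnorm x : measurable_fun setT ((fun y => sqnorm (y - x)) : E -> R).
Proof. by apply: measurable_sqnorm_sub; [exact: measurable_cst|exact: measurable_id]. Qed.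

Lemma ge0_integral_translation x (g : E -> \bar R) : measurable_fun setT g ->
  (forall y, 0 <= g y)%E ->
  (\int[lam]_y g ((y : V) - x)%R = \int[lam]_y g y)%E.
Proof.
move=> mg g0.
have mt : measurable_fun setT ((fun y : V => y - x) : E -> E).
  by apply: measurable_continuous_map => y; apply: continuousB; [by []|exact: cst_continuous].
have := @ge0_integral_pushforward _ _ E E R _ mt lam setT g measurableT mg (fun y _ => g0 y).
rewrite preimage_setT => <-; apply: eq_measure_integral => A mA _.
exact: (lebesgue_translation lamE x mA).
Qed.

Lemma integral_pk t x : 0 < t -> (\int[lam]_y (pk t x y)%:E = 1)%E.
Proof.
move=> t0; rewrite -(lam_gauss t0) /gauss.
rewrite (@ge0_integral_translation x (fun y : E => (gauss_density t y)%:E))//.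
- have -> : (fun y : E => (gauss_density t y)%:E) = EFin \o pk t 0.
    by apply/funext => y; rewrite /= /pk subr0.
  by apply/measurable_EFinP; exact: measurable_pk.
- by move=> y; rewrite lee_fin ltW// gauss_gt0.
Qed.

Lemma rint_pk t x : 0 < t -> rint lam (pk t x).
Proof.
move=> t0; apply/integrableP; split; first by apply/measurable_EFinP; exact: measurable_pk.
under eq_integral do rewrite /= ger0_norm ?pk_ge0//.
by rewrite integral_pk// ltry.
Qed.

Lemma Rint_pk t x : 0 < t -> \int[lam]_y pk t x y = 1.
Proof. by move=> t0; rewrite /Rintegral integral_pk. Qed.

Definition bmeas f (M : R) := measurable_fun setT (f : E -> R) /\ forall x, `|f x| <= M.

Definition heat t f : V -> R := fun x => \int[lam]_y (f y * pk t x y).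

Local Notation hP := heat.

Lemma rint_bpk t f (M : R) x : 0 < t -> bmeas f M -> rint lam (fun y => f y * pk t x y).
Proof.
move=> t0 [mf fM]; under eq_fun do rewrite mulrC.
exact: rintM (rint_pk x t0) mf fM.
Qed.

Lemma rint_ipk t f x : 0 < t -> rint lam f -> rint lam (fun y => f y * pk t x y).
Proof.
move=> t0 fi; apply: (rintM fi (measurable_pk t x) (M := gc n t)) => y.
by rewrite ger0_norm ?pk_ge0// pk_le_gc.
Qed.

Lemma measurable_hP t f : measurable_fun setT (f : E -> R) ->
  measurable_fun setT (hP t f : E -> R).
Proof.
move=> mf; pose F (p : E * E) : \bar R := (f p.2 * pk t p.1 p.2)%:E.
have mF : measurable_fun setT F.
  apply/measurable_EFinP; apply: measurable_funM.
    exact: (measurableT_comp mf measurable_snd).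
  by apply: measurable_pk_comp; [exact: measurable_fst|exact: measurable_snd].
apply: (measurableT_comp (fine_measurable measurableT)).
rewrite (_ : (fun _ => _) = fun x : E =>
  (\int[lam]_y (F^\+ (x, y)) - \int[lam]_y (F^\- (x, y)))%E); last first.
  apply/funext => x; rewrite [LHS]integralE.
  by congr (_ - _)%E; apply: eq_integral => y _; rewrite ?funeposE ?funenegE.
apply: emeasurable_funB.
- by apply: (measurable_fun_fubini_tonelli_F (m2 := lam)) => //; exact: measurable_funepos.
- by apply: (measurable_fun_fubini_tonelli_F (m2 := lam)) => //; exact: measurable_funeneg.
Qed.

Lemma hP_le t f (M : R) x : 0 < t -> bmeas f M -> `|hP t f x| <= M.
Proof.
move=> t0 fM; have M0 : 0 <= M := le_trans (normr_ge0 _) (fM.2 x).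
have := norm_Rint_le (rint_bpk x t0 fM) (rintZ M (rint_pk x t0)).
rewrite RintZ ?rint_pk// Rint_pk// mulr1; apply => y.
by rewrite normrM (ger0_norm (pk_ge0 _ _ t0)) ler_wpM2r ?pk_ge0//; exact: fM.2.
Qed.

Lemma bmeas_hP t f (M : R) : 0 < t -> bmeas f M -> bmeas (hP t f) M.
Proof. by move=> t0 fM; split; [exact: measurable_hP fM.1|move=> x; exact: hP_le]. Qed.

Lemma bmeasB f g (M N : R) : bmeas f M -> bmeas g N -> bmeas (fun x => f x - g x) (M + N).
Proof.
move=> [mf fM] [mg gN]; split; first exact: measurable_funB.
by move=> x; rewrite (le_trans (ler_normB _ _))// lerD.
Qed.

Lemma bmeasM f g (M N : R) : bmeas f M -> bmeas g N -> bmeas (fun x => f x * g x) (M * N).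
Proof.
move=> [mf fM] [mg gN]; split; first exact: measurable_funM.
by move=> x; rewrite normrM ler_pM.
Qed.

Lemma bmeas_cst (c : R) : bmeas (fun=> c) `|c|.
Proof. by split => //; exact: measurable_cst. Qed.

Lemma bmeas_sum (I : Type) (s : seq I) (F : I -> V -> R) (M : R) :
  (forall i, bmeas (F i) M) -> bmeas (fun x => \sum_(i <- s) F i x) ((size s)%:R * M).
Proof.
move=> FM; split; first by apply: measurable_sum => i; exact: (FM i).1.
elim: s => [|i s ih] x; first by rewrite big_nil normr0 mul0r.
rewrite big_cons /= (le_trans (ler_normD _ _))// -natr1 mulrDl mul1r addrC.
by rewrite lerD//; exact: (FM i).2.
Qed.

Lemma hPD t f g (M N : R) x : 0 < t -> bmeas f M -> bmeas g N ->
  hP t (fun y => f y + g y) x = hP t f x + hP t g x.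
Proof.
move=> t0 fM gN; rewrite -RintD ?(rint_bpk x t0 fM) ?(rint_bpk x t0 gN)//.
by apply: eq_Rint => y; rewrite mulrDl.
Qed.

Lemma hPB t f g (M N : R) x : 0 < t -> bmeas f M -> bmeas g N ->
  hP t (fun y => f y - g y) x = hP t f x - hP t g x.
Proof.
move=> t0 fM gN; rewrite -RintB ?(rint_bpk x t0 fM) ?(rint_bpk x t0 gN)//.
by apply: eq_Rint => y; rewrite mulrBl.
Qed.

Lemma hPZ t f (M c : R) x : 0 < t -> bmeas f M ->
  hP t (fun y => c * f y) x = c * hP t f x.
Proof.
move=> t0 fM; rewrite -RintZ ?(rint_bpk x t0 fM)//.
by apply: eq_Rint => y; rewrite mulrA.
Qed.

Lemma hP_cst t (c : R) x : 0 < t -> hP t (fun=> c) x = c.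
Proof. by move=> t0; rewrite /hP RintZ ?rint_pk// Rint_pk// mulr1. Qed.

Lemma hP_sum t (I : Type) (s : seq I) (F : I -> V -> R) (M : R) x : 0 < t ->
  (forall i, bmeas (F i) M) ->
  hP t (fun y => \sum_(i <- s) F i y) x = \sum_(i <- s) hP t (F i) x.
Proof.
move=> t0 FM; rewrite -Rint_sum; last by move=> i; exact: rint_bpk (FM i).
by apply: eq_Rint => y; rewrite mulr_suml.
Qed.

Lemma hP_ge0 t f x : 0 < t -> (forall y, 0 <= f y) -> 0 <= hP t f x.
Proof. by move=> t0 f0; apply: Rint_ge0 => y; rewrite mulr_ge0 ?pk_ge0. Qed.

Lemma Rint_Mb psi f (M : R) : rint lam psi -> bmeas f M -> rint lam (fun x => psi x * f x).
Proof. by move=> psi_i fM; exact: rintM psi_i fM.1 fM.2. Qed.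

Lemma hP_prod_integrable t psi f (M : R) : 0 < t -> rint lam psi -> bmeas f M ->
  (lam \x lam)%E.-integrable setT
    (fun p : E * E => (psi p.1 * (f p.2 * pk t p.1 p.2))%:E).
Proof.
move=> t0 psi_i fM.
have M0 : 0 <= M := le_trans (normr_ge0 _) (fM.2 0).
pose F (p : E * E) : \bar R := (psi p.1 * (f p.2 * pk t p.1 p.2))%:E.
have mF : measurable_fun setT F.
  apply/measurable_EFinP; apply: measurable_funM.
    exact: (measurableT_comp (rint_measurable psi_i) measurable_fst).
  apply: measurable_funM; first exact: (measurableT_comp fM.1 measurable_snd).
  by apply: measurable_pk_comp; [exact: measurable_fst|exact: measurable_snd].
apply: (@integrable12ltyP _ _ E E R lam lam _ mF).2.
apply: (@le_lt_trans _ _ (\int[lam]_x (M * `|psi x|)%:E)%E); last first.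
  rewrite -RintE ?ltry//; exact/rintZ/rint_norm.
apply: ge0_le_integral => //.
- by move=> x _; apply: integral_ge0.
- apply: (measurable_fun_fubini_tonelli_F (m2 := lam) (abse \o F)).
    exact: measurableT_comp.
  by move=> p; exact: abse_ge0.
- apply/measurable_EFinP; apply: measurable_funM => //.
  by apply: measurableT_comp => //; exact: rint_measurable psi_i.
move=> x _.
have i1 : rint lam (fun y => M * `|psi x| * pk t x y) by exact/rintZ/rint_pk.
apply: (@le_trans _ _ (\int[lam]_y (M * `|psi x| * pk t x y)%:E)%E).
  apply: ge0_le_integral => //.
  - apply/measurable_EFinP; apply: measurableT_comp => //.
    apply: (measurable_funM (measurable_cst (psi x))).
    by apply: measurable_funM; [exact: fM.1|exact: measurable_pk].
  - by apply/measurable_EFinP; apply: measurable_funM => //; exact: measurable_pk.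
  - move=> y _; rewrite lee_fin /= (normrM (psi x)) (normrM (f y)) (ger0_norm (pk_ge0 _ _ t0)) mulrA.
    rewrite ler_wpM2r ?pk_ge0// mulrC ler_wpM2r//; exact: fM.2.
by rewrite -RintE// RintZ ?rint_pk// Rint_pk// mulr1.
Qed.

(** Fubini together with the symmetry of the kernel. Self-adjointness is what moves the semigroup
    from test functions onto [psi] later on. *)
Lemma hP_dual t psi f (M : R) : 0 < t -> rint lam psi -> bmeas f M ->
  \int[lam]_x (psi x * hP t f x) = \int[lam]_x (f x * hP t psi x).
Proof.
move=> t0 psi_i fM; rewrite /Rintegral; congr fine.
have F := @Fubini _ _ E E R lam lam _ (hP_prod_integrable t0 psi_i fM).
transitivity (\int[lam]_x \int[lam]_y (psi x * (f y * pk t x y))%:E)%E.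
  apply: eq_integral => x _.
  have i1 := rint_bpk x t0 fM.
  by rewrite -(RintE (rintZ (psi x) i1)) (RintZ (psi x) i1).
rewrite [LHS]F; apply: eq_integral => y _.
transitivity (\int[lam]_x (f y * (psi x * pk t y x))%:E)%E.
  by apply: eq_integral => x _; congr (_%:E); rewrite [pk t y x]pkC; ring.
have i1 := rint_ipk y t0 psi_i.
by rewrite -(RintE (rintZ (f y) i1)) (RintZ (f y) i1).
Qed.

Lemma pk_conv s r x z : 0 < s -> 0 < r -> hP r (pk s x) z = pk (s + r) x z.
Proof.
move=> s0 r0; rewrite /hP.
have tt0 : 0 < r * s / (r + s) by rewrite divr_gt0 ?mulr_gt0 ?addr_gt0.
pose c := x + (s / (r + s)) *: (z - x).
transitivity (\int[lam]_y (pk (s + r) x z * pk (r * s / (r + s)) c y)).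
  apply: eq_Rint => y; rewrite mulrC [pk r z y]pkC /pk.
  rewrite -[z - y](_ : (z - x) - (y - x) = _); last by rewrite opprB addrA subrK.
  by rewrite (gauss_convolution (z - x) (y - x) r0 s0) (addrC s r) /c opprD addrA.
by rewrite RintZ ?rint_pk// Rint_pk// mulr1.
Qed.

(** Self-adjointness of P_r, applied to the kernel p_s(x, .), reduces the semigroup law to [pk_conv]
    and avoids a second use of Fubini. *)
Lemma hP_semigroup s r f (M : R) x : 0 < s -> 0 < r -> bmeas f M ->
  hP s (hP r f) x = hP (s + r) f x.
Proof.
move=> s0 r0 fM; have := hP_dual r0 (rint_pk x s0) fM.
rewrite {1 2}/hP => E1; rewrite {1}/hP.
under eq_Rint do rewrite mulrC.
rewrite E1; apply: eq_Rint => y; congr (_ * _).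
exact: pk_conv.
Qed.

Lemma rint_hP t psi : 0 < t -> rint lam psi -> rint lam (hP t psi).
Proof.
move=> t0 psi_i.
have b1 : bmeas (fun=> 1) 1 by split => [|x]; rewrite ?normr1//; exact: measurable_cst.
have iF := hP_prod_integrable t0 psi_i b1.
have mF := measurable_int _ iF.
apply/integrableP; split.
  by apply/measurable_EFinP; apply: measurable_hP; exact: rint_measurable psi_i.
apply: le_lt_trans ((@integrable21ltyP _ _ E E R lam lam _ mF).1 iF).
apply: ge0_le_integral => //.
- apply/measurable_EFinP; apply: measurableT_comp => //.
  by apply: measurable_hP; exact: rint_measurable psi_i.
- apply: (measurable_fun_fubini_tonelli_G (m1 := lam)
    (abse \o (fun p : E * E => (psi p.1 * (1 * pk t p.1 p.2))%:E))).
    exact: measurableT_comp.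
  by move=> p; exact: abse_ge0.
move=> y _ /=.
have E1 : (fun x => (`|psi x * (1 * pk t x y)|)%:E) = fun x => (`|psi x * pk t y x|)%:E.
  by apply/funext => x; rewrite mul1r pkC.
rewrite E1 -RintE; last exact/rint_norm/rint_ipk.
by rewrite lee_fin; apply: le_normr_Rintegral => //; exact: rint_ipk.
Qed.

Lemma rint_moment2 t x : 0 < t -> rint lam (fun y => sqnorm (y - x) * pk t x y).
Proof.
move=> t0; have t20 : 0 < 2 * t by rewrite mulr_gt0.
apply: (le_rint _ _ (rintZ (4 * kap R n * t) (rint_pk x t20))).
- by apply: measurable_funM; [exact: measurable_sqnorm|exact: measurable_pk].
- by move=> y; rewrite ger0_norm ?gauss_moment2// mulr_ge0 ?sqnorm_ge0 ?pk_ge0.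
Qed.

Lemma Rint_moment2 t x : 0 < t ->
  \int[lam]_y (sqnorm (y - x) * pk t x y) <= 4 * kap R n * t.
Proof.
move=> t0; have t20 : 0 < 2 * t by rewrite mulr_gt0.
have := le_Rint (rint_moment2 x t0) (rintZ (4 * kap R n * t) (rint_pk x t20)).
rewrite RintZ ?rint_pk// Rint_pk// mulr1; apply => y.
exact: gauss_moment2.
Qed.

Lemma rint_moment4 t x : 0 < t -> rint lam (fun y => sqnorm (y - x) ^+ 2 * pk t x y).
Proof.
move=> t0; have t20 : 0 < 2 * t by rewrite mulr_gt0.
apply: (le_rint _ _ (rintZ (64 * kap R n * t ^+ 2) (rint_pk x t20))).
- apply: measurable_funM; last exact: measurable_pk.
  by apply: measurable_funX; exact: measurable_sqnorm.
- by move=> y; rewrite ger0_norm ?gauss_moment4// mulr_ge0 ?sqr_ge0 ?pk_ge0.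
Qed.

Lemma Rint_moment4 t x : 0 < t ->
  \int[lam]_y (sqnorm (y - x) ^+ 2 * pk t x y) <= 64 * kap R n * t ^+ 2.
Proof.
move=> t0; have t20 : 0 < 2 * t by rewrite mulr_gt0.
have := le_Rint (rint_moment4 x t0) (rintZ (64 * kap R n * t ^+ 2) (rint_pk x t20)).
rewrite RintZ ?rint_pk// Rint_pk// mulr1; apply => y.
exact: gauss_moment4.
Qed.

Lemma pk_diffE t x z y : pk t (x + z) y - pk t x y =
  gauss_density t ((y - x) - z) - gauss_density t (y - x).
Proof. by rewrite /pk opprD addrA. Qed.

(** For |z| <= sqrt t this is [gauss_diff] with A = 1, integrated. For larger z the trivial bound 2
    is enough, because [Cg] is at least 1. *)
Lemma Rint_pk_diff t x z : 0 < t ->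
  \int[lam]_y `|pk t (x + z) y - pk t x y| <= 2 * Cg R n * (enorm z / Num.sqrt t).
Proof.
move=> t0; have t80 : 0 < 8 * t by rewrite mulr_gt0.
have q0 : 0 < Num.sqrt t by rewrite sqrtr_gt0.
have C1 := Cg_ge1 R n.
have di : rint lam (fun y => `|pk t (x + z) y - pk t x y|).
  by apply: rint_norm; apply: rintB; exact: rint_pk.
have e0 : 0 <= enorm z / Num.sqrt t by rewrite divr_ge0 ?enorm_ge0// ltW.
have [zq|qz] := leP (enorm z) (Num.sqrt t).
  have i1 : rint lam (fun y => pk t x y + pk (8 * t) x y).
    by apply: rintD; exact: rint_pk.
  have := le_Rint di (rintZ (Cg R n * (enorm z / Num.sqrt t)) i1).
  rewrite RintZ// RintD ?rint_pk// !Rint_pk// => h.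
  apply: (le_trans (h _)); last by lra.
  move=> y; rewrite pk_diffE.
  have := @gauss_diff _ _ t 1 (y - x) z t0 (lexx _); rewrite !mul1r => /(_ zq) h1.
  apply: (le_trans h1); apply: ler_wpM2l; first by rewrite mulr_ge0//; lra.
  rewrite lerD2l; apply: ler_piMl; first exact: pk_ge0.
  by rewrite -[leRHS]expR0 ler_expR; lra.
have i1 : rint lam (fun y => pk t (x + z) y + pk t x y).
  by apply: rintD; exact: rint_pk.
apply: (@le_trans _ _ 2).
  have := le_Rint di i1; rewrite RintD ?rint_pk// !Rint_pk// -(natrD _ 1 1) => h.
  apply: h => y; rewrite (le_trans (ler_normB _ _))//.
  by rewrite !ger0_norm ?pk_ge0.
have e1 : 1 <= enorm z / Num.sqrt t by rewrite ler_pdivlMr// mul1r ltW.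
nra.
Qed.

Lemma hP_lipschitz t f (M : R) x z : 0 < t -> bmeas f M ->
  `|hP t f (x + z) - hP t f x| <= M * (2 * Cg R n * (enorm z / Num.sqrt t)).
Proof.
move=> t0 fM; have M0 : 0 <= M := le_trans (normr_ge0 _) (fM.2 x).
have di : rint lam (fun y => `|pk t (x + z) y - pk t x y|).
  by apply: rint_norm; apply: rintB; exact: rint_pk.
rewrite -RintB ?(rint_bpk _ t0 fM)//.
apply: (@le_trans _ _ (\int[lam]_y (M * `|pk t (x + z) y - pk t x y|))).
  apply: norm_Rint_le.
  - by apply: rintB; exact: rint_bpk fM.
  - exact: rintZ.
  - by move=> y; rewrite -mulrBr normrM ler_wpM2r//; exact: fM.2.
by rewrite RintZ// ler_wpM2l// Rint_pk_diff.
Qed.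

End Heat.

(** * Discrete potentials and the logarithmic truncation *)

Section LogTruncation.
Variable R : realType.
Variable b : R.
Hypotheses (b_gt0 : 0 < b) (b_lt1 : b < 1).
Implicit Types s m : R.

Local Notation c := (b ^+ 2).
Local Notation Lb := (ln b^-1).

Definition clamp s : R := Num.max c (Num.min s b).
(* [Hf] is convex with derivative the logarithmic ramp [Gf]; both vanish below [b ^+ 2],
   and [Hf' = 1] above [b]. *)
Definition Gf s : R := ln (clamp s / c) / Lb.
Definition Hf s : R := (clamp s * ln (clamp s / c) - clamp s + c) / Lb + (Num.max s b - b).

Let c_gt0 : 0 < c. Proof. by rewrite exprn_gt0. Qed.

Let c_ltb : c < b. Proof. by rewrite expr2 gtr_pMr. Qed.

Lemma lnV_gt0 : 0 < Lb.
Proof. by rewrite ln_gt0// invf_gt1. Qed.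
Let Lb_gt0 := lnV_gt0.

Lemma clamp_ge s : c <= clamp s. Proof. by rewrite le_max lexx. Qed.
Lemma clamp_le s : clamp s <= b.
Proof. by rewrite ge_max (ltW c_ltb) ge_min lexx orbT. Qed.

Lemma clamp_gt0 s : 0 < clamp s. Proof. exact: lt_le_trans (clamp_ge s). Qed.

Lemma clamp_dist s s' : `|clamp s' - clamp s| <= `|s' - s|.
Proof.
have cb := c_ltb; rewrite /clamp /Num.max /Num.min.
case: (ltP s b) => ?; case: (ltP s' b) => ?; rewrite ?cb;
  case: (ltP c s) => ?; case: (ltP c s') => ?;
  rewrite ler_norml; apply/andP; split; case: (ger0P (s' - s)) => *; lra.
Qed.

Lemma ln_sub1 (x : R) : 0 < x -> ln x <= x - 1.
Proof.
move=> x0; have := expR_ge1Dx (ln x); rewrite lnK ?posrE//; lra.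
Qed.

Lemma Gf_ge0 s : 0 <= Gf s.
Proof.
rewrite divr_ge0 ?(ltW Lb_gt0)// ln_ge0// ler_pdivlMr// mul1r; exact: clamp_ge.
Qed.

Lemma Gf_le1 s : Gf s <= 1.
Proof.
rewrite ler_pdivrMr// mul1r ler_ln ?posrE ?invr_gt0 ?divr_gt0 ?clamp_gt0//.
rewrite ler_pdivrMr// expr2 mulrA mulVf ?gt_eqF// mul1r; exact: clamp_le.
Qed.

Lemma Gf_eq0 s : s <= c -> Gf s = 0.
Proof.
move=> sc; rewrite /Gf /clamp min_l ?(le_trans sc (ltW c_ltb))// max_l//.
by rewrite divff ?gt_eqF// ln1 mul0r.
Qed.

Lemma Gf_eq1 s : b <= s -> Gf s = 1.
Proof.
move=> bs; rewrite /Gf /clamp min_r// max_r ?(ltW c_ltb)//.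
rewrite (_ : b / c = b^-1) ?divff ?gt_eqF//.
by field; rewrite gt_eqF.
Qed.

(** Write s as [clamp s] plus an excess. On the clamped parts the gap is a relative entropy,
    nonnegative by ln x <= x - 1. The excess is positive only above b, where the slope is 1, and
    negative only below b^2, where the slope is 0. *)
Lemma Hf_ge s s' : Gf s * (s' - s) <= Hf s' - Hf s.
Proof.
set t := clamp s; set t' := clamp s'.
have t0 := clamp_gt0 s; have t'0 := clamp_gt0 s'.
have k1 : ln (t / c) * (t' - t) <= (t' * ln (t' / c) - t' + c) - (t * ln (t / c) - t + c).
  have := @ln_sub1 (t / t'); rewrite divr_gt0// => /(_ isT).
  rewrite !ln_div ?posrE// => h.
  have h2 : t' * (ln t - ln t') <= t - t'.
    apply: (@le_trans _ _ (t' * (t / t' - 1))); first by rewrite ler_pM2l.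
    by rewrite le_eqVlt; apply/orP; left; apply/eqP; field; rewrite gt_eqF.
  by nra.
have {}k1 : Gf s * (t' - t) <= (t' * ln (t' / c) - t' + c) / Lb - (t * ln (t / c) - t + c) / Lb.
  by rewrite -mulrBl /Gf mulrAC ler_wpM2r// invr_ge0 ltW.
have k2 : Gf s * ((s' - t') - (s - t)) <= (Num.max s' b - b) - (Num.max s b - b).
  have g0 := Gf_ge0 s; have g1 := Gf_le1 s.
  have p' : 0 <= Num.max s' b - b by rewrite subr_ge0 le_max lexx orbT.
  have e' : s' - t' <= Num.max s' b - b.
    rewrite /t' /clamp; case: (leP s' b) => sb'.
      by have := le_max s' c s'; rewrite lexx orbT; lra.
    by rewrite max_r ?(ltW c_ltb)//; lra.
  have [sc|sc] := leP s c.
    have sb : s <= b := le_trans sc (ltW c_ltb).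
    by rewrite Gf_eq0// mul0r (max_r sb) subrr subr0.
  have [sb|sb] := leP b s.
    rewrite Gf_eq1// mul1r /t /clamp (min_r sb) (max_r (ltW c_ltb)); lra.
  rewrite /t /clamp (min_l (ltW sb)) (max_r (ltW sc)); nra.
rewrite /Hf -/t -/t'; nra.
Qed.

Lemma Hf_le s s' : Hf s' - Hf s <= Gf s' * (s' - s).
Proof. by have := Hf_ge s' s; nra. Qed.

Lemma Hf0 : Hf 0 = 0.
Proof.
rewrite /Hf /clamp (min_l (ltW b_gt0)) max_l ?(ltW c_gt0)// max_r ?(ltW b_gt0)//.
by rewrite divff ?gt_eqF// ln1; field; rewrite gt_eqF.
Qed.

Lemma Hf_ge0 s : 0 <= Hf s.
Proof. by have := Hf_ge 0 s; rewrite Gf_eq0 ?(ltW c_gt0)// Hf0 mul0r subr0. Qed.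

Lemma Hf_le_id s : 0 <= s -> Hf s <= s.
Proof.
by move=> s0; have := Hf_le 0 s; have := Gf_le1 s; have := Gf_ge0 s; rewrite Hf0; nra.
Qed.

Lemma Hf_ge_subb s : s - b <= Hf s.
Proof. by have := Hf_ge b s; have := Hf_ge0 b; rewrite Gf_eq1//; lra. Qed.

Lemma Hf_eq0 s : 0 <= s <= c -> Hf s = 0.
Proof.
move=> /andP[s0 sc]; have := Hf_le 0 s; have := Hf_ge0 s.
by rewrite Gf_eq0// Hf0; lra.
Qed.

Lemma ln_dist (m x y : R) : 0 < m -> m <= x -> m <= y -> `|ln x - ln y| <= `|x - y| / m.
Proof.
move=> m0; wlog xy : x y / x <= y.
  move=> h mx my; have [xy|yx] := leP x y; first exact: h.
  by rewrite distrC [`|x - y|]distrC; apply: h => //; exact: ltW.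
move=> mx my; have x0 := lt_le_trans m0 mx; have y0 := lt_le_trans m0 my.
have lxy : ln x <= ln y by rewrite ler_ln ?posrE.
rewrite distrC [`|x - y|]distrC !ger0_norm ?subr_ge0// -ln_div ?posrE//.
have h := @ln_sub1 (y / x) (divr_gt0 y0 x0).
apply: (le_trans h); rewrite (_ : y / x - 1 = (y - x) / x); last by field; rewrite gt_eqF.
by rewrite ler_wpM2l ?subr_ge0// lef_pV2 ?posrE.
Qed.

Lemma Gf_dist s s' m : 0 < m -> m <= s -> m <= s' ->
  `|Gf s' - Gf s| <= `|s' - s| / (Lb * m).
Proof.
move=> m0 ms ms'; have [bm|mb] := leP b m.
  by rewrite !Gf_eq1 ?(le_trans bm)// subrr normr0 divr_ge0// mulr_ge0// ltW.
have cl u : m <= u -> m <= clamp u by move=> mu; rewrite le_max le_min mu (ltW mb) orbT.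
rewrite -mulrBl normrM (gtr0_norm (_ : 0 < Lb^-1)) ?invr_gt0//.
rewrite !ln_div ?posrE ?clamp_gt0// (_ : _ - _ - _ = ln (clamp s') - ln (clamp s)); last by ring.
rewrite [Lb * m]mulrC invfM mulrA ler_wpM2r ?invr_ge0 ?(ltW Lb_gt0)//.
apply: (le_trans (ln_dist m0 (cl _ ms') (cl _ ms))).
by rewrite ler_wpM2r ?invr_ge0 ?(ltW m0)// clamp_dist.
Qed.

Lemma Gf_lip s s' : `|Gf s' - Gf s| <= `|s' - s| / (Lb * c).
Proof.
rewrite -mulrBl normrM (gtr0_norm (_ : 0 < Lb^-1)) ?invr_gt0//.
rewrite !ln_div ?posrE ?clamp_gt0// (_ : _ - _ - _ = ln (clamp s') - ln (clamp s)); last by ring.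
rewrite [Lb * c]mulrC invfM mulrA ler_wpM2r ?invr_ge0 ?(ltW Lb_gt0)//.
apply: (le_trans (ln_dist c_gt0 (clamp_ge s') (clamp_ge s))).
by rewrite ler_wpM2r ?invr_ge0 ?(ltW c_gt0)// clamp_dist.
Qed.

Lemma measurable_clamp : measurable_fun setT clamp.
Proof.
apply: measurable_maxr; first exact: measurable_cst.
by apply: measurable_minr; [exact: measurable_id|exact: measurable_cst].
Qed.

Let measurable_lnclamp : measurable_fun setT (fun s => ln (clamp s / c)).
Proof.
apply: measurableT_comp; first exact: measurable_ln.
by apply: measurable_funM; [exact: measurable_clamp|exact: measurable_cst].
Qed.

Lemma measurable_Hf : measurable_fun setT Hf.
Proof.
apply: measurable_funD; last first.
  apply: measurable_funB; last exact: measurable_cst.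
  by apply: measurable_maxr; [exact: measurable_id|exact: measurable_cst].
apply: measurable_funM; last exact: measurable_cst.
apply: measurable_funD; last exact: measurable_cst.
apply: measurable_funB; last exact: measurable_clamp.
by apply: measurable_funM; [exact: measurable_clamp|exact: measurable_lnclamp].
Qed.

End LogTruncation.

(** * Regularity of a nonnegative function with bounded discrete Laplacian, and the Bregman error of
    its truncation *)

Section DiscretePotential.
Variables (R : realType) (n : nat).
Local Notation V := 'rV[R]_(n.+1).
Local Notation E := (Rd R n).
Variable lam : {sigma_finite_measure set E -> \bar R}.
Hypothesis lamE : is_lebesgue_d lam.
Hypothesis lam_gauss : forall t : R, 0 < t -> gauss lam t setT = 1%E.
Local Notation hP := (heat lam).

(** A Riemann sum of the integrable singularity s^(-1/2). Thanks to it the Lipschitz constant of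
    [psum] depends on the total time i d only, and not on the step d. *)
Lemma sum_inv_sqrt (i : nat) :
  \sum_(j < i) (Num.sqrt (j.+1%:R : R))^-1 <= 2 * Num.sqrt i%:R.
Proof.
elim: i => [|i ih]; first by rewrite big_ord0 sqrtr0 mulr0.
rewrite big_ord_recr /=; pose a : R := Num.sqrt i%:R; set d := Num.sqrt i.+1%:R.
rewrite -/a in ih.
have d0 : 0 < d by rewrite sqrtr_gt0 ltr0n.
have a0 : 0 <= a by exact: sqrtr_ge0.
have ad : a <= d by rewrite ler_wsqrtr// ler_nat.
have E1 : d ^+ 2 - a ^+ 2 = 1.
  by rewrite !sqr_sqrtr ?ler0n// -natr1; ring.
suff : d^-1 <= 2 * (d - a) by lra.
by rewrite -div1r ler_pdivrMr//; nra.
Qed.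

Lemma subr_swap (a b e g : R) : a - b - (e - g) = - (b - g) + (a - e).
Proof. by ring. Qed.

Lemma grid_approx (d y : R) : 0 < d -> d <= y -> exists i : nat, y <= i.+1%:R * d <= 2 * y.
Proof.
move=> d0 dy; exists (Num.truncn (y / d)).
have yd : 0 <= y / d by rewrite divr_ge0 ?ltW// (lt_le_trans d0 dy).
have h1 := ltW (truncnS_gt (y / d)).
have h2 : (Num.truncn (y / d))%:R <= y / d by rewrite truncn_le.
apply/andP; split; first by rewrite -ler_pdivrMr.
rewrite -natr1 mulrDl mul1r (_ : 2 * y = y + y); last by ring.
by rewrite lerD// -ler_pdivlMr.
Qed.

Section Fixed.
Variables (d Cv Cw : R) (v wt : V -> R).
Hypotheses (d_gt0 : 0 < d) (d_le1 : d <= 1).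
Hypotheses (vb : bmeas v Cv) (v_ge0 : forall x, 0 <= v x) (wb : bmeas wt Cw).
Hypothesis vE : forall x, hP d v x - v x = d * hP d wt x.

Let Cv_ge0 : 0 <= Cv. Proof. exact: le_trans (normr_ge0 _) (vb.2 0). Qed.
Let Cw_ge0 : 0 <= Cw. Proof. exact: le_trans (normr_ge0 _) (wb.2 0). Qed.
Let jd_gt0 (j : nat) : 0 < j.+1%:R * d. Proof. by rewrite mulr_gt0// ltr0n. Qed.

Definition psum (i : nat) (x : V) : R := d * \sum_(j < i) hP (j.+1%:R * d) wt x.

(** Iterate P_d v = v + d P_d wt. Thus v is P_t v minus a potential over the times up to t, and
    every regularity statement on v results from a good choice of the grid time t. *)
Lemma potential_iter (i : nat) x : hP (i.+1%:R * d) v x = v x + psum i.+1 x.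
Proof.
rewrite /psum; elim: i => [|i ih].
  by rewrite big_ord_recl big_ord0 addr0 !mul1r -vE; ring.
rewrite big_ord_recr /= mulrDr addrA -ih.
have -> : i.+2%:R * d = i.+1%:R * d + d by rewrite -[i.+2%:R]natr1 mulrDl mul1r.
rewrite -(hP_semigroup lamE lam_gauss x (jd_gt0 i) d_gt0 vb).
rewrite -(hP_semigroup lamE lam_gauss x (jd_gt0 i) d_gt0 wb).
have Pb := bmeas_hP lamE lam_gauss d_gt0 wb.
have -> : hP d v = fun y => v y + d * hP d wt y by apply/funext => y; rewrite -vE; ring.
rewrite (hPD lamE lam_gauss x (jd_gt0 i) vb (bmeasM (bmeas_cst n d) Pb)).
by rewrite (hPZ lamE lam_gauss d x (jd_gt0 i) Pb).
Qed.

Lemma psum_le i x : `|psum i x| <= i%:R * d * Cw.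
Proof.
rewrite normrM (gtr0_norm d_gt0) [i%:R * d]mulrC -mulrA ler_pM2l//.
apply: (le_trans (ler_norm_sum _ _ _)).
apply: (@le_trans _ _ (\sum_(j < i) Cw)).
  by apply: ler_sum => j _; exact: hP_le lamE lam_gauss _ _ _ _ (jd_gt0 j) wb.
by rewrite sumr_const card_ord mulr_natl.
Qed.

Lemma psum_lipschitz i x z :
  `|psum i (x + z) - psum i x| <= 4 * Cw * Cg R n * enorm z * Num.sqrt (i%:R * d).
Proof.
rewrite -mulrBr -sumrB normrM (gtr0_norm d_gt0).
have C0 : 0 <= Cg R n by rewrite (le_trans ler01)// Cg_ge1.
have q0 : 0 < Num.sqrt d by rewrite sqrtr_gt0.
have qq : Num.sqrt d ^+ 2 = d by rewrite sqr_sqrtr// ltW.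
apply: (@le_trans _ _ (d * \sum_(j < i) (Cw * (2 * Cg R n * enorm z) / Num.sqrt d) *
     (Num.sqrt (j.+1%:R))^-1)).
  rewrite ler_pM2l//; apply: (le_trans (ler_norm_sum _ _ _)); apply: ler_sum => j _.
  apply: (le_trans (hP_lipschitz lamE lam_gauss x z (jd_gt0 j) wb)).
  rewrite sqrtrM ?ler0n// invfM le_eqVlt; apply/orP; left; apply/eqP; ring.
rewrite -mulr_sumr.
have h := sum_inv_sqrt i; set S := \sum_(j < i) _ in h *.
rewrite sqrtrM ?ler0n//.
rewrite (_ : d * _ = (Cw * (2 * Cg R n * enorm z) * Num.sqrt d) * S); last first.
  by rewrite -{1}qq; field; rewrite gt_eqF.
rewrite (_ : 4 * _ * _ * _ * _ = (Cw * (2 * Cg R n * enorm z) * Num.sqrt d) *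
   (2 * Num.sqrt i%:R)); last by ring.
rewrite ler_wpM2l// !mulr_ge0 ?enorm_ge0//; exact: ltW.
Qed.

(** Nonnegativity of v matters here: the kernel bound integrates to a multiple of P_t v(x) itself,
    and the sup bound [Cv] appears only with the exponentially small tail. *)
Lemma hP_gauss_diff t A x z : 0 < t -> 1 <= A -> A * enorm z <= Num.sqrt t ->
  `|hP t v (x + z) - hP t v x| <= Cg R n * (enorm z / Num.sqrt t) *
     (A * hP t v x + expR (- (A ^+ 2 / 16)) * Cv).
Proof.
move=> t0 A1 Az; have t80 : 0 < 8 * t by rewrite mulr_gt0.
have i1 := rint_bpk lamE lam_gauss x t0 vb.
have i8 := rint_bpk lamE lam_gauss x t80 vb.
have i2 := rint_bpk lamE lam_gauss (x + z) t0 vb.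
set K := Cg R n * _; set e := expR _.
have C0 : 0 <= Cg R n by rewrite (le_trans ler01)// Cg_ge1.
have K0 : 0 <= K by rewrite mulr_ge0// divr_ge0 ?enorm_ge0// sqrtr_ge0.
have e0 : 0 <= e := expR_ge0 _.
apply: (@le_trans _ _ (K * (A * hP t v x + e * hP (8 * t) v x))); last first.
  apply: ler_wpM2l => //; rewrite lerD2l; apply: ler_wpM2l => //.
  by rewrite (le_trans (ler_norm _))//; exact: hP_le lamE lam_gauss _ _ _ _ t80 vb.
rewrite /heat -!RintZ// -RintD; [|exact: rintZ|exact: rintZ].
rewrite -RintZ; last by apply: rintD; exact: rintZ.
rewrite -RintB//; apply: norm_Rint_le; first exact: rintB.
  by apply: rintZ; apply: rintD; exact: rintZ.
move=> y; rewrite -mulrBr normrM (ger0_norm (v_ge0 y)) pk_diffE.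
have := gauss_diff (y - x) t0 A1 Az; rewrite -/K -/e => h.
rewrite [leRHS](_ : _ = v y * (K * (A * gauss_density t (y - x) + e * gauss_density (8 * t) (y - x)))).
  by rewrite ler_wpM2l.
by rewrite /pk; ring.
Qed.

Lemma potential_diff (i : nat) A x z : 1 <= A -> A * enorm z <= Num.sqrt (i.+1%:R * d) ->
  `|v (x + z) - v x| <= 4 * Cw * Cg R n * enorm z * Num.sqrt (i.+1%:R * d) +
    Cg R n * (enorm z / Num.sqrt (i.+1%:R * d)) *
    (A * (v x + i.+1%:R * d * Cw) + expR (- (A ^+ 2 / 16)) * Cv).
Proof.
move=> A1 Az; set t := i.+1%:R * d in Az *; have t0 : 0 < t := jd_gt0 i.
have vS y : v y = hP t v y - psum i.+1 y by rewrite potential_iter; ring.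
rewrite (vS (x + z)) {1}(vS x).
rewrite subr_swap.
rewrite (le_trans (ler_normD _ _))// normrN lerD ?psum_lipschitz//.
apply: (le_trans (hP_gauss_diff x t0 A1 Az)).
have C0 : 0 <= Cg R n by rewrite (le_trans ler01)// Cg_ge1.
apply: ler_wpM2l; first by rewrite mulr_ge0// divr_ge0 ?enorm_ge0// sqrtr_ge0.
rewrite lerD2r ler_wpM2l// ?(le_trans ler01)//.
rewrite /t potential_iter lerD2l (le_trans (ler_norm _))//; exact: psum_le.
Qed.

Definition Lip : R := (8 * Cw + 2 * Cv) * Cg R n + 1.

Lemma Lip_ge1 : 1 <= Lip.
Proof.
by rewrite lerDr mulr_ge0 ?addr_ge0 ?mulr_ge0.
Qed.

(** Use a grid time t between 1 and 2, which exists since d <= 1: the kernel gradient is then O(1),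
    and so is the potential over [0, t]. The constant [Lip] depends on the two sup bounds only. *)
Lemma potential_lipschitz x z : `|v (x + z) - v x| <= Lip * enorm z.
Proof.
have [i /andP[t1 t2]] := grid_approx d_gt0 d_le1.
rewrite mulr1 in t2; set t := i.+1%:R * d in t1 t2; have t0 : 0 < t := jd_gt0 i.
have vS y : v y = hP t v y - psum i.+1 y by rewrite potential_iter; ring.
have q1 : 1 <= Num.sqrt t by rewrite -{1}sqrtr1 ler_wsqrtr.
have q2 : Num.sqrt t <= 2.
  rewrite -(@ler_sqr R) ?nnegrE ?sqrtr_ge0// sqr_sqrtr ?(ltW t0)//; lra.
have C1 := Cg_ge1 R n; have z0 := enorm_ge0 z.
rewrite (vS (x + z)) (vS x).
rewrite subr_swap.
apply: (le_trans (ler_normD _ _)); rewrite normrN.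
have h1 := psum_lipschitz i.+1 x z; rewrite -/t in h1.
have h2 := hP_lipschitz lamE lam_gauss x z t0 vb.
have h3 : enorm z / Num.sqrt t <= enorm z.
  by rewrite ler_pdivrMr ?sqrtr_gt0// ler_peMr.
have h4 : 4 * Cw * Cg R n * enorm z * Num.sqrt t <= 4 * Cw * Cg R n * enorm z * 2.
  by rewrite ler_wpM2l// !mulr_ge0//; lra.
have h5 : Cv * (2 * Cg R n * (enorm z / Num.sqrt t)) <= Cv * (2 * Cg R n * enorm z).
  by rewrite ler_wpM2l// ler_wpM2l//; lra.
rewrite /Lip; nra.
Qed.

Definition Klog : R := Cg R n * (1 + 5 * Cw + Cv).

(** Choose a grid time t between y and 2 y and A = 4 sqrt (ln (1/t)), so that exp (-A^2 / 16) = t.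
    Every term of [potential_diff] is then O(|z| sqrt (y ln (1/y))). Up to the logarithm this is the
    classical bound |grad v|^2 = O(v) for a nonnegative function with bounded Laplacian; positivity
    is what makes gradients small where v is small. *)
Lemma potential_log x z (y : R) : v x <= y -> d <= y -> y <= 4^-1 ->
  16 * ln y^-1 * sqnorm z <= y ->
  (v (x + z) - v x) ^+ 2 <= 32 * Klog ^+ 2 * sqnorm z * (y * ln y^-1).
Proof.
move=> vy dy y4 zy; have y0 : 0 < y := lt_le_trans d_gt0 dy.
have [i /andP[t1 t2]] := grid_approx d_gt0 dy.
set t := i.+1%:R * d in t1 t2; have t0 : 0 < t := jd_gt0 i.
have l1 : 2^-1 <= ln t^-1.
  have := @ln_sub1 R t t0; rewrite lnV ?posrE//; lra.
have l2 : ln t^-1 <= ln y^-1.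
  by rewrite ler_ln ?posrE ?invr_gt0// lef_pV2 ?posrE.
pose q := Num.sqrt (ln t^-1); pose A := 4 * q.
have q0 : 0 <= q by exact: sqrtr_ge0.
have qq : q ^+ 2 = ln t^-1 by rewrite sqr_sqrtr//; lra.
have A1 : 1 <= A by rewrite /A; nra.
have AA : A ^+ 2 / 16 = ln t^-1 by rewrite /A -qq; field.
have z0 := enorm_ge0 z.
pose st := Num.sqrt t; have st0 : 0 < st by rewrite sqrtr_gt0.
have stt : st ^+ 2 = t by rewrite sqr_sqrtr// ltW.
have Az : A * enorm z <= st.
  have A0 : 0 <= A by lra.
  rewrite -(@ler_sqr R) ?nnegrE ?mulr_ge0 ?(ltW st0)//.
  rewrite stt exprMn sqr_enorm.
  have -> : A ^+ 2 = 16 * ln t^-1 by rewrite -AA; field.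
  apply: le_trans t1; apply: le_trans zy; rewrite ler_wpM2r ?sqnorm_ge0//.
  by rewrite ler_pM2l.
have h := potential_diff x A1 Az.
rewrite -/t -/st AA lnV ?posrE// opprK lnK ?posrE// in h.
have C1 := Cg_ge1 R n.
have D1 : `|v (x + z) - v x| <= Klog * enorm z * st * A.
  apply: (le_trans h).
  have -> : Cg R n * (enorm z / st) * (A * (v x + t * Cw) + t * Cv) =
    Cg R n * enorm z * (A * (v x / st + st * Cw) + st * Cv).
    by rewrite -stt; field; rewrite gt_eqF.
  have vst : v x / st <= st by rewrite ler_pdivrMr// -expr2 stt (le_trans vy).
  have sA : st <= st * A by rewrite ler_peMr// ltW.
  have e0 : 0 <= Cg R n * enorm z by rewrite mulr_ge0//; lra.
  rewrite (_ : 4 * Cw * _ * _ * _ = Cg R n * enorm z * (4 * Cw * st)); last by ring.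
  rewrite -mulrDr /Klog.
  rewrite (_ : _ * _ * _ * A = Cg R n * enorm z * ((1 + 5 * Cw + Cv) * (st * A))); last by ring.
  rewrite ler_wpM2l//.
  have a1 : A * (v x / st) <= A * st by rewrite ler_wpM2l//; lra.
  have a2 : Cw * st <= Cw * (st * A) by rewrite ler_wpM2l.
  have a3 : Cv * st <= Cv * (st * A) by rewrite ler_wpM2l.
  lra.
have -> : (v (x + z) - v x) ^+ 2 = `|v (x + z) - v x| ^+ 2 by rewrite real_normK ?num_real.
apply: (@le_trans _ _ ((Klog * enorm z * st * A) ^+ 2)).
  by rewrite lerXn2r ?nnegrE// (le_trans (normr_ge0 _) D1).
have -> : (Klog * enorm z * st * A) ^+ 2 = 16 * Klog ^+ 2 * sqnorm z * (t * ln t^-1).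
  by rewrite -AA !exprMn stt sqr_enorm; field.
rewrite (_ : 32 * _ * _ * _ = 16 * Klog ^+ 2 * sqnorm z * (2 * y * ln y^-1)); last by ring.
apply: ler_wpM2l; first by rewrite mulr_ge0 ?sqnorm_ge0// mulr_ge0// sqr_ge0.
by apply: ler_pM => //; [exact: ltW|lra].
Qed.

Section Truncated.
Variable b : R.
Hypotheses (b_gt0 : 0 < b) (b_le8 : b <= 8^-1).
Let b_lt1 : b < 1. Proof. by have := b_le8; lra. Qed.

Definition breg (x y : V) : R :=
  Hf b (v y) - Hf b (v x) - Gf b (v x) * (v y - v x).

Lemma breg_ge0 x y : 0 <= breg x y.
Proof. by rewrite subr_ge0 Hf_ge. Qed.

Lemma breg_le x y : breg x y <= `|Gf b (v y) - Gf b (v x)| * `|v y - v x|.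
Proof.
rewrite -normrM (le_trans _ (ler_norm _))// mulrBl /breg lerD2r; exact: Hf_le.
Qed.

(** A squared radius. Under the first term v moves by at most b^2 / 4. The second is the condition
    16 ln (1/v) |z|^2 <= v of [potential_log], for v >= b^2 / 2 and ln (1/v) <= 3 ln (1/b); hence 96
    = 2 * 16 * 3. *)
Definition rho : R := Num.min ((b ^+ 2 / (4 * Lip)) ^+ 2) (b ^+ 2 / (96 * ln b^-1)).

Let Lb_gt0 : 0 < ln b^-1. Proof. exact: lnV_gt0. Qed.
Let c_gt0 : 0 < b ^+ 2. Proof. by rewrite exprn_gt0. Qed.
Let Lip_gt0 : 0 < Lip. Proof. exact: lt_le_trans ltr01 Lip_ge1. Qed.

Lemma rho_gt0 : 0 < rho.
Proof. by rewrite lt_min exprn_gt0 ?divr_gt0 ?mulr_gt0. Qed.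

(** The factor 32 of [potential_log], times 3 from ln (1/v) <= 3 ln (1/b), times 2 from v(y) >= v(x)
    / 2. No b survives, since the two logarithms cancel. *)
Definition C6 : R := 192 * Klog ^+ 2.
Definition C7 : R := Lip ^+ 2 / (ln b^-1 * b ^+ 2 * rho).

Lemma breg_far x y : breg x y <= Lip ^+ 2 * sqnorm (y - x) / (ln b^-1 * b ^+ 2).
Proof.
apply: (le_trans (breg_le x y)).
have h := potential_lipschitz x (y - x); rewrite subrKC in h.
have := Gf_lip b_gt0 b_lt1 (v x) (v y); set D := `|v y - v x| in h * => hG.
apply: (@le_trans _ _ (D ^+ 2 / (ln b^-1 * b ^+ 2))).
  by rewrite expr2 mulrAC ler_wpM2r ?normr_ge0.
apply: ler_wpM2r; first by rewrite invr_ge0 mulr_ge0// ltW.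
rewrite -sqr_enorm -exprMn; apply: lerXn2r => //; rewrite nnegrE ?normr_ge0//.
exact: le_trans (normr_ge0 _) h.
Qed.

(** If v(x) <= b^2 / 2 or v(x) >= 2 b, both points lie on the same flat piece of [Gf]. In between,
    the slope of [Gf] is O(1 / (v ln (1/b))) while the squared increment of v is O(|z|^2 v ln
    (1/v)); the product is free of b. *)
Lemma breg_near x y : d <= b ^+ 2 / 2 -> sqnorm (y - x) <= rho ->
  breg x y <= C6 * sqnorm (y - x).
Proof.
have b8 := b_le8; have b0 := b_gt0; move=> db yx; have C60 : 0 <= C6 * sqnorm (y - x).
  apply: mulr_ge0; [by apply: mulr_ge0 => //; exact: sqr_ge0|exact: sqnorm_ge0].
have h := potential_lipschitz x (y - x); rewrite subrKC in h.
have zc : Lip * enorm (y - x) <= b ^+ 2 / 4.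
  rewrite mulrC -ler_pdivlMr// -(@ler_sqr R) ?nnegrE ?enorm_ge0 ?divr_ge0 ?(ltW c_gt0) ?(ltW Lip_gt0)//.
  rewrite sqr_enorm (le_trans yx)// /rho ge_min; apply/orP; left.
  by rewrite le_eqVlt; apply/orP; left; apply/eqP; field; rewrite gt_eqF.
have D4 : `|v y - v x| <= b ^+ 2 / 4 by rewrite (le_trans h).
move: (D4); rewrite ler_norml => /andP[D1 D2].
have cb : b ^+ 2 <= b / 8 by rewrite expr2; nra.
have [vc|vc] := leP (v x) (b ^+ 2 / 2).
  apply: (le_trans (breg_le x y)).
  by rewrite !Gf_eq0 ?subrr ?normr0 ?mul0r//; lra.
have [vb2|vb2] := leP (2 * b) (v x).
  apply: (le_trans (breg_le x y)).
  by rewrite !Gf_eq1 ?subrr ?normr0 ?mul0r//; lra.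
have vx0 : 0 < v x by apply: le_lt_trans vc; rewrite divr_ge0// ltW.
(* Here v(x) > b^2 / 2 >= b^3. *)
have l3 : ln (v x)^-1 <= 3 * ln b^-1.
  rewrite mulr_natl -lnXn ?invr_gt0// ler_ln ?posrE ?exprn_gt0 ?invr_gt0//.
  rewrite exprVn lef_pV2 ?posrE ?exprn_gt0//.
  apply: le_trans (ltW vc); rewrite exprS; have := c_gt0; nra.
have lv0 : 0 <= ln (v x)^-1.
  by rewrite ln_ge0// invf_ge1//; lra.
have q0 := sqnorm_ge0 (y - x).
have z16 : 16 * ln (v x)^-1 * sqnorm (y - x) <= v x.
  apply: le_trans (ltW vc).
  have : sqnorm (y - x) <= b ^+ 2 / (96 * ln b^-1).
    by rewrite (le_trans yx)// /rho ge_min lexx orbT.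
  rewrite ler_pdivlMr ?mulr_gt0// => hh.
  have : ln (v x)^-1 * sqnorm (y - x) <= 3 * ln b^-1 * sqnorm (y - x) by rewrite ler_wpM2r.
  lra.
have dv : d <= v x by rewrite (le_trans db)// ltW.
have v4 : v x <= 4^-1 by lra.
have := potential_log (lexx (v x)) dv v4 z16; rewrite subrKC => hlog.
have m0 : 0 < v x / 2 by rewrite divr_gt0.
have m1 : v x / 2 <= v x by lra.
have m2 : v x / 2 <= v y by lra.
have hG := Gf_dist b_gt0 b_lt1 m0 m1 m2.
apply: (le_trans (breg_le x y)).
apply: (@le_trans _ _ ((v y - v x) ^+ 2 / (ln b^-1 * (v x / 2)))).
  have -> : (v y - v x) ^+ 2 = `|v y - v x| * `|v y - v x|.
    by rewrite -expr2 real_normK ?num_real.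
  by rewrite [leRHS]mulrAC ler_wpM2r.
rewrite ler_pdivrMr ?mulr_gt0//; apply: (le_trans hlog).
rewrite /C6 (_ : 32 * _ * _ * _ = (32 * Klog ^+ 2 * sqnorm (y - x) * v x) * ln (v x)^-1); last by ring.
rewrite (_ : 192 * _ * _ * _ = (32 * Klog ^+ 2 * sqnorm (y - x) * v x) * (3 * ln b^-1)); last by field.
apply: ler_wpM2l => //; apply: mulr_ge0; last exact: ltW.
by rewrite mulr_ge0// mulr_ge0// sqr_ge0.
Qed.

(** Beyond [rho] the crude bound is multiplied by |z|^2 / rho >= 1, which makes it quartic. The
    fourth moment of p_d is O(d^2), so the constant [C7], which explodes as b tends to 0, is
    harmless once d is small. *)
Lemma breg_le_moments x y : d <= b ^+ 2 / 2 ->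
  breg x y <= C6 * sqnorm (y - x) + C7 * sqnorm (y - x) ^+ 2.
Proof.
move=> db; have q0 := sqnorm_ge0 (y - x); have r0 := rho_gt0.
have C70 : 0 <= C7 by rewrite divr_ge0 ?sqr_ge0// !mulr_ge0 ?ltW.
have C60 : 0 <= C6 by apply: mulr_ge0 => //; exact: sqr_ge0.
have [yx|yx] := leP (sqnorm (y - x)) rho.
  by rewrite (le_trans (breg_near db yx))// lerDl mulr_ge0// sqr_ge0.
apply: (le_trans (breg_far x y)).
apply: (@le_trans _ _ (C7 * sqnorm (y - x) ^+ 2)); last by rewrite lerDr mulr_ge0.
rewrite /C7 (_ : _ * sqnorm _ / _ = Lip ^+ 2 / (ln b^-1 * b ^+ 2 * rho) * (rho * sqnorm (y - x))).
  by rewrite -/C7 ler_wpM2l// expr2 ler_wpM2r// ltW.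
by field; rewrite !gt_eqF.
Qed.

Definition beta (x : V) : R := \int[lam]_y (breg x y * pk d x y).

Let Hvb : bmeas (fun y => Hf b (v y)) Cv.
Proof.
split; first exact: (measurableT_comp (measurable_Hf b) vb.1).
move=> y; rewrite ger0_norm ?Hf_ge0// (le_trans (Hf_le_id b_gt0 b_lt1 (v_ge0 y)))//.
by rewrite (le_trans (ler_norm _))//; exact: vb.2.
Qed.

Lemma betaE x : beta x =
  hP d (fun y => Hf b (v y)) x - Hf b (v x) - Gf b (v x) * (d * hP d wt x).
Proof.
rewrite -vE /beta.
have E1 y : breg x y * pk d x y = (Hf b (v y) * pk d x y - Hf b (v x) * pk d x y)
    - Gf b (v x) * (v y * pk d x y - v x * pk d x y) by rewrite /breg; ring.
have ip := rint_pk lamE lam_gauss x d_gt0.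
have iv := rint_bpk lamE lam_gauss x d_gt0 vb.
have iH := rint_bpk lamE lam_gauss x d_gt0 Hvb.
under eq_Rint do rewrite E1.
have iHx := rintZ (Hf b (v x)) ip; have ivx := rintZ (v x) ip.
have j1 := rintB iH iHx; have j2 := rintB iv ivx; have j3 := rintZ (Gf b (v x)) j2.
rewrite (RintB j1 j3) (RintB iH iHx) (RintZ (Gf b (v x)) j2) (RintB iv ivx).
rewrite (RintZ (v x) ip) (RintZ (Hf b (v x)) ip).
by rewrite (Rint_pk lamE lam_gauss x d_gt0) !mulr1.
Qed.

Lemma beta_ge0 x : 0 <= beta x.
Proof. by apply: Rint_ge0 => y; rewrite mulr_ge0 ?breg_ge0 ?pk_ge0. Qed.

Definition C5 : R := 4 * kap R n * C6 + 1.

Lemma beta_le x : d <= b ^+ 2 / 2 -> 64 * kap R n * C7 * d <= 1 -> beta x <= C5 * d.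
Proof.
move=> db d7.
have i2 := rint_moment2 lamE lam_gauss x d_gt0.
have i4 := rint_moment4 lamE lam_gauss x d_gt0.
have C70 : 0 <= C7 by rewrite divr_ge0 ?sqr_ge0// !mulr_ge0 ?ltW ?rho_gt0.
have C60 : 0 <= C6 by apply: mulr_ge0 => //; exact: sqr_ge0.
apply: (@le_trans _ _ (\int[lam]_y (C6 * (sqnorm (y - x) * pk d x y) +
    C7 * (sqnorm (y - x) ^+ 2 * pk d x y)))).
  apply: le_Rint.
  - have ip := rint_pk lamE lam_gauss x d_gt0.
    have iv := rint_bpk lamE lam_gauss x d_gt0 vb.
    have iH := rint_bpk lamE lam_gauss x d_gt0 Hvb.
    have E1 : (fun y => breg x y * pk d x y) =
      (fun y => (Hf b (v y) * pk d x y - Hf b (v x) * pk d x y)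
        - Gf b (v x) * (v y * pk d x y - v x * pk d x y)).
      by apply/funext => y; rewrite /breg; ring.
    rewrite E1; apply: rintB; first by apply: rintB => //; exact: rintZ.
    by apply: rintZ; apply: rintB => //; exact: rintZ.
  - by apply: rintD; exact: rintZ.
  - move=> y; have := ler_wpM2r (pk_ge0 x y d_gt0) (breg_le_moments x y db).
    move: (breg x y) (sqnorm (y - x)) (pk d x y) => B q p h.
    by apply: (le_trans h); rewrite mulrDl !mulrA.
rewrite RintD; [|exact: rintZ|exact: rintZ].
rewrite !RintZ//.
have m2 := Rint_moment2 lamE lam_gauss x d_gt0.
have m4 := Rint_moment4 lamE lam_gauss x d_gt0.
have k1 := ler_wpM2l C60 m2; have k2 := ler_wpM2l C70 m4.
have k3 : C7 * (64 * kap R n * d ^+ 2) <= d.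
  rewrite (_ : _ * _ = (64 * kap R n * C7 * d) * d); last by ring.
  by rewrite ler_piMl// ltW.
rewrite /C5; lra.
Qed.

End Truncated.
End Fixed.
End DiscretePotential.

(** * Superharmonic functions *)

Section Counting.
Variable R : realType.

(** The discrete layer-cake formula: counting the levels i <= s recovers s up to 1, as long as N
    levels suffice. This version serves closed superlevel sets, [count_lt] open ones. *)
Lemma count_le (N : nat) (s : R) :
  [/\ s < 0 -> \sum_(i < N) (i%:R <= s)%R%:R = 0 :> R,
      0 <= s -> \sum_(i < N) (i%:R <= s)%R%:R <= s + 1 :> R &
      s <= N%:R -> s <= \sum_(i < N) (i%:R <= s)%R%:R :> R].
Proof.
elim: N => [|N [h1 h2 h3]]; first by split => *; rewrite big_ord0//; lra.
have S_le : \sum_(i < N) (i%:R <= s)%R%:R <= N%:R :> R.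
  rewrite -[leRHS](_ : \sum_(i < N) 1 = _); last by rewrite sumr_const card_ord.
  by apply: ler_sum => i _; case: (i%:R <= s)%R; rewrite ?ler01 ?lexx.
rewrite !big_ord_recr /=; case: (leP N%:R s) => Ns; split => s0.
- by have := ler0n R N; lra.
- by rewrite lerD2r (le_trans S_le).
- rewrite -natr1 in s0; have [->|sN] := eqVneq s N%:R; last first.
    suff : N%:R <= \sum_(i < N) (i%:R <= s)%R%:R :> R by rewrite /= mulr1n; lra.
    rewrite -[leLHS](_ : \sum_(i < N) 1 = _); last by rewrite sumr_const card_ord.
    apply: ler_sum => i _; suff -> : i%:R <= s by [].
    by rewrite (le_trans _ Ns)// ler_nat ltnW.
  rewrite /= mulr1n (@le_trans _ _ (N%:R + 1))//; first by rewrite lerDl.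
  rewrite lerD2r -[leLHS](_ : \sum_(i < N) 1 = _); last by rewrite sumr_const card_ord.
  by apply: ler_sum => i _; rewrite ler_nat ltnW.
- by rewrite h1// addr0.
- by rewrite addr0 h2.
- by rewrite addr0 h3// ltW.
Qed.

Lemma count_lt (N : nat) (s : R) :
  [/\ s <= 0 -> \sum_(i < N) (i%:R < s)%R%:R = 0 :> R,
      0 <= s -> \sum_(i < N) (i%:R < s)%R%:R <= s + 1 :> R &
      s <= N%:R -> s <= \sum_(i < N) (i%:R < s)%R%:R :> R].
Proof.
elim: N => [|N [h1 h2 h3]]; first by split => *; rewrite big_ord0//; lra.
have S_le : \sum_(i < N) (i%:R < s)%R%:R <= N%:R :> R.
  rewrite -[leRHS](_ : \sum_(i < N) 1 = _); last by rewrite sumr_const card_ord.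
  by apply: ler_sum => i _; case: (i%:R < s)%R; rewrite ?ler01 ?lexx.
rewrite !big_ord_recr /=; case: (ltP N%:R s) => Ns; split => s0.
- by have := ler0n R N; lra.
- by rewrite lerD2r (le_trans S_le)// ltW.
- rewrite -natr1 in s0.
  suff : N%:R <= \sum_(i < N) (i%:R < s)%R%:R :> R by rewrite /= mulr1n; lra.
  rewrite -[leLHS](_ : \sum_(i < N) 1 = _); last by rewrite sumr_const card_ord.
  apply: ler_sum => i _; suff -> : i%:R < s by [].
  by rewrite (le_lt_trans _ Ns)// ler_nat ltnW.
- by rewrite h1// addr0.
- by rewrite addr0 h2.
- by rewrite addr0 h3.
Qed.

End Counting.

Section Superharmonic.
Variables (R : realType) (n : nat).
Local Notation V := 'rV[R]_(n.+1).
Local Notation E := (Rd R n).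
Variable lam : {sigma_finite_measure set E -> \bar R}.
Hypothesis lamE : is_lebesgue_d lam.
Hypothesis lam_gauss : forall t : R, 0 < t -> gauss lam t setT = 1%E.
Local Notation hP := (heat lam).
Variables (U : set V) (psi : V -> \bar R).
Hypotheses (oU : open U) (lamU : (lam U < +oo)%E).
Hypothesis psi_int : lam.-integrable (U : set E) psi.
Hypothesis psi_sh : superharmonic_in lam U psi.

(* The value is 0 where [psi] is infinite, and off [U]. *)
Definition psb : V -> R := fine \o (psi \_ U).

Let mU : measurable (U : set E). Proof. exact: measurable_open. Qed.

Lemma rint_psb : rint lam psb.
Proof.
have ip : lam.-integrable setT ((psi : E -> \bar R) \_ (U : set E)).
  exact/(integrable_mkcond (psi : E -> \bar R) mU).
apply: (le_integrable measurableT _ _ ip).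
  apply/measurable_EFinP; apply: (measurableT_comp (fine_measurable measurableT)).
  exact: measurable_int ip.
move=> x _ /=; rewrite /psb /=; case: ((psi \_ U) x) => [r| |] //=.
- by rewrite normr0 leey.
- by rewrite normr0 leey.
Qed.

Lemma psb_out x : ~ U x -> psb x = 0.
Proof. by move=> Ux; rewrite /psb /= patchN// notin_setE. Qed.

Lemma psb_in x : U x -> psb x = fine (psi x).
Proof. by move=> Ux; rewrite /psb /= patchT// inE. Qed.

Lemma psi_ae_fin : {ae lam, forall x, U x -> psi x \is a fin_num}.
Proof. exact: (@integrable_ae _ E R lam U mU psi psi_int). Qed.

Lemma measurable_cball (x : V) (r : R) : measurable (cball_e x r : set E).
Proof.
have -> : cball_e x r = setT `&` (fun y : V => sqnorm (y - x)) @^-1` `]-oo, r ^+ 2].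
  by rewrite setTI; apply/seteqP; split => y; rewrite /= in_itv.
by apply: measurable_sqnorm => //; exact: measurable_itv.
Qed.

Lemma sub_cball (x : V) (r s : R) : 0 <= r <= s -> cball_e x r `<=` cball_e x s.
Proof.
move=> /andP[r0 rs] y /= yr; apply: (le_trans yr); apply: lerXn2r => //.
by rewrite nnegrE (le_trans r0).
Qed.

(** The ball contains the cube of half-side h = r / (n+1) around x, because (n+1) h^2 <= r^2. *)
Lemma cball_gt0 (x : V) (r : R) : 0 < r -> (0 < lam (cball_e x r))%E.
Proof.
move=> r0; pose h := r / n.+1%:R.
have N0 : 0 < n.+1%:R :> R by rewrite ltr0n.
have h0 : 0 < h by rewrite divr_gt0.
apply: (@lt_le_trans _ _ (lam (box (x - const_mx h) (x + const_mx h)))).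
  rewrite lamE => [|i]; last by rewrite !mxE lerD2l; lra.
  rewrite lte_fin prodr_gt0// => i _; rewrite !mxE; lra.
apply: le_measure; rewrite ?inE.
- exact: measurable_box.
- exact: measurable_cball.
move=> y yb /=; rewrite /sqnorm.
apply: (@le_trans _ _ (\sum_(i < n.+1) h ^+ 2)).
  apply: ler_sum => i _; have := yb i; rewrite !mxE => /andP[y1 y2].
  by rewrite -real_normK ?num_real// lerXn2r ?nnegrE ?(ltW h0)// ler_norml; apply/andP; split; lra.
have rE : r = h * n.+1%:R by rewrite divfK// gt_eqF.
clearbody h; rewrite sumr_const card_ord -mulr_natr rE exprMn.
apply: ler_wpM2l; first exact: sqr_ge0.
by rewrite expr2 ler_peMr ?ler0n ?ler1n.
Qed.

Lemma Rint_indic (f : V -> R) (B : set V) : measurable (B : set E) ->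
  rint lam f -> (\int[lam]_(y in (B : set E)) (f y)%:E)%E = (\int[lam]_y (f y * \1_B y))%:E.
Proof.
move=> mB fi; rewrite RintE; last first.
  apply: (rintM fi (M := 1)); first exact: measurable_indic.
  by move=> y; rewrite indicE; case: (_ \in _); rewrite ?normr1 ?normr0.
rewrite [LHS]integral_mkcond; apply: eq_integral => y _.
by rewrite patchE indicE; case: (_ \in _); rewrite ?mulr1 ?mulr0.
Qed.

(** Under the integral [psb] may replace [psi], which is finite almost everywhere on U. At the
    centre finiteness has to be assumed, since [psb] is 0 where [psi] is infinite. *)
Lemma psb_mean x r : U x -> psi x \is a fin_num -> 0 < r -> cball_e x r `<=` U ->
  \int[lam]_y (psb y * \1_(cball_e x r) y) <= psb x * fine (lam (cball_e x r)).
Proof.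
move=> Ux fx r0 BU; have [_ _ /(_ x r Ux r0 BU)] := psi_sh.
set B := cball_e x r; have mB : measurable (B : set E) := measurable_cball x r.
have lB0 : (0 < lam B)%E := cball_gt0 x r0.
have lBoo : (lam B < +oo)%E.
  by apply: le_lt_trans lamU; apply: le_measure; rewrite ?inE.
have -> : (\int[lam]_(y in (B : set E)) psi y = \int[lam]_(y in (B : set E)) (psb y)%:E)%E.
  apply: ae_eq_integral => //.
  - exact: measurable_int (integrableS mU mB BU psi_int).
  - apply/measurable_EFinP; apply: measurable_funTS; exact: rint_measurable rint_psb.
  - have [N [mN N0 sN]] := psi_ae_fin; exists N; split => //.
    apply: subset_trans sN => y /=; apply: contra_not => fy By.
    by rewrite psb_in ?fineK//; [exact: fy (BU _ By)|exact: BU].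
rewrite (Rint_indic mB rint_psb) -(fineK fx) -(psb_in Ux) -EFinM lee_fin.
have fB : 0 < fine (lam B) by rewrite fine_gt0// lB0.
by rewrite ler_pdivrMl// mulrC.
Qed.

Definition nrm1 : R := \int[lam]_y `|psb y|.
Definition pr (d rh : R) : R := gc n d * expR (- (rh ^+ 2 / (2 * d))).

Lemma nrm1_ge0 : 0 <= nrm1. Proof. by apply: Rint_ge0. Qed.

Lemma pr_gt0 d rh : 0 < d -> 0 < pr d rh.
Proof. by move=> d0; rewrite mulr_gt0 ?gc_gt0 ?expR_gt0. Qed.

Lemma pk_superlevel (d l : R) (x : V) : 0 < d -> 0 < l < gc n d ->
  [set y | l <= pk d x y] = cball_e x (Num.sqrt (2 * d * ln (gc n d / l))).
Proof.
move=> d0 /andP[l0 lg]; have g0 := gc_gt0 n d0.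
have gl1 : 1 < gc n d / l by rewrite ltr_pdivlMr// mul1r.
have L0 : 0 < ln (gc n d / l) by rewrite ln_gt0.
have r0 : 0 <= 2 * d * ln (gc n d / l) by rewrite mulr_ge0 ?mulr_ge0// ltW.
have key a : (l <= gc n d * expR a) = (ln l - ln (gc n d) <= a).
  have -> : gc n d * expR a = expR (ln (gc n d) + a) by rewrite expRD lnK ?posrE.
  by rewrite -{1}[l]lnK ?posrE// ler_expR lerBlDl.
apply/seteqP; split=> y; rewrite /cball_e /= sqr_sqrtr// /pk gauss_gcE key;
  rewrite ln_div ?posrE// mulNr lerNr ler_pdivrMr ?mulr_gt0//; lra.
Qed.

End Superharmonic.

Section GaussianTail.
Variables (R : realType) (n : nat).

Lemma expRN_le_pow (m : nat) (y : R) : (0 < m)%N -> 0 < y -> expR (- y) <= (m%:R / y) ^+ m.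
Proof.
move=> m0 y0; have M0 : 0 < m%:R :> R by rewrite ltr0n.
rewrite expRN -[leRHS]invrK -exprVn invf_div lef_pV2 ?posrE ?expR_gt0 ?exprn_gt0 ?divr_gt0//.
have -> : expR y = expR (y / m%:R) ^+ m.
  by rewrite -expRM_natl; congr expR; field; rewrite gt_eqF.
apply: lerXn2r; rewrite ?nnegrE ?expR_ge0//; first by rewrite divr_ge0// ltW.
by have := expR_ge1Dx (y / m%:R); lra.
Qed.

Lemma gc_le_pow (d : R) : 0 < d <= 1 -> gc n d <= (d ^+ n.+1)^-1.
Proof.
move=> /andP[d0 d1]; have pi2 : 2 <= pi :> R by exact: pi_ge2.
rewrite lef_pV2 ?posrE ?exprn_gt0 ?sqrtr_gt0 ?mulr_gt0 ?pi_gt0//.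
apply: lerXn2r; rewrite ?nnegrE ?sqrtr_ge0 ?(ltW d0)//.
rewrite -(@ler_sqr R) ?nnegrE ?sqrtr_ge0 ?(ltW d0)// sqr_sqrtr; last first.
  by rewrite !mulr_ge0 ?pi_ge0// ltW.
by rewrite expr2; nra.
Qed.

(** Take m = n + 3 in exp (-y) <= (m / y)^m: n + 1 powers of d compensate the prefactor [gc], and
    two remain. *)
Lemma pr_small (rh : R) : 0 < rh -> exists2 C : R, 0 <= C &
  forall d, 0 < d <= 1 -> pr n d rh <= C * d ^+ 2.
Proof.
move=> rh0; exists ((2 * n.+3%:R / rh ^+ 2) ^+ n.+3).
  by rewrite exprn_ge0// divr_ge0 ?sqr_ge0.
move=> d /andP[d0 d1].
have y0 : 0 < rh ^+ 2 / (2 * d) by rewrite divr_gt0 ?exprn_gt0 ?mulr_gt0.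
have h1 := @expRN_le_pow n.+3 _ isT y0.
have h2 : gc n d <= (d ^+ n.+1)^-1 by apply: gc_le_pow; rewrite d0.
apply: (@le_trans _ _ ((d ^+ n.+1)^-1 * (n.+3%:R / (rh ^+ 2 / (2 * d))) ^+ n.+3)).
  by apply: ler_pM => //; exact: ltW (gc_gt0 n d0).
have -> : n.+3%:R / (rh ^+ 2 / (2 * d)) = 2 * n.+3%:R / rh ^+ 2 * d.
  by field; rewrite !gt_eqF.
rewrite [X in _ * X]exprMn mulrCA (_ : n.+3 = (n.+1 + 2)%N); last by rewrite addn2.
by rewrite [d ^+ (_ + _)]exprD mulKf// gt_eqF// exprn_gt0.
Qed.

End GaussianTail.

(** * The super mean value inequality for the heat kernel *)

Section SuperMean.
Variables (R : realType) (n : nat).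
Local Notation V := 'rV[R]_(n.+1).
Local Notation E := (Rd R n).
Variable lam : {sigma_finite_measure set E -> \bar R}.
Hypothesis lamE : is_lebesgue_d lam.
Hypothesis lam_gauss : forall t : R, 0 < t -> gauss lam t setT = 1%E.
Local Notation hP := (heat lam).
Variables (U : set V) (psi : V -> \bar R).
Hypotheses (oU : open U) (lamU : (lam U < +oo)%E).
Hypothesis psi_int : lam.-integrable (U : set E) psi.
Hypothesis psi_sh : superharmonic_in lam U psi.
Local Notation psb := (psb U psi).
Local Notation nrm1 := (nrm1 lam U psi).
Local Notation LU := (fine (lam U)).

Let mU : measurable (U : set E). Proof. exact: measurable_open. Qed.
Let psb_i : rint lam psb. Proof. exact: rint_psb. Qed.
Let LU_ge0 : 0 <= LU. Proof. exact: fine_ge0. Qed.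

Lemma sub_lty (B : set V) : measurable (B : set E) -> B `<=` U -> (lam B < +oo)%E.
Proof. by move=> mB BU; apply: le_lt_trans lamU; apply: le_measure; rewrite ?inE. Qed.

(* Superlevel sets of the Gaussian kernel are balls, so a layer-cake staircase
   turns the mean value inequality on balls into one for the kernel. *)
Lemma staircase (d rh : R) (x : V) : 0 < d -> 0 < rh ->
  exists (M : nat) (h : R) (B : nat -> set V),
  [/\ 0 < h, forall i, (i < M)%N -> exists2 r, 0 < r <= rh & B i = cball_e x r,
      forall y, `|pk d x y - \sum_(i < M) h * \1_(B i) y| <= 2 * pr n d rh &
      forall y, ~ cball_e x rh y -> \sum_(i < M) h * \1_(B i) y = 0].
Proof.
move=> d0 rh0; set p := pr n d rh; set g := gc n d.
have p0 : 0 < p := pr_gt0 n rh d0.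
have g0 : 0 < g := gc_gt0 n d0.
have y0 : 0 < rh ^+ 2 / (2 * d) by rewrite divr_gt0 ?exprn_gt0 ?mulr_gt0.
have pg : p < g by rewrite gtr_pMr// -[ltRHS]expR0 ltr_expR; lra.
(* Enough steps for the height h to be at most p, the kernel value at distance rh. The lowest level
   is p, which keeps every ball within radius rh. *)
pose M := (Num.truncn ((g - p) / p)).+1.
have M0 : 0 < M%:R :> R by rewrite ltr0n.
pose h := (g - p) / M%:R.
have h0 : 0 < h by rewrite divr_gt0// subr_gt0.
have hp : h <= p.
  rewrite ler_pdivrMr// mulrC -ler_pdivrMr//; exact: ltW (truncnS_gt _).
have hM : h * M%:R = g - p by rewrite divfK// gt_eqF.
pose B i := [set y : V | p + i%:R * h <= pk d x y].
have stepE y : \sum_(i < M) h * \1_(B i) y =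
    h * \sum_(i < M) (i%:R <= (pk d x y - p) / h)%R%:R.
  rewrite -mulr_sumr; congr (_ * _); apply: eq_bigr => i _; rewrite indicE.
  congr ((nat_of_bool _)%:R); apply/idP/idP; rewrite ler_pdivlMr// lerBrDl.
    by rewrite inE.
  by move=> ?; rewrite inE.
exists M, h, B; split => //.
- move=> i iM.
  have l0 : 0 < p + i%:R * h by rewrite ltr_wpDr// mulr_ge0 ?ler0n// ltW.
  have lg : p + i%:R * h < g.
    have : i%:R * h < M%:R * h by rewrite ltr_pM2r// ltr_nat.
    by rewrite [M%:R * h]mulrC hM; lra.
  have gl1 : 1 < g / (p + i%:R * h) by rewrite ltr_pdivlMr// mul1r.
  have L0 : 0 < ln (g / (p + i%:R * h)) by rewrite ln_gt0.
  have r0 : 0 < 2 * d * ln (g / (p + i%:R * h)) by rewrite !mulr_gt0.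
  exists (Num.sqrt (2 * d * ln (g / (p + i%:R * h)))); last first.
    by rewrite /B pk_superlevel// l0.
  rewrite sqrtr_gt0 r0 /= -[leRHS](ger0_norm (ltW rh0)) -sqrtr_sqr ler_wsqrtr//.
  have : ln (g / (p + i%:R * h)) <= ln (g / p).
    rewrite ler_ln ?posrE ?divr_gt0//; apply: ler_wpM2l; first exact: ltW.
    by rewrite lef_pV2 ?posrE// lerDl mulr_ge0 ?ler0n// ltW.
  have -> : ln (g / p) = rh ^+ 2 / (2 * d).
    rewrite /p /pr -/g invfM mulrA divff ?gt_eqF// mul1r -expRN opprK expRK//.
  by rewrite ler_pdivlMr ?mulr_gt0// mulrC.
- move=> y; rewrite stepE; set s := (_ - _) / h.
  have sE : pk d x y = p + s * h by rewrite /s divfK ?gt_eqF//; ring.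
  have pk0 := pk_gt0 x y d0.
  have sM : s <= M%:R.
    rewrite ler_pdivrMr// mulrC hM lerD2r; exact: pk_le_gc.
  have [c1 c2 c3] := count_le M s; rewrite sE ler_norml.
  have [s0|s0] := ltP s 0.
    rewrite c1// mulr0 subr0; apply/andP; split; nra.
  have := c2 s0; have := c3 sM; set S := \sum_(i < M) _ => S1 S2.
  by apply/andP; split; nra.
- move=> y yB; rewrite stepE; have [c1 _ _] := count_le M ((pk d x y - p) / h).
  rewrite c1 ?mulr0// ltr_pdivrMr// mul0r subr_lt0 /p /pr /pk gauss_gcE.
  rewrite ltr_pM2l// ltr_expR mulNr ltrN2 ltr_pM2r ?invr_gt0 ?mulr_gt0//.
  by rewrite ltNge; apply/negP => yy; exact: yB.
Qed.

(** Sum the mean value inequalities over the balls of the staircase, with weights h. Two errors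
    arise: the staircase differs from the kernel by 2 p, paid by the L^1 norm of [psb], and its mass
    is not exactly 1, paid by |psb x|. *)
Lemma hP_psb_le (d rh : R) (x : V) : 0 < d -> 0 < rh -> psi x \is a fin_num ->
  cball_e x rh `<=` U ->
  hP d psb x - psb x <= 2 * pr n d rh * (nrm1 + `|psb x| * LU) +
    `|psb x| * (64 * kap R n * d ^+ 2 / (rh ^+ 2) ^+ 2).
Proof.
move=> d0 rh0 fx BU.
have Ux : U x by apply: BU; rewrite /cball_e /= subrr /sqnorm big1 ?sqr_ge0// => i _; rewrite mxE expr0n.
have [M [h [B [h0 Bball err out]]]] := staircase x d0 rh0.
set p := pr n d rh in err *; have p0 : 0 < p := pr_gt0 n rh d0.
pose st y := \sum_(i < M) h * \1_(B i) y.
have BiU (i : 'I_M) : B i `<=` U.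
  have [r /andP[r0 rr] ->] := Bball i (ltn_ord i).
  by apply: subset_trans BU; apply: sub_cball; rewrite (ltW r0).
have mB (i : 'I_M) : measurable (B i : set E).
  by have [r _ ->] := Bball i (ltn_ord i); exact: measurable_cball.
have iB (i : 'I_M) : rint lam \1_(B i) by apply: rint_indic => //; exact: sub_lty.
have iBp (i : 'I_M) : rint lam (fun y => psb y * \1_(B i) y).
  apply: (rintM psb_i (M := 1)); first exact: measurable_indic.
  by move=> y; rewrite indicE; case: (_ \in _); rewrite ?normr1 ?normr0.
have ist : rint lam st by apply: rint_sum => i; exact: rintZ.
have istp : rint lam (fun y => psb y * st y).
  rewrite (_ : (fun y => _) = fun y => \sum_(i < M) h * (psb y * \1_(B i) y)).
    by apply: rint_sum => i; exact: rintZ.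
  by apply/funext => y; rewrite /st mulr_sumr; apply: eq_bigr => i _; rewrite mulrCA.
have ipk := rint_pk lamE lam_gauss x d0.
have S1 : \int[lam]_y (psb y * st y) <= psb x * \int[lam]_y st y.
  have -> : \int[lam]_y (psb y * st y) = \int[lam]_y (\sum_(i < M) h * (psb y * \1_(B i) y)).
    by apply: eq_Rint => y; rewrite /st mulr_sumr; apply: eq_bigr => i _; rewrite mulrCA.
  rewrite !Rint_sum; [|by move=> i; exact: rintZ|by move=> i; exact: rintZ].
  rewrite mulr_sumr; apply: ler_sum => i _.
  rewrite (RintZ h (iBp i)) (RintZ h (iB i)) Rint_indicE// mulrCA ler_pM2l//.
  have [r /andP[r0 rr] Br] := Bball i (ltn_ord i); have := BiU i; rewrite Br => BrU.
  exact: psb_mean.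
have S2 : `|1 - \int[lam]_y st y| <= 2 * p * LU + 64 * kap R n * d ^+ 2 / (rh ^+ 2) ^+ 2.
  rewrite -{1}(Rint_pk lamE lam_gauss x d0) -RintB//.
  have mBr := measurable_cball x rh.
  have iBr : rint lam \1_(cball_e x rh) by apply: rint_indic => //; exact: sub_lty.
  have i4 := rint_moment4 lamE lam_gauss x d0.
  have rr0 : 0 < (rh ^+ 2) ^+ 2 by rewrite !exprn_gt0.
  (* The fourth moment bounds the kernel mass outside the ball by O(d^2); the second moment would
     give only O(d), the order of the main term. *)
  apply: (@le_trans _ _ (\int[lam]_y (2 * p * \1_(cball_e x rh) y +
      ((rh ^+ 2) ^+ 2)^-1 * (sqnorm (y - x) ^+ 2 * pk d x y)))).
    apply: norm_Rint_le; [exact: rintB|by apply: rintD; exact: rintZ|].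
    move=> y; rewrite indicE; have [yB|yB] := pselect (cball_e x rh y).
      rewrite mem_set// mulr1 (le_trans (err y))// lerDl.
      apply: mulr_ge0; first by rewrite invr_ge0 ltW.
      by apply: mulr_ge0; [exact: sqr_ge0|exact: pk_ge0].
    rewrite memNset// mulr0 add0r /st out// subr0 ger0_norm ?pk_ge0//.
    rewrite mulrA ler_peMl ?pk_ge0// mulrC ler_pdivlMr// mul1r.
    apply: lerXn2r; rewrite ?nnegrE ?sqr_ge0 ?sqnorm_ge0//.
    by rewrite leNgt; apply/negP => /ltW yy; exact: yB.
  rewrite RintD; [|exact: rintZ|exact: rintZ].
  rewrite (RintZ (2 * p) iBr) (RintZ _ i4) Rint_indicE//; apply: lerD.
    apply: ler_wpM2l; [by rewrite mulr_ge0// ltW|apply: fine_le].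
    - by rewrite ge0_fin_numE//; exact: sub_lty.
    - by rewrite ge0_fin_numE.
    - by apply: le_measure; rewrite ?inE.
  rewrite mulrC ler_wpM2r ?invr_ge0 ?(ltW rr0)//; exact: Rint_moment4.
have iP := rint_ipk x d0 psb_i.
have S3 : hP d psb x - \int[lam]_y (psb y * st y) <= 2 * p * nrm1.
  rewrite /heat -RintB// (le_trans (ler_norm _))//.
  rewrite -RintZ; last exact: rint_norm.
  apply: norm_Rint_le; [exact: rintB|exact/rintZ/rint_norm|].
  by move=> y; rewrite -mulrBr normrM mulrC ler_wpM2r//; exact: err.
have S4 : psb x * \int[lam]_y st y - psb x <= `|psb x| * (2 * p * LU + 64 * kap R n * d ^+ 2 / (rh ^+ 2) ^+ 2).
  rewrite -{2}[psb x]mulr1 -mulrBr (le_trans (ler_norm _))// normrM.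
  by rewrite ler_wpM2l// distrC.
move: S1 S3 S4; move: (hP d psb x) (\int[lam]_y _) (\int[lam]_y _) (psb x) => a1 a2 a3 a4; lra.
Qed.

(** Duality puts P_d on [psb], and [hP_psb_le] applies at almost every point of the support of F.
    Since F is nonnegative, the pointwise inequality keeps its direction. *)
Lemma super_mean (d rh MF : R) (F : V -> R) : 0 < d -> 0 < rh -> bmeas F MF ->
  (forall x, 0 <= F x) -> (forall x, F x != 0 -> cball_e x rh `<=` U) ->
  \int[lam]_x (psb x * (hP d F x - F x)) <=
  MF * (nrm1 * (4 * pr n d rh * LU + 64 * kap R n * d ^+ 2 / (rh ^+ 2) ^+ 2)).
Proof.
move=> d0 rh0 Fb F0 FU; have p0 := pr_gt0 n rh d0.
have MF0 : 0 <= MF := le_trans (normr_ge0 _) (Fb.2 0).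
set tl := 64 * kap R n * _ / _; set p := pr n d rh in p0 *.
have tl0 : 0 <= tl.
  have k0 : 0 <= kap R n := le_trans ler01 (kap_ge1 R n).
  by rewrite divr_ge0 ?sqr_ge0// mulr_ge0 ?sqr_ge0// mulr_ge0.
have i1 := Rint_Mb psb_i Fb.
have i2 := Rint_Mb psb_i (bmeas_hP lamE lam_gauss d0 Fb).
have i3 : rint lam (fun x => F x * hP d psb x).
  under eq_fun do rewrite mulrC.
  exact: rintM (rint_hP lamE lam_gauss d0 psb_i) Fb.1 Fb.2.
have -> : \int[lam]_x (psb x * (hP d F x - F x)) = \int[lam]_x (F x * hP d psb x - psb x * F x).
  under eq_Rint do rewrite mulrBr.
  by rewrite (RintB i2 i1) (RintB i3 i1) (hP_dual lamE lam_gauss d0 psb_i Fb).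
have iU : rint lam \1_U by apply: rint_indic.
pose G x := MF * (2 * p * nrm1 * \1_U x + (2 * p * LU + tl) * `|psb x|).
have iG : rint lam G.
  by apply: rintZ; apply: rintD; [exact: rintZ|exact/rintZ/rint_norm].
apply: (@le_trans _ _ (\int[lam]_x G x)).
  apply: ae_le_Rint => //; first exact: rintB.
  have [N [mN N0 sN]] := psi_ae_fin oU psi_int; exists N; split => //.
  apply: subset_trans sN => x /=; apply: contra_not => fx.
  have c10 : 0 <= 2 * p * nrm1.
    by apply: mulr_ge0; [rewrite mulr_ge0// ltW|exact: nrm1_ge0].
  have c20 : 0 <= 2 * p * LU + tl.
    by apply: addr_ge0 => //; apply: mulr_ge0 => //; rewrite mulr_ge0// ltW.
  have Kx0 : 0 <= 2 * p * nrm1 * \1_U x + (2 * p * LU + tl) * `|psb x|.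
    by apply: addr_ge0; apply: mulr_ge0.
  have Gx0 : 0 <= G x by apply: mulr_ge0.
  have [Fx|Fx] := eqVneq (F x) 0; first by rewrite Fx mul0r mulr0 subr0.
  have BU := FU _ Fx.
  have Ux : U x by apply: BU; rewrite /cball_e /= subrr /sqnorm big1 ?sqr_ge0// => i _; rewrite mxE expr0n.
  have h := hP_psb_le d0 rh0 (fx Ux) BU.
  rewrite [psb x * F x]mulrC -mulrBr.
  apply: (@le_trans _ _ (F x * (2 * p * nrm1 * \1_U x + (2 * p * LU + tl) * `|psb x|))).
    apply: ler_wpM2l => //; apply: (le_trans h); rewrite indicE mem_set// -/p -/tl.
    by rewrite le_eqVlt; apply/orP; left; apply/eqP; rewrite /=; ring.
  by apply: ler_wpM2r => //; rewrite (le_trans (ler_norm _))//; exact: Fb.2.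
rewrite RintZ; last by apply: rintD; [exact: rintZ|exact/rintZ/rint_norm].
apply: ler_wpM2l => //.
rewrite RintD; [|exact: rintZ|exact/rintZ/rint_norm].
rewrite (RintZ _ iU) (RintZ _ (rint_norm psb_i)) Rint_indicE// -/nrm1.
by rewrite le_eqVlt; apply/orP; left; apply/eqP; ring.
Qed.

End SuperMean.

(** * Continuity of the heat semigroup in L^1, in dual form *)

Section L1Continuity.
Variables (R : realType) (n : nat).
Local Notation V := 'rV[R]_(n.+1).
Local Notation E := (Rd R n).
Variable lam : {sigma_finite_measure set E -> \bar R}.
Hypothesis lamE : is_lebesgue_d lam.
Hypothesis lam_gauss : forall t : R, 0 < t -> gauss lam t setT = 1%E.
Local Notation hP := (heat lam).

Lemma open_cball (O : set V) (x : V) : open O -> O x ->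
  exists2 rh : R, 0 < rh & cball_e x rh `<=` O.
Proof.
move=> oO Ox; have /nbhs_ballP[e /= e0 eO] := oO x Ox.
exists (e / 2); first by rewrite divr_gt0.
move=> y xy; apply: eO; split => // i j; rewrite ord1 /ball /= distrC.
apply: (@le_lt_trans _ _ (e / 2)); last by lra.
have e20 : 0 <= e / 2 by lra.
rewrite -(@ler_sqr R) ?nnegrE// real_normK ?num_real//.
apply: (le_trans _ xy); rewrite /sqnorm (bigD1 j)//= !mxE lerDl.
by apply: sumr_ge0 => k _; exact: sqr_ge0.
Qed.

Lemma cvg0_harmonic (C : R) (u : nat -> R) : (\forall k \near \oo, 0 <= u k <= C * k.+1%:R^-1) ->
  u @ \oo --> (0 : R).
Proof.
move=> uC; apply: (@squeeze_cvgr _ _ _ _ (fun=> 0) (fun k => C * harmonic k) u) => //.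
  exact: cvg_cst.
rewrite -[X in _ --> X](mulr0 C); apply: cvgMl_tmp; exact: cvg_harmonic.
Qed.

(** Convergence of P_r g to g in L^1, expressed by testing against bounded functions: by duality the
    semigroup acts on F, and uniformity over the ball of radius M amounts to the norm. *)
Definition l1cont (g : V -> R) := forall e : R, 0 < e -> exists2 th : R, 0 < th &
  forall (r M : R) (F : V -> R), 0 < r <= th -> bmeas F M ->
    `|\int[lam]_x (g x * (hP r F x - F x))| <= e * M.

Let bd1 (O : set V) : measurable (O : set E) -> bmeas \1_O (1 : R).
Proof.
move=> mO; split; first exact: measurable_indic.
by move=> x; rewrite indicE; case: (_ \in _); rewrite ?normr1 ?normr0.
Qed.

Lemma bmeas_hPB (r M : R) (F : V -> R) : 0 < r -> bmeas F M ->
  bmeas (fun x => hP r F x - F x) (M + M).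
Proof. by move=> r0 Fb; exact: bmeasB (bmeas_hP lamE lam_gauss r0 Fb) Fb. Qed.

Let bool_dist (c : bool) (a : R) : 0 <= a <= 1 ->
  `|a - c%:R| <= c%:R + a - 2 * (c%:R * a).
Proof.
by move=> /andP[a0 a1]; case: c => /=; rewrite ler_norml; apply/andP; split; lra.
Qed.

(** Otherwise there are times r_k <= 1/(k+1) violating the bound. But at each point of O the kernel
    mass outside O is at most the fourth moment divided by the fourth power of the radius of a ball
    inside O, so dominated convergence gives 0. *)
Lemma open_defect (O : set V) : open O -> (lam O < +oo)%E ->
  forall e : R, 0 < e -> exists2 th : R, 0 < th & forall r, 0 < r <= th ->
    \int[lam]_x (\1_O x * (1 - hP r \1_O x)) <= e.
Proof.
move=> oO lO e e0; apply: contrapT => hn.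
have mO : measurable (O : set E) by exact: measurable_open.
have Ob := bd1 mO.
have /choice[r rP] : forall k : nat, exists r : R, 0 < r <= k.+1%:R^-1 /\
    e < \int[lam]_x (\1_O x * (1 - hP r \1_O x)).
  move=> k; apply: contrapT => hk; apply: hn; exists k.+1%:R^-1; first by rewrite invr_gt0 ltr0n.
  by move=> r rk; rewrite leNgt; apply/negP => ?; apply: hk; exists r.
have r0 k : 0 < r k by have [/andP[]] := rP k.
have h01 k x : 0 <= hP (r k) \1_O x <= 1.
  apply/andP; split; first exact: hP_ge0.
  by rewrite (le_trans (ler_norm _))//; exact: hP_le lamE lam_gauss _ _ _ _ (r0 k) Ob.
have : (fun k => \int[lam]_x (\1_O x * (1 - hP (r k) \1_O x))) @ \oo --> \int[lam]_x (0 : R).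
  apply: (@dominated_Rint _ E R lam (fun k x => \1_O x * (1 - hP (r k) \1_O x))
    (fun=> 0) \1_O).
  - move=> k; apply: measurable_funM; first exact: measurable_indic.
    apply: measurable_funB; first exact: measurable_cst.
    exact: measurable_hP Ob.1.
  - exact: measurable_cst.
  - exact: rint_indic.
  - move=> k x; rewrite indicE; move: (hP _ _ x) (h01 k x) => a /andP[a0 a1].
    by case: (_ \in _) => /=; rewrite ler_norml; apply/andP; split; lra.
  - move=> x; rewrite indicE; have [Ox|Ox] := pselect (O x); last first.
      by rewrite memNset// (_ : (fun _ => _) = fun=> 0) ?mul0r; [exact: cvg_cst|apply/funext => k; rewrite mul0r].
    rewrite mem_set//; have [rh rh0 BO] := open_cball oO Ox.
    pose C := 64 * kap R n / (rh ^+ 2) ^+ 2.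
    have rr0 : 0 < (rh ^+ 2) ^+ 2 by rewrite !exprn_gt0.
    have C0 : 0 <= C.
      by rewrite divr_ge0 ?(ltW rr0)// mulr_ge0// (le_trans ler01)// kap_ge1.
    have bnd k : 1 - hP (r k) \1_O x <= C * r k ^+ 2.
      rewrite -{1}(Rint_pk lamE lam_gauss x (r0 k)) -RintB; first last.
      - exact: rint_bpk lamE lam_gauss _ _ _ _ (r0 k) Ob.
      - exact: rint_pk.
      have i4 := rint_moment4 lamE lam_gauss x (r0 k).
      apply: (@le_trans _ _ (\int[lam]_y (((rh ^+ 2) ^+ 2)^-1 * (sqnorm (y - x) ^+ 2 * pk (r k) x y)))).
        apply: le_Rint.
        + by apply: rintB; [exact: rint_pk|exact: rint_bpk lamE lam_gauss _ _ _ _ (r0 k) Ob].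
        + exact: rintZ.
        + move=> y; have p0 := pk_ge0 x y (r0 k); rewrite indicE.
          have [yB|yB] := pselect (O y).
            rewrite mem_set// mul1r subrr; apply: mulr_ge0; first by rewrite invr_ge0 ltW.
            by apply: mulr_ge0; first exact: sqr_ge0.
          rewrite memNset// mul0r subr0 mulrA ler_peMl// mulrC ler_pdivlMr// mul1r.
          apply: lerXn2r; rewrite ?nnegrE ?sqr_ge0 ?sqnorm_ge0//.
          by rewrite leNgt; apply/negP => /ltW yy; apply: yB; exact: BO.
      rewrite (RintZ _ i4).
      have -> : C * r k ^+ 2 = ((rh ^+ 2) ^+ 2)^-1 * (64 * kap R n * r k ^+ 2) by rewrite /C; ring.
      by apply: ler_wpM2l; [rewrite invr_ge0 ltW|exact: Rint_moment4].
    have bnd2 k : 1 - hP (r k) \1_O x <= C * k.+1%:R^-1.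
      apply: (le_trans (bnd k)); apply: ler_wpM2l => //.
      have [/andP[_ rk] _] := rP k; have rk0 := ltW (r0 k).
      have k1 : k.+1%:R^-1 <= 1 :> R by rewrite invf_le1 ?ltr0n// ler1n.
      by rewrite expr2 (le_trans (ler_wpM2r rk0 (le_trans rk k1)))// mul1r.
    suff : (fun k => true%:R * (1 - hP (r k) \1_O x)) @ \oo --> (0 : R) by [].
    apply: (@cvg0_harmonic C); apply: nearW => k; rewrite mul1r.
    by rewrite bnd2 subr_ge0 andbT; have /andP[] := h01 k x.
rewrite Rintegral_cst// mul0r => /cvgrPdist_lt /(_ e e0)[K _ /(_ K (leqnn K))] /=.
have [_ eK] := rP K; rewrite sub0r normrN ltNge => /negP; apply.
by rewrite (le_trans (ltW eK))// ler_norm.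
Qed.

(** The semigroup preserves mass, so the L^1 distance between the indicator and its image is twice
    the mass that leaks out of O; hence e / 2 in the call to [open_defect]. *)
Lemma l1cont_indic (O : set V) : open O -> (lam O < +oo)%E -> l1cont \1_O.
Proof.
move=> oO lO e e0; have e20 : 0 < e / 2 by lra.
have [th th0 thP] := open_defect oO lO e20; exists th => // r M F rth Fb.
have r0 : 0 < r by case/andP: rth.
have M0 : 0 <= M := le_trans (normr_ge0 _) (Fb.2 0).
have mO : measurable (O : set E) by exact: measurable_open.
have Ob := bd1 mO; have iO : rint lam \1_O by exact: rint_indic.
have iH := rint_hP lamE lam_gauss r0 iO.
have h01 x : 0 <= hP r \1_O x <= 1.
  apply/andP; split; first exact: hP_ge0.
  by rewrite (le_trans (ler_norm _))//; exact: hP_le lamE lam_gauss _ _ _ _ r0 Ob.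
have i1 := Rint_Mb iO Fb.
have i2 := Rint_Mb iO (bmeas_hP lamE lam_gauss r0 Fb).
have i3 : rint lam (fun x => F x * hP r \1_O x).
  under eq_fun do rewrite mulrC.
  exact: rintM iH Fb.1 Fb.2.
have -> : \int[lam]_x (\1_O x * (hP r F x - F x)) = \int[lam]_x (F x * hP r \1_O x - \1_O x * F x).
  under eq_Rint do rewrite mulrBr.
  by rewrite (RintB i2 i1) (RintB i3 i1) (hP_dual lamE lam_gauss r0 iO Fb).
have b1 : bmeas (fun _ : V => 1) (1 : R) by split => [|x]; [exact: measurable_cst|rewrite normr1].
have iOH : rint lam (fun x => \1_O x * hP r \1_O x).
  exact: Rint_Mb iO (bmeas_hP lamE lam_gauss r0 Ob).
have mass : \int[lam]_x hP r \1_O x = \int[lam]_x \1_O x.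
  have := hP_dual lamE lam_gauss r0 iO b1.
  under eq_Rint do rewrite (hP_cst lamE lam_gauss 1 _ r0) mulr1.
  by move=> ->; apply: eq_Rint => x; rewrite mul1r.
have iD : rint lam (fun x => \1_O x + hP r \1_O x - 2 * (\1_O x * hP r \1_O x)).
  by apply: rintB; [exact: rintD|exact: rintZ].
apply: (@le_trans _ _ (\int[lam]_x (M * (\1_O x + hP r \1_O x - 2 * (\1_O x * hP r \1_O x))))).
  apply: norm_Rint_le; [exact: rintB|exact: rintZ|move=> x].
  rewrite [\1_O x * F x]mulrC -mulrBr normrM; apply: ler_pM => //; first exact: Fb.2.
  by rewrite indicE; exact: bool_dist.
rewrite (RintZ _ iD) mulrC; apply: ler_wpM2r => //.
have := thP r rth.
have -> : \int[lam]_x (\1_O x * (1 - hP r \1_O x)) = \int[lam]_x \1_O x - \int[lam]_x (\1_O x * hP r \1_O x).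
  by under eq_Rint do rewrite mulrBr mulr1; rewrite RintB.
rewrite (RintB (rintD iO iH) (rintZ 2 iOH)) (RintD iO iH) (RintZ 2 iOH) mass.
by move: (\int[lam]_x _) (\int[lam]_x _) => a b'; lra.
Qed.

Lemma l1cont_lin (a b : R) (f g : V -> R) : rint lam f -> rint lam g ->
  l1cont f -> l1cont g -> l1cont (fun x => a * f x + b * g x).
Proof.
move=> fi gi fc gc' e e0.
pose k := `|a| + `|b| + 1; have k0 : 0 < k by rewrite /k ltr_wpDl// addr_ge0.
have ek : 0 < e / k by rewrite divr_gt0.
have [t1 t10 h1] := fc _ ek; have [t2 t20 h2] := gc' _ ek.
exists (Num.min t1 t2); first by rewrite lt_min t10.
move=> r M F /andP[r0]; rewrite le_min => /andP[r1 r2] Fb.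
have M0 : 0 <= M := le_trans (normr_ge0 _) (Fb.2 0).
have Db := bmeas_hPB r0 Fb.
have {}h1 := h1 r M F; have {}h2 := h2 r M F.
rewrite r0 r1 in h1; rewrite r0 r2 in h2.
have i1 := Rint_Mb fi Db; have i2 := Rint_Mb gi Db.
have -> : \int[lam]_x ((a * f x + b * g x) * (hP r F x - F x)) =
   a * \int[lam]_x (f x * (hP r F x - F x)) + b * \int[lam]_x (g x * (hP r F x - F x)).
  rewrite -(RintZ a i1) -(RintZ b i2) -(RintD (rintZ a i1) (rintZ b i2)).
  by apply: eq_Rint => x; rewrite mulrDl !mulrA.
rewrite (le_trans (ler_normD _ _))// !normrM.
have k1 := ler_wpM2l (normr_ge0 a) (h1 isT Fb); have k2 := ler_wpM2l (normr_ge0 b) (h2 isT Fb).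
apply: (le_trans (lerD k1 k2)).
have -> : `|a| * (e / k * M) + `|b| * (e / k * M) = e * M * ((`|a| + `|b|) / k) by field; rewrite gt_eqF.
rewrite ler_piMr//; first by rewrite mulr_ge0// ltW.
by rewrite ler_pdivrMr// mul1r /k lerDl.
Qed.

Lemma l1cont_sum (N : nat) (F : nat -> V -> R) : (forall i, rint lam (F i)) ->
  (forall i, l1cont (F i)) -> l1cont (fun x => \sum_(i < N) F i x).
Proof.
move=> Fi Fc; elim: N => [|N ih].
  move=> e e0; exists 1 => // r M G _ Gb.
  under eq_Rint do rewrite big_ord0 mul0r.
  by rewrite Rintegral_cst// mul0r normr0 mulr_ge0 ?(ltW e0)// (le_trans (normr_ge0 _) (Gb.2 0)).
have := @l1cont_lin 1 1 _ _ (rint_sum (index_enum 'I_N) (fun i : 'I_N => Fi i)) (Fi N) ih (Fc N).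
by congr l1cont; apply/funext => x; rewrite big_ord_recr /= !mul1r.
Qed.

Lemma l1cont_lim (g : V -> R) : rint lam g ->
  (forall e : R, 0 < e -> exists g' : V -> R,
     [/\ rint lam g', l1cont g' & \int[lam]_x `|g x - g' x| <= e]) -> l1cont g.
Proof.
move=> gi ap e e0; have e40 : 0 < e / 4 by lra.
have [g' [gi' gc' gg']] := ap _ e40; have [th th0 thP] := gc' _ (divr_gt0 e0 (ltr0n R 2)).
exists th => // r M F rth Fb; have /andP[r0 _] := rth.
have M0 : 0 <= M := le_trans (normr_ge0 _) (Fb.2 0).
have Db := bmeas_hPB r0 Fb.
have i1 := Rint_Mb gi Db; have i2 := Rint_Mb gi' Db.
have i3 := rint_norm (rintB gi gi').
have -> : \int[lam]_x (g x * (hP r F x - F x)) =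
  \int[lam]_x (g' x * (hP r F x - F x)) + \int[lam]_x ((g x - g' x) * (hP r F x - F x)).
  rewrite -RintD//; last by exact: Rint_Mb (rintB gi gi') Db.
  by apply: eq_Rint => x; rewrite -mulrDl subrKC.
rewrite (le_trans (ler_normD _ _))//.
have h2 : `|\int[lam]_x ((g x - g' x) * (hP r F x - F x))| <= (M + M) * (e / 4).
  apply: (@le_trans _ _ (\int[lam]_x ((M + M) * `|g x - g' x|))).
    apply: norm_Rint_le; [exact: Rint_Mb (rintB gi gi') Db|exact: rintZ|].
    by move=> x; rewrite normrM mulrC ler_wpM2r//; exact: Db.2.
  by rewrite (RintZ _ i3) ler_wpM2l// addr_ge0.
have h1 := thP r M F rth Fb.
by apply: (le_trans (lerD h1 h2)); rewrite le_eqVlt; apply/orP; left; apply/eqP; field.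
Qed.

Section LowerSemicontinuous.
Variables (U : set V) (psi : V -> \bar R).
Hypotheses (oU : open U) (lamU : (lam U < +oo)%E).
Hypothesis psi_int : lam.-integrable (U : set E) psi.
Hypothesis psi_lsc : forall x, U x -> forall a : R, (a%:E < psi x)%E ->
  exists2 W, nbhs x W & forall y, W y -> (a%:E < psi y)%E.
Local Notation psb := (psb U psi).

Let Oa (a : R) : set V := U `&` [set x | (a%:E < psi x)%E].

Let oOa a : open (Oa a).
Proof.
rewrite openE => x [Ux ax]; have [W Wx Wa] := psi_lsc Ux ax.
by apply: filterI; [exact: oU|apply: filterS Wx].
Qed.

Let lOa a : (lam (Oa a) < +oo)%E.
Proof. by apply: (sub_lty oU lamU); [exact: (measurable_open (@oOa a))|exact: subIsetl]. Qed.

Let iOa a : rint lam \1_(Oa a).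
Proof. by apply: rint_indic; [exact: (measurable_open (@oOa a))|exact: lOa]. Qed.

Let iU : rint lam \1_U.
Proof. by apply: rint_indic; [exact: measurable_open oU|exact: lamU]. Qed.

(** A staircase of step 1/(k+1) reaching height k+1 on either side of 0. The sets {psi > a} are open
    by lower semicontinuity; for negative levels the set {psi <= a} is U minus such a set.
    Indicators of open sets thus approximate [psb] in L^1, with no appeal to density of continuous
    functions. *)
Let sk (k : nat) (x : V) : R :=
  k.+1%:R^-1 * \sum_(i < k.+1 ^ 2) \1_(Oa (i%:R / k.+1%:R)) x +
  (- k.+1%:R^-1) * \sum_(i < k.+1 ^ 2) (1 * \1_U x + (-1) * \1_(Oa (- (i%:R / k.+1%:R))) x).

Let rint_sk k : rint lam (sk k).
Proof.
apply: rintD; apply: rintZ; apply: rint_sum => i //.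
by apply: rintD; exact: rintZ.
Qed.

Let l1cont_sk k : l1cont (sk k).
Proof.
apply: l1cont_lin.
- by apply: rint_sum => i.
- by apply: rint_sum => i; apply: rintD; exact: rintZ.
- by apply: (@l1cont_sum _ (fun i => \1_(Oa (i%:R / k.+1%:R)))) => i //; exact: l1cont_indic.
- apply: (@l1cont_sum _ (fun i x => 1 * \1_U x + (-1) * \1_(Oa (- (i%:R / k.+1%:R))) x)) => i.
    by apply: rintD; exact: rintZ.
  by apply: l1cont_lin => //; apply: l1cont_indic.
Qed.

Let sk_out k x : ~ U x -> sk k x = 0.
Proof.
move=> Ux; rewrite /sk !big1 ?mulr0 ?addr0// => i _.
  by rewrite !indicE !memNset ?mulr0 ?addr0//; move=> [].
by rewrite indicE memNset//; move=> [].
Qed.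

Let sk_in k x : U x -> psi x \is a fin_num ->
  `|sk k x| <= `|psb x| + 1 /\ (`|psb x| <= k.+1%:R -> `|sk k x - psb x| <= k.+1%:R^-1).
Proof.
move=> Ux fx; set K : R := k.+1%:R; have K0 : 0 < K by rewrite ltr0n.
set t := psb x; have tE : psi x = t%:E by rewrite /t psb_in// fineK.
have -> : sk k x = K^-1 * (\sum_(i < k.+1 ^ 2) (i%:R < K * t)%R%:R -
    \sum_(i < k.+1 ^ 2) (i%:R <= - (K * t))%R%:R).
  rewrite /sk mulrBr mulNr -/K; congr (_ * _ - _ * _); apply: eq_bigr => i _.
    rewrite indicE; congr ((nat_of_bool _)%:R).
    have -> : (i%:R < K * t) = (i%:R / K < t) by rewrite ltr_pdivrMr// mulrC.
    apply/idP/idP; rewrite inE /Oa /= tE lte_fin; first by case.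
    by [].
  rewrite !indicE mem_set// mul1r mulN1r.
  have -> : (i%:R <= - (K * t)) = ~~ (- (i%:R / K) < t).
    by rewrite -leNgt [in RHS]lerNr ler_pdivrMr// mulNr [t * K]mulrC.
  have -> : (x \in Oa (- (i%:R / K))) = (- (i%:R / K) < t).
    by apply/idP/idP; rewrite inE /Oa /= tE lte_fin; [case|].
  by case: (_ < t); rewrite ?subrr ?subr0.
set A := \sum_(i < _) _; set B := \sum_(i < _) _.
have [a1 a2 a3] := count_lt (k.+1 ^ 2) (K * t).
have [b1 b2 b3] := count_le (k.+1 ^ 2) (- (K * t)).
rewrite -/A in a1 a2 a3; rewrite -/B in b1 b2 b3.
have KK : (k.+1 ^ 2)%:R = K * K :> R by rewrite natrX expr2.
rewrite KK in a3 b3.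
have AB : `|A - B| <= K * `|t| + 1.
  have [t0|t0] := ltP 0 t.
    rewrite b1 ?subr0; last by rewrite oppr_lt0 mulr_gt0.
    have A0 : 0 <= A by apply: sumr_ge0 => i _; rewrite ler0n.
    by rewrite ger0_norm// (gtr0_norm t0) a2// mulr_ge0// ltW.
  rewrite a1 ?sub0r ?normrN; last by rewrite pmulr_rle0.
  have B0 : 0 <= B by apply: sumr_ge0 => i _; rewrite ler0n.
  by rewrite ger0_norm// (ler0_norm t0) mulrN b2// oppr_ge0 pmulr_rle0.
split.
  rewrite normrM gtr0_norm ?invr_gt0// ler_pdivrMl// (le_trans AB)//.
  by rewrite mulrDr mulr1 lerD2l ler1n.
move=> tK; rewrite -[X in `|_ - X|](mulKf (lt0r_neq0 K0)) -mulrBr normrM gtr0_norm ?invr_gt0//.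
rewrite ler_piMr ?invr_ge0 ?(ltW K0)//.
have [t0|t0] := ltP 0 t.
  rewrite b1 ?subr0; last by rewrite oppr_lt0 mulr_gt0.
  have h2 : A <= K * t + 1 by apply: a2; rewrite mulr_ge0// ltW.
  have h3 : K * t <= A by apply: a3; rewrite ler_pM2l// (le_trans (ler_norm _) tK).
  by rewrite ler_norml; apply/andP; split; lra.
rewrite a1; last by rewrite pmulr_rle0.
have h2 : B <= - (K * t) + 1 by apply: b2; rewrite oppr_ge0 pmulr_rle0.
have h3 : - (K * t) <= B.
  apply: b3; rewrite -mulrN ler_pM2l//; apply: le_trans tK; rewrite -normrN; exact: ler_norm.
by rewrite ler_norml; apply/andP; split; lra.
Qed.

Lemma l1cont_psb : l1cont psb.
Proof.
have pi := rint_psb oU psi_int.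
have iG : rint lam (fun x => 2 * `|psb x| + 1 * \1_U x).
  by apply: rintD; apply: rintZ => //; exact: rint_norm.
have cv : (fun k => \int[lam]_x `|psb x - sk k x|) @ \oo --> \int[lam]_x (0 : R).
  apply: (@ae_dominated_Rint _ _ _ lam _ _ (fun x => 2 * `|psb x| + 1 * \1_U x)) => //.
  - by move=> k; apply: (rint_measurable (mu := lam)); exact/rint_norm/rintB.
  - have [N [mN N0 sN]] := psi_ae_fin oU psi_int; exists N; split => //.
    apply: subset_trans sN => x /=; apply: contra_not => fx k; rewrite normr_id.
    have [Ux|Ux] := pselect (U x); last first.
      by rewrite sk_out// psb_out// subr0 normr0 addr_ge0 ?mulr_ge0.
    have [h _] := sk_in k Ux (fx Ux).
    rewrite indicE mem_set// mulr1 (le_trans (ler_normB _ _))//; lra.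
  - have [N [mN N0 sN]] := psi_ae_fin oU psi_int; exists N; split => //.
    apply: subset_trans sN => x /=; apply: contra_not => fx.
    have [Ux|Ux] := pselect (U x); last first.
      rewrite (_ : (fun _ => _) = fun=> 0); first exact: cvg_cst.
      by apply/funext => k; rewrite sk_out// psb_out// subr0 normr0.
    suff : (fun k => `|psb x - sk k x|) @ \oo --> (0 : R) by [].
    apply: (@cvg0_harmonic 1); exists (Num.truncn `|psb x|) => // k /= tk.
    rewrite normr_ge0 /= mul1r distrC.
    have [_ h] := sk_in k Ux (fx Ux); apply: h.
    by apply: ltW; apply: (lt_le_trans (truncnS_gt _)); rewrite ler_nat.
rewrite Rintegral_cst// mul0r in cv.
apply: l1cont_lim => // e e0.
move/cvgrPdist_lt : cv => /(_ e e0)[K _ /(_ K (leqnn K))] /= h.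
exists (sk K); split => //.
by move: h; rewrite sub0r normrN => /ltW; apply: le_trans; exact: ler_norm.
Qed.

End LowerSemicontinuous.
End L1Continuity.

(** * Superharmonic functions tested against potentials that are small off U *)

Section Core.
Variables (R : realType) (n : nat).
Local Notation V := 'rV[R]_(n.+1).
Local Notation E := (Rd R n).
Variable lam : {sigma_finite_measure set E -> \bar R}.
Hypothesis lamE : is_lebesgue_d lam.
Hypothesis lam_gauss : forall t : R, 0 < t -> gauss lam t setT = 1%E.
Local Notation hP := (heat lam).
Variables (U : set V) (psi : V -> \bar R).
Hypotheses (oU : open U) (lamU : (lam U < +oo)%E).
Hypothesis psi_int : lam.-integrable (U : set E) psi.
Hypothesis psi_sh : superharmonic_in lam U psi.
Local Notation psb := (psb U psi).
Local Notation nrm1 := (nrm1 lam U psi).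

Let psb_i : rint lam psb. Proof. exact: rint_psb. Qed.

Lemma Rint_psb_le (f : V -> R) (M : R) : bmeas f M ->
  `|\int[lam]_x (psb x * f x)| <= M * nrm1.
Proof.
move=> fb; rewrite -(RintZ M (rint_norm psb_i)).
apply: norm_Rint_le; [exact: Rint_Mb fb|exact/rintZ/rint_norm|].
by move=> x; rewrite normrM mulrC ler_wpM2r//; exact: fb.2.
Qed.

Let dist_le_bound (a c b : R) : 0 <= a -> 0 <= c -> a <= b -> c <= b -> `|a - c| <= b.
Proof. by move=> *; rewrite ler_norml; apply/andP; split; lra. Qed.

(* Averaging over the grid times up to th telescopes [hP d f - f]. *)
Lemma averaging (d th e K b : R) (f g : V -> R) (i : nat) :
  0 < d -> 0 < th -> 0 <= e -> th / 2 <= i.+1%:R * d <= th ->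
  (forall (r M : R) (F : V -> R), 0 < r <= th -> bmeas F M ->
    `|\int[lam]_x (psb x * (hP r F x - F x))| <= e * M) ->
  bmeas f b -> (forall x, 0 <= f x) -> bmeas g (K * d) ->
  (forall x, g x = hP d f x - f x) ->
  \int[lam]_x (psb x * g x) <= (e * K + 2 * b * nrm1 / th) * d.
Proof.
move=> d0 th0 e0 /andP[J1 J2] hT fb f0 gb gE.
set J : R := i.+1%:R; have Jp : 0 < J by rewrite ltr0n.
have jd (j : nat) : 0 < j.+1%:R * d by rewrite mulr_gt0// ltr0n.
have jd1 (j : nat) : j.+2%:R * d = j.+1%:R * d + d by rewrite -[j.+2%:R]natr1 mulrDl mul1r.
have hg j x : hP (j.+1%:R * d) g x = hP (j.+2%:R * d) f x - hP (j.+1%:R * d) f x.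
  have -> : g = fun y => hP d f y - f y by apply/funext.
  rewrite (hPB lamE lam_gauss x (jd j) (bmeas_hP lamE lam_gauss d0 fb) fb).
  by rewrite (hP_semigroup lamE lam_gauss x (jd j) d0 fb) -jd1.
have tel x : \sum_(j < i.+1) hP (j.+1%:R * d) g x = hP (i.+2%:R * d) f x - hP (1%:R * d) f x.
  by rewrite -(telescope_sumr (fun j => hP (j.+1%:R * d) f x) (leq0n i.+1)) big_mkord; apply: eq_bigr.
have i0 := Rint_Mb psb_i gb.
have ij (j : nat) := Rint_Mb psb_i (bmeas_hP lamE lam_gauss (jd j) gb).
have ijB (j : nat) : rint lam (fun x => psb x * (hP (j.+1%:R * d) g x - g x)).
  exact: Rint_Mb psb_i (bmeas_hPB lamE lam_gauss (jd j) gb).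
have Dt : bmeas (fun x => hP (i.+2%:R * d) f x - hP (1%:R * d) f x) b.
  split.
    by apply: measurable_funB; apply: measurable_hP; exact: fb.1.
  move=> x; have h1 := hP_le lamE lam_gauss x (jd i.+1) fb.
  have h2 := hP_le lamE lam_gauss x (jd 0%N) fb.
  have h3 := hP_ge0 lam x (jd i.+1) f0; have h4 := hP_ge0 lam x (jd 0%N) f0.
  rewrite (ger0_norm h3) in h1; rewrite (ger0_norm h4) in h2.
  exact: dist_le_bound.
have key : J * \int[lam]_x (psb x * g x) =
  \int[lam]_x (psb x * (hP (i.+2%:R * d) f x - hP (1%:R * d) f x)) -
  \sum_(j < i.+1) \int[lam]_x (psb x * (hP (j.+1%:R * d) g x - g x)).
  rewrite -Rint_sum// -(RintZ J i0) -RintB; [|exact: Rint_Mb psb_i Dt|exact: rint_sum].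
  apply: eq_Rint => x; rewrite -mulr_sumr -mulrBr sumrB tel opprB addrCA subrr addr0.
  by rewrite sumr_const card_ord -mulr_natl mulrCA.
have s1 : `|\sum_(j < i.+1) \int[lam]_x (psb x * (hP (j.+1%:R * d) g x - g x))| <= J * (e * (K * d)).
  apply: (le_trans (ler_norm_sum _ _ _)).
  apply: (@le_trans _ _ (\sum_(j < i.+1) e * (K * d))).
    apply: ler_sum => j _; apply: hT => //; rewrite jd /=.
    by apply: le_trans J2; rewrite ler_pM2r// ler_nat.
  by rewrite sumr_const card_ord mulr_natl.
have s2 := Rint_psb_le Dt.
rewrite -(ler_pM2l Jp) key.
move: s1 s2; rewrite !ler_norml => /andP[s1 _] /andP[_ s2].
have bn : 0 <= b * nrm1 by rewrite mulr_ge0 ?nrm1_ge0// (le_trans (normr_ge0 _) (fb.2 0)).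
(* There are at least th / (2 d) grid times, which is the source of the factor 2 / th. *)
have Jt : 1 <= J * d * (2 / th) by rewrite mulrA ler_pdivlMr//; lra.
have s3 : b * nrm1 <= J * (2 * b * nrm1 / th * d).
  have -> : J * (2 * b * nrm1 / th * d) = b * nrm1 * (J * d * (2 / th)) by field; rewrite gt_eqF.
  exact: ler_peMr.
move: s1 s2 s3; move: (\int[lam]_x _) (\sum_(j < i.+1) _) nrm1 => a1 a2 a3; lra.
Qed.

(** The order of choice is the point. K bounds the removed part per unit d and is free of b, so it
    determines th through [l1cont_psb]; b is then small compared with th, the threshold is c = b^2,
    and d0 comes last and absorbs all that explodes with b. *)
Lemma superharmonic_potential_le (Cv Cw : R) : 0 <= Cv -> 0 <= Cw -> forall e, 0 < e ->
  exists c d0 : R, [/\ 0 < c, 0 < d0 & forall (d : R) (v wt : V -> R),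
    0 < d <= d0 -> bmeas v Cv -> (forall x, 0 <= v x) -> bmeas wt Cw ->
    (forall x, hP d v x - v x = d * hP d wt x) ->
    (forall x, ~ U x -> v x <= c / 2) ->
    \int[lam]_x (psb x * hP d wt x) <= e].
Proof.
move=> Cv0 Cw0 e e0.
have n0 : 0 <= nrm1 := nrm1_ge0 _ _ _.
pose K := Cw + C5 n Cv Cw.
have k1 := kap_ge1 R n.
have C60 : 0 <= C6 n Cv Cw by apply: mulr_ge0 => //; exact: sqr_ge0.
have C50 : 0 <= C5 n Cv Cw.
  by apply: addr_ge0 => //; apply: mulr_ge0 => //; apply: mulr_ge0 => //; lra.
have K0 : 0 <= K by rewrite addr_ge0.
have eT0 : 0 < e / (4 * (K + 1)) by rewrite divr_gt0// mulr_gt0// ltr_wpDl.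
have lsc := let: And3 _ l _ := psi_sh in l.
have [th1 th10 hT1] := l1cont_psb lamE lam_gauss oU lamU psi_int lsc eT0.
pose th := Num.min th1 1.
have th0 : 0 < th by rewrite lt_min th10 ltr01.
pose b := Num.min 8^-1 (e * th / (8 * (nrm1 + 1))).
have b0 : 0 < b by rewrite lt_min invr_gt0 ltr0n /= divr_gt0 ?mulr_gt0// ltr_wpDl.
have b8 : b <= 8^-1 by rewrite ge_min lexx.
have b1 : b < 1 by lra.
have bn : 2 * b * nrm1 / th <= e / 4.
  have : b <= e * th / (8 * (nrm1 + 1)) by rewrite ge_min lexx orbT.
  rewrite ler_pdivlMr ?mulr_gt0// ?ltr_wpDl// => hb.
  rewrite ler_pdivrMr//; nra.
pose L := Lip n Cv Cw.
have L1 : 1 <= L.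
  by rewrite /L /Lip lerDr mulr_ge0 ?addr_ge0 ?mulr_ge0// (le_trans ler01)// Cg_ge1.
have c0 : 0 < b ^+ 2 by rewrite exprn_gt0.
pose rh := b ^+ 2 / (2 * L).
have rh0 : 0 < rh by rewrite divr_gt0// mulr_gt0//; lra.
have [Cp Cp0 hCp] := pr_small n rh0.
pose LU := fine (lam U); have LU0 : 0 <= LU by exact: fine_ge0.
pose Q := Cv * (nrm1 * (4 * Cp * LU + 64 * kap R n / (rh ^+ 2) ^+ 2)).
have rr0 : 0 < (rh ^+ 2) ^+ 2 by rewrite !exprn_gt0.
have Q0 : 0 <= Q.
  apply: mulr_ge0 => //; apply: mulr_ge0 => //; apply: addr_ge0.
    by rewrite !mulr_ge0.
  by rewrite divr_ge0 ?(ltW rr0)// mulr_ge0//; lra.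
pose c7 := 64 * kap R n * C7 n Cv Cw b.
have c70 : 0 <= c7.
  have lb0 : 0 < ln b^-1 := lnV_gt0 b0 b1.
  have r0 : 0 < rho n Cv Cw b.
    by rewrite lt_min exprn_gt0 ?divr_gt0 ?mulr_gt0//; rewrite -/L; lra.
  apply: mulr_ge0; first by apply: mulr_ge0 => //; lra.
  by rewrite divr_ge0 ?sqr_ge0// !mulr_ge0 ?ltW.
pose d0 := Num.min (Num.min 1 (b ^+ 2 / 2)) (Num.min (c7 + 1)^-1 (Num.min (e / (4 * (Q + 1))) (th / 2))).
exists (b ^+ 2), d0; split => //.
  rewrite !lt_min ltr01 invr_gt0 !divr_gt0 ?mulr_gt0 ?ltr_wpDl//.
move=> d v wt /andP[dp]; rewrite !le_min => /andP[/andP[d1 d2] /andP[d3 /andP[d4 d5]]] vb v0 wb vE vU.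
have d7 : 64 * kap R n * C7 n Cv Cw b * d <= 1.
  rewrite -/c7; move: d3; rewrite -div1r ler_pdivlMr ?ltr_wpDl//; nra.
have dQ : Q * d <= e / 4.
  move: d4; rewrite ler_pdivlMr ?mulr_gt0 ?ltr_wpDl//; nra.
pose Phi x := Hf b (v x).
have vCv x : v x <= Cv by rewrite (le_trans (ler_norm _))//; exact: vb.2.
have Phib : bmeas Phi Cv.
  split; first exact: (measurableT_comp (measurable_Hf b) vb.1).
  by move=> x; rewrite ger0_norm ?Hf_ge0// (le_trans (Hf_le_id b0 b1 (v0 x))).
have bE x := betaE lamE lam_gauss dp vb v0 vE b0 b8 x.
have bt0 x := beta_ge0 lam v dp b0 b8 x.
have bt1 x := beta_le lamE lam_gauss dp d1 vb v0 wb vE b0 b8 x d2 d7.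
pose wd x := d * hP d wt x.
have wdb : bmeas wd (Cw * d).
  split.
    by apply: measurable_funM; [exact: measurable_cst|exact: measurable_hP wb.1].
  move=> x; rewrite /wd normrM (gtr0_norm dp) mulrC ler_pM2r//; exact: hP_le lamE lam_gauss _ _ _ _ dp wb.
have PhiE x : hP d Phi x - Phi x = Gf b (v x) * wd x + beta lam d v b x.
  by rewrite bE /wd /Phi; ring.
pose E2 x := wd x - (hP d Phi x - Phi x).
have E2b : bmeas E2 (K * d).
  split; first by apply: measurable_funB; [exact: wdb.1|exact: (bmeas_hPB lamE lam_gauss dp Phib).1].
  move=> x; rewrite /E2 PhiE.
  rewrite (_ : _ - _ = (1 - Gf b (v x)) * wd x - beta lam d v b x); last by ring.
  have -> : K * d = Cw * d + C5 n Cv Cw * d by rewrite -mulrDl.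
  rewrite (le_trans (ler_normB _ _))//; apply: lerD; last by rewrite ger0_norm.
  have := Gf_ge0 b0 b1 (v x); have := Gf_le1 b0 b1 (v x) => g1 g0.
  rewrite normrM ger0_norm ?subr_ge0// (le_trans _ (wdb.2 x))// ler_piMl//; lra.
(* The part removed by the truncation lies between 0 and b, while P_d Lf - Lf = E2 is at most K d in
   absolute value. [averaging] combines these two bounds. *)
pose Lf x := v x - Hf b (v x).
have Lf0 x : 0 <= Lf x by rewrite subr_ge0; exact: Hf_le_id.
have Lfb : bmeas Lf b.
  split; first by apply: measurable_funB; [exact: vb.1|exact: Phib.1].
  move=> x; rewrite ger0_norm// /Lf; have := Hf_ge_subb b0 b1 (v x); lra.
have E2E x : E2 x = hP d Lf x - Lf x.
  rewrite (hPB lamE lam_gauss x dp vb Phib) /E2 /wd -vE /Lf /Phi.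
  by move: (hP d v x) (hP d _ x) => a1 a2; ring.
have th20 : d <= th / 2 by [].
have [i /andP[J1 J2]] := grid_approx dp th20.
have J3 : th / 2 <= i.+1%:R * d <= th.
  by rewrite J1 /=; apply: (le_trans J2); lra.
have hT (r M : R) (F : V -> R) : 0 < r <= th -> bmeas F M ->
    `|\int[lam]_x (psb x * (hP r F x - F x))| <= e / (4 * (K + 1)) * M.
  move=> /andP[r0 rth]; apply: hT1; rewrite r0 /=.
  by rewrite (le_trans rth)// /th ge_min lexx.
have i2 := averaging dp th0 (ltW eT0) J3 hT Lfb Lf0 E2b E2E.
have i1 : \int[lam]_x (psb x * (hP d Phi x - Phi x)) <= Q * d ^+ 2.
  have Phi0 x : 0 <= Phi x by exact: Hf_ge0.
  (* Where H(v) does not vanish v exceeds b^2, whereas off U it is at most b^2 / 2; the Lipschitz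
     bound keeps the two regions farther apart than rh. *)
  have PhiU x : Phi x != 0 -> cball_e x rh `<=` U.
    move=> Px y xy; apply: contrapT => /vU vy.
    have cx : b ^+ 2 < v x.
      rewrite ltNge; apply/negP => vx; move/negP: Px; apply.
      by rewrite /Phi Hf_eq0// v0.
    have := potential_lipschitz lamE lam_gauss dp d1 vb wb vE x (y - x).
    rewrite subrKC -/L ler_norml => /andP[h _].
    have : enorm (y - x) <= rh.
      by rewrite -(@ler_sqr R) ?nnegrE ?enorm_ge0 ?(ltW rh0)// sqr_enorm.
    rewrite -(@ler_pM2l _ L); last by lra.
    have -> : L * rh = b ^+ 2 / 2 by rewrite /rh; field; rewrite gt_eqF//; lra.
    by lra.
  apply: (le_trans (super_mean lamE lam_gauss oU lamU psi_int psi_sh dp rh0 Phib Phi0 PhiU)).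
  have -> : Q * d ^+ 2 = Cv * (nrm1 * ((4 * Cp * LU + 64 * kap R n / (rh ^+ 2) ^+ 2) * d ^+ 2)).
    by rewrite /Q -!mulrA.
  apply: ler_wpM2l => //; apply: ler_wpM2l => //; rewrite [leRHS]mulrDl; apply: lerD; last by rewrite mulrAC.
  have := hCp d; rewrite dp d1 => /(_ isT) h; rewrite -/LU.
  rewrite (_ : 4 * Cp * LU * d ^+ 2 = 4 * (Cp * d ^+ 2) * LU); last by ring.
  by rewrite ler_wpM2r// ler_pM2l.
have iP := Rint_Mb psb_i (bmeas_hPB lamE lam_gauss dp Phib).
have iE := Rint_Mb psb_i E2b.
have iw := Rint_Mb psb_i (bmeas_hP lamE lam_gauss dp wb).
have tot : d * \int[lam]_x (psb x * hP d wt x) =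
  \int[lam]_x (psb x * (hP d Phi x - Phi x)) + \int[lam]_x (psb x * E2 x).
  rewrite -(RintZ d iw) -(RintD iP iE); apply: eq_Rint => x.
  by rewrite -mulrDr /E2 subrKC /wd mulrCA.
rewrite -(ler_pM2l dp) tot.
have hK : e / (4 * (K + 1)) * K <= e / 4.
  have -> : e / (4 * (K + 1)) * K = e / 4 * (K / (K + 1)).
    by field; rewrite gt_eqF// ltr_wpDl.
  apply: ler_piMr; first by lra.
  by rewrite ler_pdivrMr ?ltr_wpDl// mul1r lerDl.
apply: (le_trans (lerD i1 i2)).
rewrite expr2 mulrA -mulrDl mulrC; apply: ler_wpM2l; first exact: ltW.
lra.
Qed.

End Core.

(** * Brownian motion and the stopping time *)

Section Density.
Context (d : measure_display) (T : measurableType d) (R : realType).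

Lemma finite_measure_pack (nu : {measure set T -> \bar R}) : (nu setT < +oo)%E ->
  exists nu' : {finite_measure set T -> \bar R}, forall A, nu' A = nu A.
Proof.
move=> fin; exists (mfrestr measurableT fin) => A.
by rewrite -[in RHS](setIT A).
Qed.

(** The Radon-Nikodym derivative has the same integrals as h on all measurable sets, hence equals h
    almost everywhere; its change of variables formula carries over. *)
Lemma ge0_integral_density (nu : {measure set T -> \bar R})
    (mu : {sigma_finite_measure set T -> \bar R}) (h : T -> R) :
  (nu setT < +oo)%E -> measurable_fun setT h -> (forall x, 0 <= h x) ->
  (forall A, measurable A -> nu A = \int[mu]_(x in A) (h x)%:E)%E ->
  forall g : T -> \bar R, measurable_fun setT g -> (forall x, 0 <= g x)%E ->
  (\int[nu]_x g x = \int[mu]_x (g x * (h x)%:E))%E.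
Proof.
move=> fin mh h0 nuE g mg g0.
have [nu' nu'E] := finite_measure_pack fin.
have -> : (\int[nu]_x g x = \int[nu']_x g x)%E.
  by apply: eq_measure_integral => A mA _; exact/esym/nu'E.
have numu : nu' `<< mu.
  apply/null_content_dominatesP => A mA muA.
  by rewrite nu'E nuE// null_set_integral//; apply/measurable_EFinP/measurable_funTS.
rewrite -(Radon_Nikodym_SigmaFinite.change_of_variables numu)//.
apply: ae_eq_integral => //.
- apply: emeasurable_funM => //; apply: measurable_int (Radon_Nikodym_SigmaFinite.f_integrable numu).
- by apply: emeasurable_funM => //; exact/measurable_EFinP.
have : ae_eq mu setT (Radon_Nikodym_SigmaFinite.f nu' mu) (EFin \o h).
  apply: integral_ae_eq => //.
  - exact: Radon_Nikodym_SigmaFinite.f_integrable.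
  - exact/measurable_EFinP.
  - by move=> A _ mA; rewrite -Radon_Nikodym_SigmaFinite.f_integral// nu'E nuE.
by apply: filterS => x /(_ Logic.I) + _ => ->.
Qed.

Lemma image_measure (d1 : measure_display) (T1 : measurableType d1)
    (P : {measure set T1 -> \bar R}) (f : T1 -> T) : measurable_fun setT f ->
  exists2 m : {measure set T -> \bar R}, forall A, m A = P (f @^-1` A) &
    forall g : T -> \bar R, measurable_fun setT g -> (forall x, 0 <= g x)%E ->
    (\int[m]_x g x = \int[P]_w g (f w))%E.
Proof.
move=> mf; unshelve eexists (pushforward P f : {measure set T -> \bar R}) => //.
by move=> g mg g0; rewrite ge0_integral_pushforward// preimage_setT.
Qed.

End Density.

Lemma pmule_inj (R : realType) (c : R) (x y : \bar R) :
  0 < c -> (c%:E * x = c%:E * y)%E -> x = y.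
Proof.
move=> c0 /(congr1 (fun z => (c^-1)%:E * z)%E).
by rewrite !muleA -!EFinM mulVf ?gt_eqF// !mul1e.
Qed.

Section Independence.
Variables (R : realType) (n : nat).
Local Notation V := 'rV[R]_(n.+1).
Local Notation E := (Rd R n).
Variable lam : {sigma_finite_measure set E -> \bar R}.
Context (dO : measure_display) (Omega : measurableType dO).
Variables (P : {measure set Omega -> \bar R}) (F : R -> set (set Omega))
  (W : R -> Omega -> V).
Hypotheses (Ffil : filtration F) (BM : brownian_motion lam P F W).
Hypotheses (Pfin : (P setT < +oo)%E) (Ppos : P setT != 0%E).
Local Notation OF s := (g_sigma_algebraType (F s)).

Lemma measurable_F s (A : set Omega) : @measurable _ (OF s) A -> F s A.
Proof. by have [Fs _ _] := Ffil; apply: smallest_sub (Fs s) _ A. Qed.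

(** The identity, viewed as a map into Omega equipped with the sigma-algebra F s. The image of P
    under it is the restriction of P to F s. *)
Definition idF s (w : Omega) : OF s := w.

Lemma measurable_idF s : measurable_fun setT (idF s).
Proof.
move=> _ A mA; rewrite setTI (_ : idF s @^-1` A = A)//; have [_ _ Fm] := Ffil.
exact: Fm (measurable_F mA).
Qed.

Lemma F_measurable_fun (d' : measure_display) (T' : measurableType d') s (X : Omega -> T') :
  @measurable_fun _ _ (OF s) T' setT X -> measurable_fun setT X.
Proof.
move=> mX _ A mA; have [_ _ Fm] := Ffil.
by apply: (Fm s); apply: measurable_F; exact: (mX measurableT A mA).
Qed.

(** Apply the independence property with A and B everything: P(Omega) = P(Omega) times the Gaussian
    mass, and P(Omega) is finite and nonzero. The Gaussian integral is read off the Brownian motion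
    and never computed. *)
Lemma gauss_mass t : 0 < t -> gauss lam t setT = 1%E.
Proof.
move=> t0; have [_ _ /(_ 0 t setT setT (lexx _) t0)] := BM.
have [/(_ 0)[F0 FC _] _ _] := Ffil.
have FT : F 0 setT by have := FC _ F0; rewrite setD0.
move=> /(_ FT measurableT); rewrite subr0 setTI.
have -> : [set w | [set: E] (W t w - W 0 w)] = setT by apply/seteqP; split.
have Pf : P setT \is a fin_num by rewrite ge0_fin_numE.
have c0 : 0 < fine (P setT).
  by rewrite fine_gt0// Pfin lt0e Ppos measure_ge0.
rewrite -[X in X = _ -> _]mule1 -(fineK Pf) => h.
by rewrite -(pmule_inj c0 h).
Qed.

Lemma measurable_W t : 0 <= t -> measurable_fun setT (W t : Omega -> E).
Proof. by move=> t0; apply: (@F_measurable_fun _ _ t); have [_ /(_ t t0)] := BM. Qed.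

Lemma measurable_addV (d' : measure_display) (T' : measurableType d') (X Y : T' -> E) :
  measurable_fun setT X -> measurable_fun setT Y ->
  measurable_fun setT ((fun w => (X w : V) - (Y w : V)) : T' -> E).
Proof.
move=> mX mY; apply: (measurability _ (measurable_boxesE R n)).
move=> _ [_ [a [b ->] <-]]; rewrite setTI.
suff -> : (fun w => (X w : V) - (Y w : V)) @^-1` box a b = \bigcap_(i in [set: 'I_n.+1])
    (fun w => (X w : V) ord0 i - (Y w : V) ord0 i) @^-1` `[a ord0 i, b ord0 i].
  apply: fin_bigcap_measurable => // i _; rewrite -[X in measurable X]setTI.
  suff mi : measurable_fun setT (fun w => (X w : V) ord0 i - (Y w : V) ord0 i).
    by apply: mi => //; exact: measurable_itv.
  apply: measurable_funB.
  - exact: (measurableT_comp (measurable_coord i) mX).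
  - exact: (measurableT_comp (measurable_coord i) mY).
apply/seteqP; split=> [w wab i _|w wab i] /=.
  by have := wab i; rewrite !mxE in_itv.
by have := wab i Logic.I; rewrite /= in_itv !mxE.
Qed.

(** P need not have mass one, so on rectangles the product of the two marginals equals c0 = P(Omega)
    times the joint law. Both sides are computed with this factor, which is cancelled at the end. *)
Lemma increment_independent s t (f : OF s * E -> \bar R) : 0 <= s -> s < t ->
  measurable_fun setT f -> (forall p, 0 <= f p)%E ->
  (\int[P]_w f (w, W t w - W s w)%R =
   \int[P]_w \int[lam]_z (f (w, z) * (gauss_density (t - s) z)%:E))%E.
Proof.
move=> s0 st mf f0; have t0 : 0 <= t by rewrite (le_trans s0)// ltW.
have ts : 0 < t - s by rewrite subr_gt0.
have mD : measurable_fun setT ((fun w => W t w - W s w) : Omega -> E).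
  by apply: measurable_addV; exact: measurable_W.
have mI : measurable_fun setT (idF s : Omega -> OF s) := @measurable_idF s.
have mID : measurable_fun setT ((fun w => (w, W t w - W s w)) : Omega -> (OF s * E)%type).
  by apply: measurable_fun_pair; [exact: measurable_idF|exact: mD].
have [p1 p1E p1i] := image_measure P mI.
have [p2 p2E _] := image_measure P mD.
have [p3 p3E p3i] := image_measure P mID.
have Pf : P setT \is a fin_num by rewrite ge0_fin_numE.
pose c0 := fine (P setT); have c0E : P setT = c0%:E by rewrite fineK.
have c00 : 0 <= c0 by exact: fine_ge0.
have [m1 m1E] : exists m1 : {finite_measure set (OF s) -> \bar R}, forall A, m1 A = p1 A.
  by apply: finite_measure_pack; rewrite p1E; exact: Pfin.
have [m2 m2E] : exists m2 : {finite_measure set E -> \bar R}, forall A, m2 A = p2 A.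
  by apply: finite_measure_pack; rewrite p2E; exact: Pfin.
pose m' := mscale (NngNum c00) p3.
have [_ _ BMi] := BM.
have [/(_ s)[Fs0 FsC _] _ _] := Ffil.
have FT : F s setT by have := FsC _ Fs0; rewrite setD0.
have prodE X : measurable X -> (m1 \x m2)%E X = m' X.
  apply: product_measure_unique => A B mA mB.
  transitivity (p1 A * p2 B)%E; last first.
    by congr (_ * _)%E; [exact: (esym (m1E A))|exact: (esym (m2E B))].
  transitivity (c0%:E * P (A `&` [set w | B (W t w - W s w)%R]))%E.
    by congr (_ * _)%E; exact: p3E.
  rewrite p1E p2E BMi//; last exact: measurable_F.
  have -> : (fun w => W t w - W s w) @^-1` B = setT `&` [set w | B (W t w - W s w)].
    by rewrite setTI.
  by rewrite BMi// c0E muleCA.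
have fub := fubini_tonelli1 (m1 := m1) (m2 := m2) f mf f0.
have E1 : (\int[m1 \x m2]_z f z = c0%:E * \int[P]_w f (w, W t w - W s w)%R)%E.
  transitivity (\int[mscale (NngNum c00) p3]_z f z)%E.
    by apply: eq_measure_integral => A mA _; exact: prodE.
  rewrite ge0_integral_mscale//; congr (_ * _)%E.
  exact: p3i.
have c0p : 0 < c0 by rewrite fine_gt0// Pfin lt0e Ppos measure_ge0.
have m2d A : measurable A -> m2 A = (\int[lam]_(z in A) (c0 * gauss_density (t - s) z)%:E)%E.
  move=> mA; rewrite m2E p2E -[X in P X]setTI BMi// c0E /gauss.
  under [RHS]eq_integral do rewrite EFinM.
  rewrite ge0_integralZl//.
  - apply/measurable_EFinP; apply: measurable_funTS.
    by rewrite (_ : gauss_density _ = pk (t - s) 0); [exact: measurable_pk|apply/funext => z; rewrite /pk subr0].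
  - by move=> z _; rewrite lee_fin ltW// gauss_gt0.
have mg : measurable_fun setT (gauss_density (t - s) : E -> R).
  by rewrite (_ : gauss_density _ = pk (t - s) 0); [exact: measurable_pk|apply/funext => z; rewrite /pk subr0].
have m2fin : (m2 setT < +oo)%E by rewrite m2E p2E; exact: Pfin.
have E2 : (\int[m1 \x m2]_z f z =
    c0%:E * \int[P]_w \int[lam]_z (f (w, z) * (gauss_density (t - s) z)%:E))%E.
  rewrite fub /fubini_F.
  transitivity (\int[p1]_w \int[m2]_y f (w, y))%E.
    by apply: eq_measure_integral => A mA _; exact: m1E.
  rewrite p1i; first last.
  - by move=> w; apply: integral_ge0.
  - exact: (measurable_fun_fubini_tonelli_F (m2 := m2)).
  rewrite -ge0_integralZl//; first last.
  - by move=> w _; apply: integral_ge0 => z _; rewrite mule_ge0// lee_fin ltW// gauss_gt0.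
  - apply: (F_measurable_fun (s := s)).
    apply: (measurable_fun_fubini_tonelli_F (m2 := lam)
      (fun p : OF s * E => (f p * (gauss_density (t - s) p.2)%:E)%E)).
      apply: emeasurable_funM => //; apply/measurable_EFinP.
      exact: (measurableT_comp mg measurable_snd).
    by move=> p; rewrite mule_ge0// lee_fin ltW// gauss_gt0.
  apply: eq_integral => w _ /=.
  have mfw : measurable_fun setT (fun z : E => f (idF s w, z)).
    exact: (measurableT_comp mf (pair1_measurable (idF s w))).
  have g0 (z : E) : 0 <= gauss_density (t - s) z by rewrite ltW// gauss_gt0.
  have cg0 (z : E) : 0 <= c0 * gauss_density (t - s) z by exact: mulr_ge0.
  have mcg : measurable_fun setT (fun z : E => c0 * gauss_density (t - s) z).
    by apply: measurable_funM.
  rewrite (ge0_integral_density m2fin mcg cg0 m2d mfw (fun z => f0 _)).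
  rewrite -ge0_integralZl//; first last.
  - by move=> z _; rewrite mule_ge0// lee_fin.
  - by apply: emeasurable_funM => //; exact/measurable_EFinP.
  by apply: eq_integral => z _; rewrite EFinM muleCA.
by apply: (pmule_inj c0p); rewrite -E1 -E2.
Qed.

End Independence.

(** * The Markov property, the survival function of the stopping time and its exponential decay *)

Section Stopping.
Variables (R : realType) (n : nat).
Local Notation V := 'rV[R]_(n.+1).
Local Notation E := (Rd R n).
Variable lam : {sigma_finite_measure set E -> \bar R}.
Hypothesis lamE : is_lebesgue_d lam.
Context (dO : measure_display) (Omega : measurableType dO).
Variables (P : {measure set Omega -> \bar R}) (F : R -> set (set Omega))
  (W : R -> Omega -> V).
Hypotheses (Ffil : filtration F) (BM : brownian_motion lam P F W).
Hypotheses (Pfin : (P setT < +oo)%E) (Ppos : P setT != 0%E).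
Local Notation OF s := (g_sigma_algebraType (F s)).
Local Notation hP := (heat lam).

Let lam_gauss (t : R) : 0 < t -> gauss lam t setT = 1%E.
Proof. exact: gauss_mass Ffil BM Pfin Ppos t. Qed.

(** Freeze the path up to time s and integrate the increment, which convolves p_r with p_(t-s). The
    weight X, known at time s, is later the survival function. *)
Lemma markov (s t r : R) (x : V) (X : Omega -> R) : 0 <= s -> s < t -> 0 < r ->
  @measurable_fun _ _ (OF s) R setT X -> (forall w, 0 <= X w) ->
  \int[P]_w (X w * pk r x (W t w)) = \int[P]_w (X w * pk (r + (t - s)) x (W s w)).
Proof.
move=> s0 st r0 mX X0; have ts : 0 < t - s by rewrite subr_gt0.
have mWs : @measurable_fun _ _ (OF s) E setT (W s) by have [_ /(_ s s0)] := BM.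
pose f (p : OF s * E) : \bar R := (X p.1 * pk r (x - W s p.1) (p.2 : V))%:E.
have mf : measurable_fun setT f.
  apply/measurable_EFinP; apply: measurable_funM.
    exact: (measurableT_comp mX measurable_fst).
  apply: measurable_pk_comp; last exact: measurable_snd.
  apply: measurable_addV; first exact: measurable_cst.
  exact: (measurableT_comp mWs measurable_fst).
have f0 p : (0 <= f p)%E by rewrite lee_fin mulr_ge0// pk_ge0.
have := increment_independent Ffil BM Pfin Ppos s0 st mf f0.
rewrite /Rintegral => h; congr fine; transitivity (\int[P]_w f (w, (W t w - W s w)%R))%E.
  apply: eq_integral => w _; rewrite /f /= /pk; congr (_ * gauss_density _ _)%:E.
  by rewrite opprB addrA subrK.
rewrite h; apply: eq_integral => w _; rewrite /f /=.
have zE z : ((X w * pk r (x - W s w) z)%:E * (gauss_density (t - s) z)%:E =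
   (X w)%:E * (pk r (x - W s w) z * pk (t - s) 0 z)%:E)%E.
  by rewrite -!EFinM -[in LHS]mulrA {3}/pk subr0.
under eq_integral do rewrite zE.
have b := @rint_bpk _ _ lam lamE lam_gauss (t - s) (pk r (x - W s w)) (gc n r) 0 ts.
have /b bi : bmeas (pk r (x - W s w)) (gc n r).
  split; first exact: measurable_pk.
  by move=> z; rewrite ger0_norm ?pk_ge0// pk_le_gc.
rewrite integralZl// -RintE// -EFinM; congr (_ * _)%:E.
have := pk_conv lamE lam_gauss (x - W s w) 0 r0 ts; rewrite /heat => ->.
by rewrite /pk sub0r opprB.
Qed.

Variable tau : Omega -> probability R R.
Hypothesis rst : randomized_stopping_time F tau.

Definition surv (t : R) (w : Omega) : R := 1 - fine (tau w `[0, t]%classic).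

Let tau_fin w (A : set R) : measurable A -> tau w A \is a fin_num.
Proof. by move=> mA; rewrite ge0_fin_numE// (le_lt_trans (probability_le1 _ mA))// ltry. Qed.

Lemma surv_ge0 t w : 0 <= surv t w.
Proof.
rewrite subr_ge0 -lee_fin fineK ?tau_fin//; first exact: probability_le1.
Qed.

Lemma surv_le1 t w : surv t w <= 1.
Proof. by rewrite gerBl fine_ge0. Qed.

Lemma surv_norm t w : `|surv t w| <= 1.
Proof. by rewrite ger0_norm ?surv_ge0 ?surv_le1. Qed.

Lemma surv_le s t w : s <= t -> surv t w <= surv s w.
Proof.
move=> st; rewrite lerD2l lerN2 fine_le ?tau_fin//.
apply: le_measure; rewrite ?inE// => x /=; rewrite !in_itv /= => /andP[-> xs].
exact: le_trans xs st.
Qed.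

Lemma survE t w : 0 <= t -> surv t w = fine (tau w `]t, +oo[%classic).
Proof.
move=> t0; have [/(_ w) t1 _] := rst.
have : tau w (@Rplus R) = (tau w `[0%R, t]%classic + tau w `]t, +oo[%classic)%E.
  rewrite -measureU//; last first.
    apply/seteqP; split=> [x [/=]|]//; rewrite !in_itv /= andbT => /andP[_ xt] tx.
    by have := le_lt_trans xt tx; rewrite ltxx.
  congr (tau w _); apply/seteqP; split => [x|x] /=; rewrite /Rplus /= !in_itv /= ?andbT.
    by move=> x0; case: (leP x t) => xt; [left; rewrite x0|right].
  by case=> [/andP[]//|tx]; rewrite (le_trans t0)// ltW.
rewrite t1 /surv -(fineK (tau_fin w (measurable_itv `[0, t]))).
rewrite -(fineK (tau_fin w (measurable_itv `]t, +oo[))) -EFinD => -[] /= ->.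
by rewrite addrAC subrr add0r.
Qed.

Lemma measurable_survF t : 0 <= t -> @measurable_fun _ _ (OF t) R setT (surv t).
Proof.
move=> t0; have [_ /(_ t t0) mt] := rst.
apply: measurable_funB; first exact: measurable_cst.
by apply: (measurableT_comp (fine_measurable measurableT)).
Qed.

Lemma measurable_surv t : 0 <= t -> measurable_fun setT (surv t).
Proof. by move=> t0; apply: (F_measurable_fun Ffil); exact: measurable_survF. Qed.

Variable U : set V.
Hypothesis exitU : before_exit U W tau.

(** A time t > 0 with W_t off U bounds the exit time, beyond which [tau w] has no mass. Time 0 is
    excluded, because the exit time is an infimum over positive times. *)
Lemma surv_exit t w : 0 < t -> ~ U (W t w) -> surv t w = 0.
Proof.
move=> t0 Ut; rewrite survE ?ltW//.
have -> : tau w `]t, +oo[%classic = 0%E; last by [].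
have mA : measurable [set s : R | (exit_time U W w < s%:E)%E].
  case: (exit_time U W w) => [r| |].
  - rewrite (_ : [set s | _] = `]r, +oo[%classic); first exact: measurable_itv.
    by apply/seteqP; split => s /=; rewrite lte_fin in_itv /= andbT.
  - rewrite (_ : [set s | _] = set0); first exact: measurable0.
    by apply/seteqP; split => s.
  - rewrite (_ : [set s | _] = setT); first exact: measurableT.
    by apply/seteqP; split => s //= _; exact: ltNyr.
apply/eqP; rewrite eq_le measure_ge0 andbT -(exitU w).
apply: le_measure; rewrite ?inE// => s /=; rewrite in_itv /= andbT => ts.
rewrite (@le_lt_trans _ _ t%:E)// ?lte_fin//.
by apply: ereal_inf_lbound; exists t.
Qed.

Definition mean_surv t : R := \int[P]_w surv t w.

Lemma rint_surv t : 0 <= t -> rint P (surv t).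
Proof. by move=> t0; apply: (bounded_rint Pfin (measurable_surv t0) (surv_norm t)). Qed.

Lemma mean_surv_le s t : 0 <= s -> s <= t -> mean_surv t <= mean_surv s.
Proof.
move=> s0 st; apply: le_Rint; rewrite ?rint_surv// ?(le_trans s0)//.
by move=> w; exact: surv_le.
Qed.

Lemma mean_surv_ge0 t : 0 <= mean_surv t.
Proof. by apply: Rint_ge0 => w; exact: surv_ge0. Qed.

Lemma mean_surv_leP t : 0 <= t -> mean_surv t <= fine (P setT).
Proof.
move=> t0; have := le_Rint (rint_surv t0) (rint_cst 1 Pfin) (surv_le1 t).
suff -> : \int[P]_w 1 = fine (P setT) by [].
by rewrite /Rintegral integral_cst// mul1e.
Qed.

(** A box of unit volume disjoint from the cube carries Gaussian mass at least e0 > 0, and the total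
    mass is 1. *)
Lemma gauss_cube_lt1 (k : R) : 0 <= k -> exists2 q : R, gauss lam 1 (cube k) = q%:E & 0 <= q < 1.
Proof.
move=> k0; pose A : set V := box (const_mx (k + 1)) (const_mx (k + 2)).
have mB : measurable (cube k : set E) by exact: measurable_box.
have mA : measurable (A : set E) by exact: measurable_box.
have mg : measurable_fun setT (EFin \o (gauss_density 1 : E -> R)).
  apply/measurable_EFinP; rewrite (_ : gauss_density 1 = pk 1 0); first exact: measurable_pk.
  by apply/funext => z; rewrite /pk subr0.
have g0 (x : E) : (0 <= (gauss_density 1 (x : V))%:E)%E by rewrite lee_fin ltW// gauss_gt0.
have lamA : lam A = 1%E.
  have := @lamE (const_mx (k + 1)) (const_mx (k + 2)) _; rewrite /A => ->.
    by rewrite big1// => i _; rewrite !mxE; ring.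
  by move=> i; rewrite !mxE; lra.
pose e0 := gc n 1 * expR (- ((n.+1)%:R * (k + 2) ^+ 2) / (2 * 1)).
have e0_gt0 : 0 < e0 by rewrite mulr_gt0 ?expR_gt0// gc_gt0.
have gA : (e0%:E <= gauss lam 1 A)%E.
  rewrite -[leLHS]mule1 -lamA -integral_cst//.
  apply: ge0_le_integral => //.
  - by move=> x _; rewrite lee_fin ltW.
  - exact: measurable_funTS.
  - move=> x Ax; rewrite lee_fin gauss_gcE; apply: ler_wpM2l; first by rewrite ltW// gc_gt0.
    rewrite ler_expR ler_wpM2r// lerN2 /sqnorm.
    rewrite -[leRHS](_ : \sum_(i < n.+1) (k + 2) ^+ 2 = _); last first.
      by rewrite sumr_const card_ord mulr_natl.
    by apply: ler_sum => i _; have := Ax i; rewrite !mxE => /andP[h1 h2]; nra.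
have AB : [disjoint (cube k : set E) & (A : set E)].
  apply/disj_setPS => x [/(_ ord0) + /(_ ord0)]; rewrite !mxE => /andP[_ h1] /andP[h2 _].
  by lra.
have h : (gauss lam 1 (cube k) + gauss lam 1 A <= 1)%E.
  rewrite -(lam_gauss (@ltr01 R)) /gauss -ge0_integral_setU//.
  - apply: ge0_subset_integral => //; exact: measurableU.
  - exact: measurable_funTS.
have q0 : (0 <= gauss lam 1 (cube k))%E by apply: integral_ge0.
have qf : gauss lam 1 (cube k) \is a fin_num.
  rewrite ge0_fin_numE// (le_lt_trans _ (ltry 1))// (le_trans _ h)// leeDl//.
  exact: le_trans (ltW _) gA.
exists (fine (gauss lam 1 (cube k))); first by rewrite fineK.
rewrite fine_ge0//= -lte_fin fineK//.
have : (gauss lam 1 (cube k) + e0%:E <= 1)%E by rewrite (le_trans _ h)// leeD2l.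
by rewrite -(fineK qf) -EFinD lee_fin lte_fin; lra.
Qed.

(** Survival at time t + 1 forces both W_t and W_(t+1) into U, so the increment lies in the cube of
    half-side 2 k. It is independent of F_t and lands there with probability q < 1. *)
Lemma mean_surv_decay (k : R) : 0 <= k -> (forall x, U x -> cube k x) ->
  exists2 q : R, 0 <= q < 1 & forall t, 0 < t -> mean_surv (t + 1) <= q * mean_surv t.
Proof.
move=> k0 Uk; have kk0 : 0 <= 2 * k by rewrite mulr_ge0.
have [q qE q01] := gauss_cube_lt1 kk0; exists q => // t t0.
have t1 : t < t + 1 by rewrite ltrDl.
have t00 := ltW t0; have t10 : 0 <= t + 1 by rewrite addr_ge0.
have mB : measurable (cube (2 * k) : set E) by exact: measurable_box.
have mI : measurable_fun setT (\1_(cube (2 * k)) : E -> R) by exact: measurable_indic.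
pose f (p : OF t * E) : \bar R := (surv t p.1 * \1_(cube (2 * k)) (p.2 : V))%:E.
have mf : measurable_fun setT f.
  apply/measurable_EFinP; apply: measurable_funM.
    exact: (measurableT_comp (measurable_survF t00) measurable_fst).
  exact: (measurableT_comp mI measurable_snd).
have f0 p : (0 <= f p)%E by rewrite lee_fin mulr_ge0// surv_ge0.
have h := increment_independent Ffil BM Pfin Ppos t00 t1 mf f0.
have mD : measurable_fun setT ((fun w => W (t + 1) w - W t w) : Omega -> E).
  by apply: measurable_addV; exact: measurable_W BM _ _.
have ig : rint P (fun w => surv t w * \1_(cube (2 * k)) (W (t + 1) w - W t w)).
  apply: (rintM (rint_surv t00) (measurableT_comp mI mD) (M := 1)) => w.
  by rewrite /= indicE; case: (_ \in _); rewrite ?normr1 ?normr0.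
apply: (le_trans (le_Rint (rint_surv t10) ig _)).
  move=> w; have [Ut|Ut] := pselect (U (W t w)); last first.
    rewrite (surv_exit t0 Ut) mul0r -(surv_exit t0 Ut); apply: surv_le; exact: ltW.
  have [Ut1|Ut1] := pselect (U (W (t + 1) w)); last first.
    by rewrite (surv_exit _ Ut1) ?addr_gt0// mulr_ge0// surv_ge0.
  rewrite indicE mem_set ?mulr1; first exact: surv_le (ltW t1).
  move=> i; have := Uk _ Ut i; have := Uk _ Ut1 i; rewrite !mxE => /andP[h1 h2] /andP[h3 h4].
  by apply/andP; split; lra.
rewrite -lee_fin (RintE ig).
have -> : (\int[P]_x (surv t x * \1_(cube (2 * k)) (W (t + 1) x - W t x)%R)%:E)%E =
   (\int[P]_w f (w, (W (t + 1) w - W t w)%R))%E by [].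
rewrite h.
under eq_integral.
  move=> w _.
  under eq_integral do rewrite /f /= EFinM -muleA.
  rewrite ge0_integralZl ?lee_fin ?surv_ge0//; first last.
  - by move=> z _; rewrite -EFinM lee_fin mulr_ge0// ltW// gauss_gt0 // subr_gt0.
  - apply/measurable_EFinP; apply: measurable_funM => //.
    rewrite (_ : gauss_density _ = pk (t + 1 - t) 0); first exact: measurable_pk.
    by apply/funext => z; rewrite /pk subr0.
  over.
have -> : (\int[lam]_x ((\1_(cube (2 * k)) x)%:E * (gauss_density (t + 1 - t) x)%:E) = q%:E)%E.
  rewrite -qE /gauss [RHS]integral_mkcond; apply: eq_integral => z _.
  rewrite (_ : t + 1 - t = 1); last by ring.
  by rewrite epatch_indic muleC.
rewrite ge0_integralZr ?lee_fin; first last.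
- by case/andP: q01.
- by move=> w _; rewrite lee_fin surv_ge0.
- by apply/measurable_EFinP; exact: measurable_surv.
- exact: measurableT.
by rewrite -(RintE (rint_surv t00)) -EFinM mulrC.
Qed.

End Stopping.

Lemma sum_blocks (R : realType) (a : nat -> R) (m K : nat) :
  (forall i j, (i <= j)%N -> a j <= a i) ->
  \sum_(k < m * K) a k <= m%:R * \sum_(i < K) a (m * i)%N.
Proof.
move=> a_le; elim: K => [|K ih]; first by rewrite muln0 !big_ord0 mulr0.
rewrite mulnS addnC big_split_ord big_ord_recr /= mulrDr; apply: lerD => //.
rewrite mulr_natl -[leRHS](_ : \sum_(i < m) a (m * K)%N = _); last by rewrite sumr_const card_ord.
by apply: ler_sum => i _; apply: a_le; rewrite leq_addr.
Qed.

(** * Discretised occupation of the path before the stopping time *)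

Section Occupation.
Variables (R : realType) (n : nat).
Local Notation V := 'rV[R]_(n.+1).
Local Notation E := (Rd R n).
Variable lam : {sigma_finite_measure set E -> \bar R}.
Hypothesis lamE : is_lebesgue_d lam.
Context (dO : measure_display) (Omega : measurableType dO).
Variables (P : {measure set Omega -> \bar R}) (F : R -> set (set Omega))
  (W : R -> Omega -> V).
Hypotheses (Ffil : filtration F) (BM : brownian_motion lam P F W).
Hypotheses (Pfin : (P setT < +oo)%E) (Ppos : P setT != 0%E).
Variable tau : Omega -> probability R R.
Hypothesis rst : randomized_stopping_time F tau.
Local Notation surv := (surv tau).
Implicit Types (N k : nat) (x : V) (g : V -> R).

Definition mesh N : R := N.+1%:R^-1.
(** The time horizon steps * mesh equals N + 1: it tends to infinity while the mesh tends to 0. *)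
Definition steps N : nat := (N.+1 * N.+1)%N.
Definition grid N k : R := k%:R * mesh N.

Lemma mesh_gt0 N : 0 < mesh N. Proof. by rewrite invr_gt0 ltr0n. Qed.
Lemma natr_mesh N : N.+1%:R * mesh N = 1. Proof. by rewrite mulfV// pnatr_eq0. Qed.
Lemma grid_ge0 N k : 0 <= grid N k. Proof. by rewrite mulr_ge0// ltW// mesh_gt0. Qed.
Lemma gridS N k : grid N k.+1 = grid N k + mesh N.
Proof. by rewrite /grid -natr1 mulrDl mul1r. Qed.
Lemma grid_lt N k : grid N k < grid N k.+1.
Proof. by rewrite gridS ltrDl mesh_gt0. Qed.

Definition occ_term N g k : R := \int[P]_w (surv (grid N k) w * g (W (grid N k) w)).
(* Discretised expected occupation functional of the path before [tau]. *)
Definition occ N g : R := mesh N * \sum_(k < steps N) occ_term N g k.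

Lemma measurable_gW g t : measurable_fun setT (g : E -> R) -> 0 <= t ->
  measurable_fun setT (fun w => g (W t w)).
Proof. by move=> mg t0; exact: (measurableT_comp mg (measurable_W Ffil BM t0)). Qed.

Lemma rint_gW g (M : R) t : bmeas g M -> 0 <= t -> rint P (fun w => g (W t w)).
Proof.
by move=> [mg gM] t0; apply: (bounded_rint Pfin (measurable_gW mg t0) (M := M)) => w; exact: gM.
Qed.

Lemma rint_survW g (M : R) s t : bmeas g M -> 0 <= s -> 0 <= t ->
  rint P (fun w => surv s w * g (W t w)).
Proof.
move=> [mg gM] s0 t0.
by apply: (rintM (rint_surv Ffil Pfin rst s0) (measurable_gW mg t0) (M := M)) => w; exact: gM.
Qed.

Lemma occ_term_le N k g (a M : R) : bmeas g M -> (forall w, surv (grid N k) w != 0 ->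
    g (W (grid N k) w) <= a) -> occ_term N g k <= a * mean_surv P tau (grid N k).
Proof.
move=> gM ga; have s0 := grid_ge0 N k.
have si := rint_surv Ffil Pfin rst s0.
rewrite -RintZ//; apply: le_Rint.
- exact: rint_survW gM _ _.
- exact: rintZ.
- move=> w; rewrite mulrC; have [->|h] := eqVneq (surv (grid N k) w) 0; first by rewrite !mulr0.
  by apply: ler_wpM2r; [exact: surv_ge0|exact: ga].
Qed.

Variables (U : set V) (rad : R).
Hypotheses (exitU : before_exit U W tau) (rad_ge0 : 0 <= rad) (Urad : forall x, U x -> cube rad x).

(** A Riemann sum of a nonincreasing function, bounded by its values at integer times. These decay
    geometrically from time 1 on, so the bound is uniform in N; in effect the expected lifetime is
    finite. *)
Lemma mean_surv_sum : exists2 C : R, 0 <= C &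
  forall N, mesh N * \sum_(k < steps N) mean_surv P tau (grid N k) <= C.
Proof.
have [q /andP[q0 q1] decay] := mean_surv_decay lamE Ffil BM Pfin Ppos rst exitU rad_ge0 Urad.
pose c0 := fine (P setT); have c00 : 0 <= c0 by exact: fine_ge0.
have q10 : 0 < 1 - q by rewrite subr_gt0.
pose s := mean_surv P tau; exists (c0 + c0 / (1 - q)).
  by rewrite addr_ge0// divr_ge0// ltW.
move=> N.
have tail I : (1 - q) * \sum_(i < I) s i.+1%:R <= s 1 - s I.+1%:R.
  elim: I => [|I ih]; first by rewrite big_ord0 mulr0 subrr.
  rewrite big_ord_recr /= mulrDr.
  have := decay I.+1%:R (ltr0Sn _ _); rewrite natr1 -/s => h.
  move: (\sum_(i < I) _) (s I.+1%:R) (s I.+2%:R) ih h => S a b ih h; lra.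
have total I : \sum_(i < I) s i%:R <= c0 + c0 / (1 - q).
  case: I => [|I]; first by rewrite big_ord0 addr_ge0// divr_ge0// ltW.
  rewrite big_ord_recl; apply: lerD; first exact: (mean_surv_leP Ffil Pfin rst).
  rewrite ler_pdivlMr// mulrC; apply: (le_trans (tail I)).
  have := mean_surv_leP Ffil Pfin rst (@ler01 R); have := mean_surv_ge0 P tau I.+1%:R.
  by rewrite -/s -/c0; lra.
have a_le i j : (i <= j)%N -> s (grid N j) <= s (grid N i).
  move=> ij; apply: (mean_surv_le Ffil Pfin rst); first exact: grid_ge0.
  by apply: ler_wpM2r; [exact/ltW/mesh_gt0|rewrite ler_nat].
have := sum_blocks N.+1 N.+1 a_le; rewrite -/(steps N) => h.
apply: (@le_trans _ _ (mesh N * (N.+1%:R * \sum_(i < N.+1) s (grid N (N.+1 * i))))).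
  by apply: ler_wpM2l; [exact/ltW/mesh_gt0|].
rewrite mulrA [mesh N * _]mulrC natr_mesh mul1r.
rewrite (eq_bigr (fun i : 'I_N.+1 => s i%:R)); first exact: total.
by move=> i _; rewrite /grid natrM mulrAC natr_mesh mul1r.
Qed.

Definition occ_mass : R := sval (cid2 mean_surv_sum).

Lemma occ_mass_ge0 : 0 <= occ_mass. Proof. by rewrite /occ_mass; case: cid2. Qed.

Lemma occ_massP N : mesh N * \sum_(k < steps N) mean_surv P tau (grid N k) <= occ_mass.
Proof. by rewrite /occ_mass; case: cid2. Qed.

Lemma occ_le N g (a M : R) : bmeas g M -> 0 <= a -> (forall x, g x <= a) ->
  occ N g <= a * occ_mass.
Proof.
move=> gM a0 ga; apply: (@le_trans _ _
   (a * (mesh N * \sum_(k < steps N) mean_surv P tau (grid N k)))).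
  rewrite mulrCA; apply: ler_wpM2l; first exact/ltW/mesh_gt0.
  by rewrite mulr_sumr; apply: ler_sum => k _; apply: (occ_term_le gM) => w _.
by apply: ler_wpM2l => //; exact: occ_massP.
Qed.

Lemma occ_ge0 N g : (forall x, 0 <= g x) -> 0 <= occ N g.
Proof.
move=> g0; apply: mulr_ge0; [exact/ltW/mesh_gt0|]; apply: sumr_ge0 => k _.
by apply: Rint_ge0 => w; rewrite mulr_ge0// surv_ge0.
Qed.

(* Only at time 0 may the surviving path be outside U. *)
Lemma occ_le_out N g (a M : R) : bmeas g M -> 0 <= a -> 0 <= M -> (forall x, U x -> g x <= a) ->
  occ N g <= a * occ_mass + mesh N * (M * fine (P setT)).
Proof.
move=> gM a0 M0 ga; have m0 := ltW (mesh_gt0 N).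
have h k : occ_term N g k <= a * mean_surv P tau (grid N k) +
    (if k == 0%N then M * fine (P setT) else 0).
  case: k => [|k] /=.
    apply: (@le_trans _ _ (M * mean_surv P tau (grid N 0))).
      by apply: (occ_term_le gM) => w _; exact: le_trans (ler_norm _) (gM.2 _).
    rewrite -[leLHS]add0r; apply: lerD; first by rewrite mulr_ge0// mean_surv_ge0.
    by apply: ler_wpM2l => //; exact: (mean_surv_leP Ffil Pfin rst (grid_ge0 N 0)).
  rewrite addr0; apply: (occ_term_le gM) => w /eqP sw; apply: ga.
  apply: contrapT => Uw; apply: sw; apply: (surv_exit rst exitU _ Uw).
  by rewrite mulr_gt0 ?mesh_gt0.
apply: (@le_trans _ _ (mesh N * \sum_(k < steps N) (a * mean_surv P tau (grid N k) +
    (if (k : nat) == 0%N then M * fine (P setT) else 0)))).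
  by apply: ler_wpM2l => //; apply: ler_sum => k _; exact: h.
rewrite big_split /= mulrDr; apply: lerD.
  rewrite -mulr_sumr mulrCA; apply: ler_wpM2l => //; exact: occ_massP.
apply: ler_wpM2l => //; rewrite /steps mulSn addSn big_ord_recl /= big1 ?addr0//.
Qed.

(* Abel-summed form of the mean over [tau w] of [g (W T w)], where [T] is the
   stopping time rounded up to the grid. *)
Definition stopped N g (w : Omega) : R := g (W 0 w) +
  \sum_(k < steps N) (g (W (grid N k.+1) w) - g (W (grid N k) w)) * surv (grid N k) w.

Lemma measurable_stopped N g : measurable_fun setT (g : E -> R) ->
  measurable_fun setT (stopped N g).
Proof.
move=> mg; apply: measurable_funD; first exact: measurable_gW.
apply: measurable_sum => k; apply: measurable_funM.
  by apply: measurable_funB; apply: measurable_gW => //; exact: grid_ge0.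
by apply: (measurable_surv Ffil rst); exact: grid_ge0.
Qed.

(** The kernel of P_th composed with the discrete potential of J steps. The smoothing time th makes
    it bounded and Lipschitz, uniformly in N as long as J times the mesh stays fixed. *)
Definition pkpot N (J : nat) (th : R) x : V -> R :=
  fun y => mesh N * \sum_(j < J) pk (th + grid N j.+1) x y.

Lemma bmeas_pk t x : 0 < t -> bmeas (pk t x) (gc n t).
Proof.
move=> t0; split; first exact: measurable_pk.
by move=> y; rewrite ger0_norm ?pk_ge0// pk_le_gc.
Qed.

Lemma bmeas_pkpot N J th x : 0 < th -> bmeas (pkpot N J th x) (J%:R * mesh N * gc n th).
Proof.
move=> th0; have m0 := ltW (mesh_gt0 N); split.
  apply: measurable_funM; first exact: measurable_cst.
  by apply: measurable_sum => j; exact: measurable_pk.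
move=> y; rewrite normrM (ger0_norm m0) -mulrA mulrCA; apply: ler_wpM2l => //.
rewrite mulr_natl -[leRHS](_ : \sum_(i < J) gc n th = _); last by rewrite sumr_const card_ord.
apply: (le_trans (ler_norm_sum _ _ _)); apply: ler_sum => j _.
have tj : 0 < th + grid N j.+1 by rewrite ltr_wpDr// grid_ge0.
rewrite ger0_norm ?pk_ge0// (le_trans (pk_le_gc _ _ tj))//.
by apply: gc_le => //; rewrite lerDl grid_ge0.
Qed.

Lemma pkpot_ge0 N J th x y : 0 < th -> 0 <= pkpot N J th x y.
Proof.
move=> th0; apply: mulr_ge0; [exact/ltW/mesh_gt0|]; apply: sumr_ge0 => j _.
by apply: pk_ge0; rewrite ltr_wpDr// grid_ge0.
Qed.

(** By the Markov property one time step turns p_(th + (j+1) d) into p_(th + (j+2) d), so for each k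
    the increments telescope in j, leaving the last kernel minus the first. This is a discrete
    Dynkin formula for the potential. *)
Lemma mean_stopped N J th x : 0 < th ->
  \int[P]_w stopped N (pkpot N J th x) w - \int[P]_w pkpot N J th x (W 0 w) =
  occ N (pk (th + grid N J.+1) x) - occ N (pk (th + grid N 1) x).
Proof.
move=> th0; set f := pkpot N J th x; have fb := @bmeas_pkpot N J th x th0; rewrite -/f in fb.
have tj j : 0 < th + grid N j.+1 by rewrite ltr_wpDr// grid_ge0.
have gi k := rint_survW fb (grid_ge0 N k) (grid_ge0 N k.+1).
have gi' k := rint_survW fb (grid_ge0 N k) (grid_ge0 N k).
have di k : rint P (fun w => (f (W (grid N k.+1) w) - f (W (grid N k) w)) * surv (grid N k) w).
  under eq_fun do rewrite mulrC mulrBr.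
  exact: rintB.
rewrite /stopped RintD; first last.
- by apply: rint_sum => k; exact: di.
- exact: rint_gW fb (lexx _).
rewrite addrAC subrr add0r Rint_sum; last by move=> k; exact: di.
rewrite /occ -mulrBr -sumrB mulr_sumr; apply: eq_bigr => k _.
rewrite (@eq_Rint _ _ _ _ _ (fun w => surv (grid N k) w * f (W (grid N k.+1) w) -
   surv (grid N k) w * f (W (grid N k) w))); last by move=> w; rewrite mulrC mulrBr.
rewrite RintB//.
have expand t : 0 <= t -> \int[P]_w (surv (grid N k) w * f (W t w)) =
   mesh N * \sum_(j < J) \int[P]_w (surv (grid N k) w * pk (th + grid N j.+1) x (W t w)).
  move=> t0; have ji (j : 'I_J) := rint_survW (bmeas_pk x (tj j)) (grid_ge0 N k) t0.
  rewrite -Rint_sum// -RintZ; last exact: rint_sum.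
  by apply: eq_Rint => w; rewrite /f /pkpot mulrCA mulr_sumr.
rewrite !expand ?grid_ge0// -mulrBr; congr (_ * _); rewrite -sumrB.
pose A j := occ_term N (pk (th + grid N j.+1) x) k.
have AS j : \int[P]_w (surv (grid N k) w * pk (th + grid N j.+1) x (W (grid N k.+1) w)) = A j.+1.
  have sm := measurable_survF rst (grid_ge0 N k).
  rewrite (markov lamE Ffil BM Pfin Ppos x (grid_ge0 N k) (grid_lt N k) (tj j) sm (surv_ge0 tau _)).
  have -> : grid N k.+1 - grid N k = mesh N by rewrite gridS addrAC subrr add0r.
  by rewrite /A /occ_term [grid N j.+2]gridS addrA.
transitivity (\sum_(j < J) (A j.+1 - A j)).
  by apply: eq_bigr => j _; rewrite AS.
by rewrite -(big_mkord xpredT (fun j => A j.+1 - A j)) telescope_sumr.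
Qed.

End Occupation.

(* The left-hand side is [p] evaluated at the grid point following [t]. *)
Lemma step_sum (R : realType) (p : nat -> R) (dl t : R) (K : nat) : 0 < dl ->
  exists2 j : nat, p 0%N + \sum_(k < K) (p k.+1 - p k) * (k%:R * dl < t)%R%:R = p j &
    [/\ (j <= K)%N, (j < K)%N -> t <= j%:R * dl & (0 < j)%N -> j.-1%:R * dl < t].
Proof.
move=> dl0; elim: K => [|K [j Ej [jK h1 h2]]]; first by exists 0%N => //; rewrite big_ord0 addr0.
rewrite big_ord_recr /= addrA Ej; case: (ltP (K%:R * dl) t) => Kt.
  exists K.+1; last by split => //; rewrite ltnn.
  suff -> : j = K by rewrite mulr1; ring.
  apply/eqP; rewrite eqn_leq jK leqNgt; apply/negP => /h1 tj.
  have : K%:R * dl < j%:R * dl := lt_le_trans Kt tj.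
  by rewrite ltr_pM2r// ltr_nat ltnNge jK.
exists j; first by rewrite mulr0 addr0.
split => //; first exact: leqW.
rewrite ltnS leq_eqVlt => /orP[/eqP->//|]; exact: h1.
Qed.

(** * Removal of the rounding of the stopping time to the grid *)

Section Stopped.
Variables (R : realType) (n : nat).
Local Notation V := 'rV[R]_(n.+1).
Local Notation E := (Rd R n).
Variable lam : {sigma_finite_measure set E -> \bar R}.
Hypothesis lamE : is_lebesgue_d lam.
Context (dO : measure_display) (Omega : measurableType dO).
Variables (P : {measure set Omega -> \bar R}) (F : R -> set (set Omega))
  (W : R -> Omega -> V).
Hypotheses (Ffil : filtration F) (BM : brownian_motion lam P F W).
Hypotheses (Pfin : (P setT < +oo)%E) (Ppos : P setT != 0%E).
Variable tau : Omega -> probability R R.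
Hypothesis rst : randomized_stopping_time F tau.
Implicit Types (N k : nat) (x : V) (g : V -> R).

Lemma sqnorm_le_norm x : sqnorm x <= n.+1%:R * `|x| ^+ 2.
Proof.
rewrite mulr_natl -[leRHS](_ : \sum_(i < n.+1) `|x| ^+ 2 = _); last by rewrite sumr_const card_ord.
apply: ler_sum => i _; rewrite -[leLHS]real_normK ?num_real// ler_sqr ?nnegrE//.
exact: norm_coord_le.
Qed.

Lemma path_cvg w t e : 0 <= t -> 0 < e ->
  exists2 r : R, 0 < r & forall s, 0 <= s -> `|s - t| < r -> enorm (W s w - W t w) <= e.
Proof.
move=> t0 e0; have [/(_ w) cW _ _] := BM.
pose e' := e / n.+1%:R; have e'0 : 0 < e' by rewrite divr_gt0// ltr0n.
have tR : t \in @Rplus R by rewrite inE /Rplus /= in_itv /= andbT.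
have := @subspace_continuousP _ (@Rplus R) _ (fun t => W t w).
move=> [/(_ cW) + _] => /(_ t); rewrite inE in tR => /(_ tR) /cvgrPdist_le /(_ e' e'0).
rewrite /prop_near1 /within /= => /nbhs_ballP[r /= r0 rP]; exists r => // s s0 st.
have := rP s; rewrite /ball /= distrC => /(_ st).
have sR : @Rplus R s by rewrite /Rplus /= in_itv /= andbT.
move=> /(_ sR); rewrite distrC => h.
have e00 := ltW e0; rewrite -ler_sqr ?nnegrE ?enorm_ge0// sqr_enorm.
apply: (le_trans (sqnorm_le_norm _)).
have -> : e ^+ 2 = n.+1%:R ^+ 2 * e' ^+ 2 by rewrite -exprMn mulrCA mulfV ?mulr1// pnatr_eq0.
apply: ler_pM => //; first by rewrite expr2 ler_peMl// ler1n.
by rewrite ler_sqr ?nnegrE// ltW.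
Qed.

Section Sequence.
Variables (f_ : nat -> V -> R) (M L : R).
Hypotheses (fb : forall N, bmeas (f_ N) M)
  (fL : forall N x y, `|f_ N y - f_ N x| <= L * enorm (y - x)).

Definition step N g w (t : R) : R := g (W 0 w) +
  \sum_(k < steps N) (g (W (grid R N k.+1) w) - g (W (grid R N k) w)) * (grid R N k < t)%R%:R.

Lemma step_le N w t : `|step N (f_ N) w t| <= M.
Proof.
have [j Ej _] := step_sum (fun k => f_ N (W (grid R N k) w)) t (steps N) (mesh_gt0 R N).
rewrite /step -[X in W X w](mul0r (mesh R N)) Ej; exact: (fb N).2.
Qed.

(** Continuity of the path at t suffices, because the functions share a Lipschitz constant even
    though they vary with N; this freedom is what later gives uniformity in space. Negative times,
    which tau does not charge, are sent to 0, where the step function also sits. *)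
Lemma step_cvg w t : (step N (f_ N) w t - f_ N (W (Num.max t 0) w)) @[N --> \oo] --> 0.
Proof.
have [t0|t0] := leP t 0.
  rewrite (_ : (fun N => _) = fun=> 0); first exact: cvg_cst.
  apply/funext => N.
  have [j Ej [_ _ h]] := step_sum (fun k => f_ N (W (grid R N k) w)) t (steps N) (mesh_gt0 R N).
  rewrite /step -[X in f_ N (W X w) + _](mul0r (mesh R N)) Ej.
  suff -> : j = 0%N by rewrite /grid mul0r subrr.
  case: j {Ej} h => // j /(_ erefl) /=; rewrite ltNge => /negP[].
  exact: (le_trans t0 (grid_ge0 R N j)).
apply/cvgrPdist_le => e e0.
have [r r0 rP] := path_cvg w (ltW t0) (divr_gt0 e0 (ltr_pwDr (@ltr01 R) (normr_ge0 L))).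
near=> N.
have mr : mesh R N < r by near: N; exact: near_infty_natSinv_lt (PosNum r0).
have tN : t <= N.+1%:R.
  by near: N; exists (Num.truncn t) => // N /= hN; rewrite (le_trans (ltW (truncnS_gt t)))// ler_nat ltnS.
have [j Ej [jK h1 h2]] := step_sum (fun k => f_ N (W (grid R N k) w)) t (steps N) (mesh_gt0 R N).
rewrite /step -[X in f_ N (W X w) + _](mul0r (mesh R N)) Ej.
have h3 : t <= grid R N j.
  move: jK; rewrite leq_eqVlt => /orP[/eqP->|]; last exact: h1.
  by rewrite /grid /steps natrM -mulrA natr_mesh mulr1.
have j0 : (0 < j)%N.
  by case: j h3 {h1 h2 Ej jK} => //; rewrite /grid mul0r leNgt t0.
rewrite sub0r normrN (le_trans (fL _ _ _))//.
have hj : enorm (W (grid R N j) w - W t w) <= e / (`|L| + 1).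
  apply: rP; first exact: grid_ge0.
  rewrite ger0_norm ?subr_ge0//; apply: le_lt_trans mr.
  have := h2 j0; case: (j) j0 => // k _ /=; rewrite -/(grid R N k) gridS.
  by move: (grid R N k) (mesh R N) => a b; lra.
apply: (le_trans (ler_wpM2r (enorm_ge0 _) (ler_norm L))).
have L1 : 0 < `|L| + 1 by rewrite ltr_pwDr.
apply: (@le_trans _ _ ((`|L| + 1) * (e / (`|L| + 1)))); last by rewrite mulrCA mulfV ?mulr1// gt_eqF.
apply: ler_pM => //; first exact: enorm_ge0.
by rewrite lerDl.
Unshelve. all: by end_near.
Qed.

Lemma measurable_step N g w : measurable_fun setT (step N g w).
Proof.
apply: measurable_funD; first exact: measurable_cst.
apply: measurable_sum => k; apply: measurable_funM; first exact: measurable_cst.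
rewrite (_ : (fun t => _) = \1_(`]grid R N k, +oo[%classic)); first exact: measurable_indic.
by apply/funext => t; rewrite indicE mem_setE in_itv /= andbT.
Qed.

Lemma Rint_step N g w : \int[tau w]_t step N g w t = stopped W tau N g w.
Proof.
have tfin : (tau w setT < +oo)%E by rewrite probability_setT ltry.
have ii k : rint (tau w) (fun t => (grid R N k < t)%R%:R : R).
  rewrite (_ : (fun t => _) = \1_(`]grid R N k, +oo[%classic)); last first.
    by apply/funext => t; rewrite indicE mem_setE in_itv /= andbT.
  by apply: rint_indic => //; rewrite (le_lt_trans (probability_le1 _ _))// ltry.
have ki k := rintZ (g (W (grid R N k.+1) w) - g (W (grid R N k) w)) (ii k).
rewrite RintD; [|exact: rint_cst|by apply: rint_sum => k; exact: ki].
rewrite Rint_sum; last by move=> k; exact: ki.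
rewrite /stopped; congr (_ + _).
  by rewrite /Rintegral integral_cst//= probability_setT mule1.
apply: eq_bigr => k _; rewrite RintZ//; congr (_ * _).
rewrite (survE rst _ (grid_ge0 R N k)) -Rint_indicE//.
by apply: eq_Rint => t; rewrite indicE mem_setE in_itv /= andbT.
Qed.

End Sequence.

Section Mean.
Variables (nu : {measure set E -> \bar R}) (h : V -> R) (Ch : R).
Hypotheses (hb : bmeas h Ch) (h_ge0 : forall x, 0 <= h x)
  (nuE : forall A : set E, measurable A -> nu A = (\int[lam]_(x in A) (h x)%:E)%E)
  (nufin : (nu setT < +oo)%E) (term : terminal_law P W tau nu).

Definition smean g w : R := \int[tau w]_t g (W (Num.max t 0) w).

Lemma measurable_path g (M L : R) w : bmeas g M ->
  (forall x y, `|g y - g x| <= L * enorm (y - x)) ->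
  measurable_fun setT (fun t : R => g (W (Num.max t 0) w)).
Proof.
move=> gM gL; apply: (@measurable_fun_cvg _ _ _ _ (fun N => step N g w)).
  by move=> N; exact: measurable_step.
move=> t _; have := @step_cvg (fun=> g) L (fun=> gL) w t => /cvg_sub0.
by apply; exact: cvg_cst.
Qed.

Lemma smean_cvg (f_ : nat -> V -> R) (M L : R) w : (forall N, bmeas (f_ N) M) ->
  (forall N x y, `|f_ N y - f_ N x| <= L * enorm (y - x)) ->
  (stopped W tau N (f_ N) w - smean (f_ N) w) @[N --> \oo] --> 0.
Proof.
move=> fb fL; have tfin : (tau w setT < +oo)%E by rewrite probability_setT ltry.
have mp N := measurable_path w (fb N) (fL N).
have ip N : rint (tau w) (fun t : R => f_ N (W (Num.max t 0) w)).
  by apply: (bounded_rint tfin (mp N) (M := M)) => t; exact: (fb N).2.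
have is_ N : rint (tau w) (step N (f_ N) w).
  by apply: (bounded_rint tfin (measurable_step N _ w) (M := M)) => t; exact: step_le.
have : \int[tau w]_t (step N (f_ N) w t - f_ N (W (Num.max t 0) w)) @[N --> \oo] -->
    \int[tau w]_t (0 : R).
  apply: (@bounded_cvg_Rint _ _ _ _ _ _ (M + M)) => //.
  - by move=> N; apply: measurable_funB => //; exact: measurable_step.
  - move=> N t; rewrite (le_trans (ler_normB _ _))// lerD//; first exact: step_le.
    exact: (fb N).2.
  - by move=> t; exact: (step_cvg fL).
rewrite {2}/Rintegral integral0 /=; apply: cvg_trans; apply: near_eq_cvg; near=> N.
by rewrite RintB// Rint_step.
Unshelve. all: by end_near.
Qed.

Lemma measurable_smean g (M L : R) : bmeas g M ->
  (forall x y, `|g y - g x| <= L * enorm (y - x)) -> measurable_fun setT (smean g).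
Proof.
move=> gM gL; apply: (@measurable_fun_cvg _ _ _ _ (fun N => stopped W tau N g)).
  by move=> N; apply: (measurable_stopped Ffil BM rst N); exact: gM.1.
move=> w _; have := smean_cvg w (fun=> gM) (fun=> gL) => /cvg_sub0.
by apply; exact: cvg_cst.
Qed.

Lemma smean_le g (M L : R) w : bmeas g M ->
  (forall x y, `|g y - g x| <= L * enorm (y - x)) -> `|smean g w| <= M.
Proof.
move=> gM gL; have tfin : (tau w setT < +oo)%E by rewrite probability_setT ltry.
have ip : rint (tau w) (fun t : R => g (W (Num.max t 0) w)).
  by apply: (bounded_rint tfin (measurable_path w gM gL) (M := M)) => t; exact: gM.2.
have := norm_Rint_le ip (rint_cst M tfin) (fun t => gM.2 _).
by rewrite {2}/Rintegral integral_cst//= probability_setT mule1.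
Qed.

Lemma stopped_le N g (M : R) w : bmeas g M -> `|stopped W tau N g w| <= M.
Proof.
move=> gM; have tfin : (tau w setT < +oo)%E by rewrite probability_setT ltry.
have sM t : `|step N g w t| <= M by exact: (@step_le (fun=> g) M (fun=> gM)).
have is_ := bounded_rint tfin (measurable_step N g w) sM.
have := norm_Rint_le is_ (rint_cst M tfin) sM.
by rewrite Rint_step {1}/Rintegral integral_cst//= probability_setT mule1.
Qed.

(** Since [tau w] lives on nonnegative times, the maximum with 0 is invisible and the terminal law
    applies; the density of nu then gives the right-hand side. *)
Lemma mean_smean g (M L : R) : bmeas g M -> (forall x, 0 <= g x) ->
  (forall x y, `|g y - g x| <= L * enorm (y - x)) ->
  \int[P]_w smean g w = \int[lam]_x (g x * h x).
Proof.
move=> gM g0 gL; rewrite /Rintegral; congr fine.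
have mEg : measurable_fun setT (EFin \o (g : E -> R)) by apply/measurable_EFinP; exact: gM.1.
have := ge0_integral_density nufin hb.1 h_ge0 nuE mEg.
move=> /(_ (fun x => _)) H.
have {}H : (\int[nu]_x (g x)%:E = \int[lam]_x (g x * h x)%:E)%E.
  by rewrite H// => x; rewrite lee_fin.
rewrite -H -(term gM.1 g0); apply: eq_integral => w _.
have tfin : (tau w setT < +oo)%E by rewrite probability_setT ltry.
have mp := measurable_path w gM gL.
have ip : rint (tau w) (fun t : R => g (W (Num.max t 0) w)).
  by apply: (bounded_rint tfin mp (M := M)) => t; exact: gM.2.
rewrite /smean RintE//.
have mR : measurable (@Rplus R) by exact: measurable_itv.
transitivity (\int[tau w]_(t in @Rplus R) (g (W (Num.max t 0) w))%:E)%E; last first.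
  apply: eq_integral => t; rewrite inE /Rplus /= in_itv /= andbT => t0.
  by rewrite max_l.
have N0 : tau w (~` @Rplus R) = 0%E.
  by have [/(_ w) t1 _] := rst; rewrite probability_setC// t1 subee.
rewrite (@negligible_integral _ _ _ (tau w) setT (~` @Rplus R))//; last exact: measurableC.
by rewrite setTD setCK.
Qed.

Lemma mean_stopped_cvg (f_ : nat -> V -> R) (M L : R) : (forall N, bmeas (f_ N) M) ->
  (forall N x, 0 <= f_ N x) -> (forall N x y, `|f_ N y - f_ N x| <= L * enorm (y - x)) ->
  (\int[P]_w stopped W tau N (f_ N) w - \int[lam]_x (f_ N x * h x)) @[N --> \oo] --> 0.
Proof.
move=> fb f0 fL.
have ms N := measurable_stopped Ffil BM rst N (fb N).1.
have mm N := measurable_smean (fb N) (fL N).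
have is_ N : rint P (stopped W tau N (f_ N)).
  by apply: (bounded_rint Pfin (ms N) (M := M)) => w; exact: stopped_le.
have im N : rint P (smean (f_ N)).
  by apply: (bounded_rint Pfin (mm N) (M := M)) => w; exact: smean_le (fb N) (fL N).
have : \int[P]_w (stopped W tau N (f_ N) w - smean (f_ N) w) @[N --> \oo] --> \int[P]_w (0 : R).
  apply: (@bounded_cvg_Rint _ _ _ _ _ _ (M + M)) => //.
  - by move=> N; exact: measurable_funB.
  - move=> N w; rewrite (le_trans (ler_normB _ _))// lerD//; first exact: stopped_le.
    exact: smean_le (fb N) (fL N).
  - by move=> w; exact: (smean_cvg w fb fL).
rewrite {2}/Rintegral integral0 /=; apply: cvg_trans; apply: near_eq_cvg; near=> N.
by rewrite RintB// (mean_smean (fb N) (f0 N) (fL N)).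
Unshelve. all: by end_near.
Qed.

End Mean.
End Stopped.

(** * Potential of the difference of the two laws *)

Section PotentialSums.
Variables (R : realType) (n : nat).
Local Notation V := 'rV[R]_(n.+1).
Local Notation E := (Rd R n).
Variable lam : {sigma_finite_measure set E -> \bar R}.
Hypothesis lamE : is_lebesgue_d lam.
Hypothesis lam_gauss : forall t : R, 0 < t -> gauss lam t setT = 1%E.
Local Notation hP := (heat lam).
Implicit Types (x : V) (i j : nat).

Section Fixed.
Variables (d C : R) (g : V -> R).
Hypotheses (d_gt0 : 0 < d) (gb : bmeas g C).

Let jd_gt0 j : 0 < j.+1%:R * d. Proof. by rewrite mulr_gt0// ltr0n. Qed.

Lemma bmeas_psum i : bmeas (psum lam d g i) (i%:R * d * C).
Proof.
split; last by move=> x; exact: (psum_le lamE lam_gauss).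
apply: measurable_funM; first exact: measurable_cst.
by apply: measurable_sum => j; apply: measurable_hP; exact: gb.1.
Qed.

Lemma hP_psum t i x : 0 < t -> hP t (psum lam d g i) x =
  d * \sum_(j < i) hP (t + j.+1%:R * d) g x.
Proof.
move=> t0; have b j := bmeas_hP lamE lam_gauss (jd_gt0 j) gb.
rewrite /psum (hPZ lamE lam_gauss d x t0 (bmeas_sum (index_enum _) (fun j : 'I_i => b j))).
rewrite (hP_sum lamE lam_gauss (index_enum _) x t0 (fun j : 'I_i => b j)); congr (_ * _).
by apply: eq_bigr => j _; rewrite (hP_semigroup lamE lam_gauss x t0 (jd_gt0 j) gb).
Qed.

Lemma psumD i k x : psum lam d g (i.+1 + k) x =
  psum lam d g i.+1 x + hP (i.+1%:R * d) (psum lam d g k) x.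
Proof.
rewrite hP_psum// /psum big_split_ord /= mulrDr; congr (_ + _ * _).
by apply: eq_bigr => j _; rewrite -addnS natrD mulrDl.
Qed.

(** Split the sum of i.+2 terms in two ways, after its first term and before its last, and
    compare. *)
Lemma psum_shift i x : hP d (psum lam d g i.+1) x - psum lam d g i.+1 x =
  d * (hP d (hP (i.+1%:R * d) g) x - hP d g x).
Proof.
have := psumD 0 i.+1 x; rewrite mul1r => h.
have E1 : psum lam d g 1 x = d * hP d g x by rewrite /psum big_ord_recl big_ord0 mul1r addr0.
have E2 : psum lam d g i.+2 x = psum lam d g i.+1 x + d * hP (i.+2%:R * d) g x.
  by rewrite /psum big_ord_recr mulrDr.
rewrite (hP_semigroup lamE lam_gauss x d_gt0 (jd_gt0 i) gb).
have -> : d + i.+1%:R * d = i.+2%:R * d by rewrite -[i.+2%:R]natr1 mulrDl mul1r addrC.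
move: h; rewrite add1n E2 E1.
move: (psum _ _ _ _ _) (heat _ _ _ _) (heat _ _ _ _) (heat _ _ _ _) => a b c e h.
by rewrite mulrBr; lra.
Qed.

(** With s = sqrt t one has |z| <= s + |z|^2 / s, so the second moment bounds the first. *)
Lemma hP_lip_diff (v : V -> R) (M L t : R) x : 0 < t -> bmeas v M ->
  (forall y z, `|v (y + z) - v y| <= L * enorm z) ->
  `|hP t v x - v x| <= L * ((1 + 4 * kap R n) * Num.sqrt t).
Proof.
move=> t0 vb vL; set s := Num.sqrt t.
have s0 : 0 < s by rewrite sqrtr_gt0.
have ss : s ^+ 2 = t by rewrite sqr_sqrtr// ltW.
have vL' y : `|v y - v x| <= L * enorm (y - x).
  by have := vL x (y - x); rewrite subrKC.
pose z1 : V := const_mx 1.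
have L0 : 0 <= L.
  have e1 : 0 < enorm z1.
    rewrite sqrtr_gt0 /sqnorm (eq_bigr (fun=> 1)); last by move=> i _; rewrite mxE expr1n.
    by rewrite sumr_const card_ord ltr0n.
  by have := le_trans (normr_ge0 _) (vL 0 z1); rewrite pmulr_lge0.
have i1 := rint_bpk lamE lam_gauss x t0 vb.
have ip := rint_pk lamE lam_gauss x t0.
have i2 := rint_moment2 lamE lam_gauss x t0.
have -> : hP t v x - v x = \int[lam]_y (v y * pk t x y - v x * pk t x y).
  rewrite RintB//; last exact: rintZ.
  by rewrite RintZ// Rint_pk// mulr1.
have ib := rintD (rintZ s ip) (rintZ s^-1 i2).
apply: (@le_trans _ _ (\int[lam]_y (L * (s * pk t x y + s^-1 * (sqnorm (y - x) * pk t x y))))).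
  apply: norm_Rint_le; [by apply: rintB => //; exact: rintZ|exact: rintZ|move=> y].
  have := pk_ge0 x y t0; move: (pk t x y) => p p0.
  rewrite -mulrBl normrM (ger0_norm p0).
  rewrite (_ : L * (s * p + s^-1 * (sqnorm (y - x) * p)) = L * (s + s^-1 * sqnorm (y - x)) * p);
    last by ring.
  apply: ler_wpM2r => //.
  apply: (le_trans (vL' y)); apply: ler_wpM2l => //.
  rewrite -sqr_enorm; have := enorm_ge0 (y - x); move: (enorm _) => a a0.
  rewrite -(@ler_pM2r _ s)// mulrDl -mulrA [a ^+ 2 * s]mulrC mulrA mulVf ?gt_eqF// mul1r.
  by nra.
rewrite RintZ// RintD; [|exact: rintZ|exact: rintZ].
rewrite (RintZ s ip) (RintZ s^-1 i2) Rint_pk// mulr1; apply: ler_wpM2l => //.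
have h := Rint_moment2 lamE lam_gauss x t0.
apply: (@le_trans _ _ (s + s^-1 * (4 * kap R n * t))).
  by rewrite lerD2l; apply: ler_wpM2l => //; rewrite invr_ge0 ltW.
rewrite -ss le_eqVlt; apply/orP; left; apply/eqP; field.
by rewrite gt_eqF.
Qed.

End Fixed.
End PotentialSums.

Section Potential.
Variables (R : realType) (n : nat).
Local Notation V := 'rV[R]_(n.+1).
Local Notation E := (Rd R n).
Variable lam : {sigma_finite_measure set E -> \bar R}.
Hypothesis lamE : is_lebesgue_d lam.
Context (dO : measure_display) (Omega : measurableType dO).
Variables (P : {measure set Omega -> \bar R}) (F : R -> set (set Omega))
  (W : R -> Omega -> V).
Hypotheses (Ffil : filtration F) (BM : brownian_motion lam P F W).
Hypotheses (Pfin : (P setT < +oo)%E) (Ppos : P setT != 0%E).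
Variable tau : Omega -> probability R R.
Hypothesis rst : randomized_stopping_time F tau.
Variables (U : set V) (rad : R).
Hypotheses (exitU : before_exit U W tau) (rad_ge0 : 0 <= rad) (Urad : forall x, U x -> cube rad x).
Variables (nu : {measure set E -> \bar R}) (h m : V -> R) (Ch Cm : R).
Hypotheses (hb : bmeas h Ch) (h_ge0 : forall x, 0 <= h x) (h_int : rint lam h)
  (nuE : forall A : set E, measurable A -> nu A = (\int[lam]_(x in A) (h x)%:E)%E)
  (nufin : (nu setT < +oo)%E) (term : terminal_law P W tau nu).
Hypotheses (mb : bmeas m Cm) (m_ge0 : forall x, 0 <= m x) (m_int : rint lam m)
  (start : forall B : set E, measurable B ->
     P [set w | B (W 0 w)] = (\int[lam]_(x in B) (m x)%:E)%E).
Local Notation hP := (heat lam).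
Local Notation Occ := (occ P W tau).
Local Notation CV := (occ_mass lamE Ffil BM Pfin Ppos rst exitU rad_ge0 Urad).
Implicit Types (x : V) (N S : nat).

Let lam_gauss (t : R) : 0 < t -> gauss lam t setT = 1%E.
Proof. exact: gauss_mass Ffil BM Pfin Ppos t. Qed.

Definition defect x : R := m x - h x.

Lemma bmeas_defect : bmeas defect (Cm + Ch). Proof. exact: bmeasB. Qed.

Lemma rint_defect : rint lam defect. Proof. exact: rintB. Qed.

Lemma mean_start g (M : R) : bmeas g M -> (forall x, 0 <= g x) ->
  \int[P]_w g (W 0 w) = \int[lam]_x (g x * m x).
Proof.
move=> gM g0; rewrite /Rintegral; congr fine.
have mEg : measurable_fun setT (EFin \o (g : E -> R)) by apply/measurable_EFinP; exact: gM.1.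
have Eg0 (x : E) : (0 <= (EFin \o (g : E -> R)) x)%E by rewrite lee_fin.
have [p pE pi] := image_measure P (measurable_W Ffil BM (lexx 0)).
have pd (A : set E) : measurable A -> p A = (\int[lam]_(x in A) (m x)%:E)%E.
  by move=> mA; rewrite pE; exact: start.
have pf : (p setT < +oo)%E by rewrite pE.
by have := ge0_integral_density pf mb.1 m_ge0 pd mEg Eg0; rewrite (pi _ mEg Eg0).
Qed.

Lemma pk_lipschitz (t : R) x y z : 0 < t ->
  `|pk t x z - pk t x y| <= 2 * Cg R n * gc n t / Num.sqrt t * enorm (z - y).
Proof.
move=> t0; have := gauss_lipschitz (y - x) (y - z) t0; rewrite /pk.
rewrite (_ : y - x - (y - z) = z - x); last by rewrite opprB addrAC subrKC.
by rewrite (_ : enorm (y - z) = enorm (z - y)) // /enorm sqnormBC.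
Qed.

Lemma pkpot_lipschitz N J (th : R) x y z : 0 < th ->
  `|pkpot N J th x z - pkpot N J th x y| <=
    J%:R * mesh R N * (2 * Cg R n * gc n th / Num.sqrt th) * enorm (z - y).
Proof.
move=> th0; have m0 := ltW (mesh_gt0 R N).
have C0 : 0 <= Cg R n by rewrite (le_trans ler01)// Cg_ge1.
set K := 2 * Cg R n * gc n th / Num.sqrt th.
rewrite -mulrBr normrM (ger0_norm m0) -sumrB.
rewrite (_ : J%:R * _ * _ * _ = mesh R N * (J%:R * (K * enorm (z - y)))); last by ring.
apply: ler_wpM2l => //.
rewrite mulr_natl -[leRHS](_ : \sum_(i < J) (K * enorm (z - y)) = _);
  last by rewrite sumr_const card_ord.
apply: (le_trans (ler_norm_sum _ _ _)); apply: ler_sum => j _.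
have tj : 0 < th + grid R N j.+1 by rewrite ltr_wpDr// grid_ge0.
have tt : th <= th + grid R N j.+1 by rewrite lerDl grid_ge0.
apply: (le_trans (pk_lipschitz x y z tj)); apply: ler_wpM2r; first exact: enorm_ge0.
apply: ler_pM; first by rewrite !mulr_ge0// ltW// gc_gt0.
- by rewrite invr_ge0 sqrtr_ge0.
- by apply: ler_wpM2l; [rewrite mulr_ge0|exact: gc_le].
- by rewrite lef_pV2 ?posrE ?sqrtr_gt0// ler_wsqrtr.
Qed.

(** The number of terms is such that the times run up to S, whatever the mesh. *)
Definition vpot N S : V -> R := psum lam (mesh R N) defect (S * N.+1).

Lemma vpotE N S th x : 0 < th -> hP th (vpot N S) x =
  \int[lam]_y (pkpot N (S * N.+1) th x y * defect y).
Proof.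
move=> th0; have db := bmeas_defect.
rewrite (hP_psum lamE lam_gauss (mesh_gt0 R N) db _ x th0).
have tj j : 0 < th + grid R N j.+1 by rewrite ltr_wpDr// grid_ge0.
have ji (j : 'I_(S * N.+1)) := rint_bpk lamE lam_gauss x (tj j) db.
rewrite -Rint_sum// -RintZ; last exact: rint_sum.
by apply: eq_Rint => y; rewrite /pkpot -[RHS]mulrA mulr_suml; congr (_ * _); apply: eq_bigr => j _; rewrite mulrC.
Qed.

(** Uniformity in x is obtained by a choice, not by compactness: for each N take a point x_N that
    violates the bound, if there is one, and apply [mean_stopped_cvg] to the potentials based at
    x_N. Their sup and Lipschitz bounds do not depend on x_N. *)
Lemma vpot_approx S (th e : R) : 0 < th -> 0 < e -> exists N0, forall N x, (N0 <= N)%N ->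
  `|hP th (vpot N S) x -
    (Occ N (pk (th + grid R N 1) x) - Occ N (pk (th + grid R N (S * N.+1).+1) x))| <= e.
Proof.
move=> th0 e0.
pose good N x := `|hP th (vpot N S) x -
    (Occ N (pk (th + grid R N 1) x) - Occ N (pk (th + grid R N (S * N.+1).+1) x))| <= e.
pose x_ N : V := xget 0 [set x | ~ good N x].
pose f_ N := pkpot N (S * N.+1) th (x_ N).
have JE N : (S * N.+1)%:R * mesh R N = S%:R by rewrite natrM -mulrA natr_mesh mulr1.
have fb N : bmeas (f_ N) (S%:R * gc n th) by rewrite -(JE N); exact: bmeas_pkpot.
have f0 N x : 0 <= f_ N x by exact: pkpot_ge0.
have fL N x y : `|f_ N y - f_ N x| <=
    S%:R * (2 * Cg R n * gc n th / Num.sqrt th) * enorm (y - x).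
  by rewrite -(JE N); exact: pkpot_lipschitz.
have /cvgrPdist_le/(_ e e0)[N0 _ N0P] :=
  mean_stopped_cvg Ffil BM Pfin rst hb h_ge0 nuE nufin term fb f0 fL.
exists N0 => N x N0N; apply: contrapT => bad.
have : ~ good N (x_ N) by apply: (@xgetPex _ 0 [set x | ~ good N x]); exists x.
apply; rewrite /good; have := N0P N N0N; rewrite /= sub0r normrN.
rewrite vpotE// -/(f_ N).
have := mean_stopped lamE Ffil BM Pfin Ppos rst N (S * N.+1) (x_ N) th0.
rewrite -/(f_ N) (mean_start (fb N) (f0 N)) => E1.
have -> : \int[lam]_y (f_ N y * defect y) =
   \int[lam]_y (f_ N y * m y) - \int[lam]_y (f_ N y * h y).
  rewrite -RintB; [|by under eq_fun do rewrite mulrC; exact: (Rint_Mb m_int (fb N))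
    |by under eq_fun do rewrite mulrC; exact: (Rint_Mb h_int (fb N))].
  by apply: eq_Rint => y; rewrite mulrBr.
move: E1; move: (Rintegral P _ _) (Rintegral lam _ _) (Rintegral lam _ _) (Occ N _) (Occ N _).
move=> a c b q p E1; rewrite (_ : b - c - (q - p) = a - c)//; lra.
Qed.

End Potential.

(** * Exterior points near the complement of a Lipschitz domain *)

Section Exterior.
Variables (R : realType) (n : nat).
Local Notation V := 'rV[R]_(n.+1).
Implicit Types (x y z : V).

Lemma coord_le_enorm z (i : 'I_n.+1) : `|z ord0 i| <= enorm z.
Proof.
rewrite -ler_sqr ?nnegrE ?enorm_ge0// sqr_enorm real_normK ?num_real// /sqnorm (bigD1 i)//= lerDl.
by apply: sumr_ge0 => j _; exact: sqr_ge0.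
Qed.

Lemma sqnorm_add_le x y : sqnorm (x + y) <= 2 * sqnorm x + 2 * sqnorm y.
Proof.
rewrite /sqnorm !mulr_sumr -big_split /=; apply: ler_sum => i _; rewrite mxE.
by have := sqr_ge0 (x ord0 i - y ord0 i); move: (x ord0 i) (y ord0 i) => a b; nra.
Qed.

Lemma sqnorm_mulmx_orth x (Q : 'M[R]_(n.+1)) : Q *m Q^T = 1%:M -> sqnorm (x *m Q) = sqnorm x.
Proof.
move=> QQ; have sE (z : V) : sqnorm z = (z *m z^T) ord0 ord0.
  by rewrite mxE; apply: eq_bigr => i _; rewrite mxE expr2.
by rewrite !sE trmx_mul mulmxA -(mulmxA x) QQ mulmx1.
Qed.

(** Move x by s down the last axis of the local chart. Since x is not in U, the graph satisfies g 0
    >= 0. A point of U at distance a from the moved point has last coordinate at most a - s, yet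
    must lie above a graph of height at least - |L| a; hence a >= s / (1 + |L|). The bound s <= r /
    4 keeps such points inside the chart. *)
Lemma boundary_exterior (U : set V) x (e : R) : locally_lipschitz_boundary U -> 0 < e ->
  closure U x -> ~ U x -> exists x' rh, [/\ 0 < rh, enorm (x' - x) <= e &
    forall y, U y -> rh <= enorm (y - x')].
Proof.
move=> llb e0 Ucx Ux; have [r [Q [g [r0 QQ [L Lg] chart]]]] := llb x Ucx Ux.
pose s := Num.min e (r / 4).
have s0 : 0 < s by rewrite lt_min e0/= divr_gt0.
have se : s <= e by rewrite /s ge_min lexx.
have sr : s <= r / 4 by rewrite /s ge_min lexx orbT.
pose el : V := delta_mx ord0 ord_max.
have QQ' : Q^T *m Q = 1%:M := mulmx1C QQ.
have QT : Q^T *m Q^T^T = 1%:M by rewrite trmxK.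
have el1 : sqnorm el = 1.
  rewrite /sqnorm (bigD1 ord_max)//= mxE !eqxx expr1n big1 ?addr0// => i iM.
  by rewrite mxE eqxx (negbTE iM) expr0n.
pose b : V := - s *: (el *m Q^T).
have sb : sqnorm b = s ^+ 2.
  by rewrite /b sqnormZ sqrrN sqnorm_mulmx_orth// el1 mulr1.
have L1 : 0 < 1 + `|L| by rewrite ltr_pwDl.
pose rh := s / (1 + `|L|); have rh0 : 0 < rh by rewrite divr_gt0.
have rhs : rh <= s by rewrite ler_pdivrMr// mulrDr mulr1 lerDl mulr_ge0// ltW.
exists (x + b), rh; split => //.
  by rewrite addrAC subrr add0r /enorm sb sqrtr_sqr gtr0_norm.
move=> y Uy; rewrite leNgt; apply/negP => yrh.
pose u := y - (x + b); have yE : y - x = u + b by rewrite /u opprD addrA addrNK.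
have e_u := enorm_ge0 u; rewrite -/u in yrh.
have su : sqnorm u <= s ^+ 2.
  by rewrite -sqr_enorm ler_sqr ?nnegrE// ?ltW//; exact: lt_le_trans yrh rhs.
have g0 : 0 <= g 0.
  rewrite leNgt; apply/negP => g0; apply: Ux; apply/(chart x) => /=.
    by rewrite subrr /sqnorm big1 ?exprn_gt0// => i _; rewrite mxE expr0n.
  rewrite subrr mul0mx mxE (_ : \row_j _ = 0)//.
  by apply/rowP => j; rewrite !mxE.
have yr : sqnorm (y - x) < r ^+ 2.
  rewrite yE (le_lt_trans (sqnorm_add_le _ _))// sb.
  have : s ^+ 2 <= (r / 4) ^+ 2 by apply: ler_pM => //; exact: ltW.
  by have : 0 < r ^+ 2 := exprn_gt0 2 r0; lra.
have /= := (chart y yr).1 Uy; rewrite yE mulmxDl.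
have bQ : b *m Q = - s *: el by rewrite /b -scalemxAl -mulmxA QQ' mulmx1.
have uQ : enorm (u *m Q) = enorm u by rewrite /enorm sqnorm_mulmx_orth.
rewrite bQ; set z := _ + _; set z' := \row_j _.
have zM : z ord0 ord_max <= enorm u - s.
  rewrite /z !mxE !eqxx mulr1 lerD2r (le_trans (ler_norm _))//.
  by have := coord_le_enorm (u *m Q) ord_max; rewrite uQ mxE.
have z'E : z' = \row_(j < n) (u *m Q) ord0 (widen_ord (leqnSn n) j).
  apply/rowP => j; rewrite [LHS]mxE [RHS]mxE /z mxE [X in _ + X]mxE [X in _ * X]mxE eqxx /=.
  rewrite (_ : (widen_ord _ j == ord_max) = false) ?mulr0 ?addr0//.
  by apply/negbTE; rewrite -val_eqE /= neq_ltn ltn_ord.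
have z's : sqnorm z' <= sqnorm u.
  rewrite -(sqnorm_mulmx_orth u QQ) z'E {2}/sqnorm big_ord_recr /= /sqnorm.
  rewrite (eq_bigr (fun j : 'I_n => (u *m Q) ord0 (widen_ord (leqnSn n) j) ^+ 2)).
    by rewrite lerDl sqr_ge0.
  by move=> j _; rewrite [X in X ^+ 2 = _]mxE.
have gz : - (`|L| * enorm u) <= g z'.
  have := Lg z' 0; rewrite subr0 => h.
  have : `|g z' - g 0| <= `|L| * enorm u.
    rewrite -ler_sqr ?nnegrE ?mulr_ge0// exprMn !real_normK ?num_real// sqr_enorm.
    by apply: (le_trans h); apply: ler_wpM2l => //; exact: sqr_ge0.
  by rewrite ler_norml => /andP[h1 _]; lra.
rewrite ltNge => /negP; apply; apply: (le_trans zM); apply: (le_trans _ gz).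
have : enorm u * (1 + `|L|) <= s by rewrite -ler_pdivlMr// ltW.
by move: (enorm u) (`|L|) => a l; lra.
Qed.

Lemma point_exterior (U : set V) x (e : R) : locally_lipschitz_boundary U -> 0 < e ->
  ~ U x -> exists x' rh, [/\ 0 < rh, enorm (x' - x) <= e &
    forall y, U y -> rh <= enorm (y - x')].
Proof.
move=> llb e0 Ux; have [Ucx|Ucx] := pselect (closure U x); first exact: boundary_exterior.
have oC : open (~` closure U) by apply: closed_openC; exact: closed_closure.
have [rh rh0 sub] := open_cball oC Ucx.
exists x, rh; split => //.
  by rewrite subrr /enorm /sqnorm big1 ?sqrtr0 ?ltW// => i _; rewrite mxE expr0n.
move=> y Uy; rewrite leNgt; apply/negP => yrh.
have /sub : cball_e x rh y.
  rewrite /cball_e /= -sqr_enorm ler_sqr ?nnegrE ?enorm_ge0// ltW//.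
by apply; exact: subset_closure.
Qed.

Lemma compact_cube (k : R) : compact (cube k : set V).
Proof.
rewrite (_ : cube k = [set v : V | forall i, `[- k, k]%classic (v ord0 i)]).
  by apply: (@rV_compact R _ (fun=> `[- k, k]%classic)) => i; exact: segment_compact.
by apply/seteqP; split => v vk i; have := vk i; rewrite /= !mxE in_itv.
Qed.

(** The radius is uniform by compactness of the cube of half-side rad + 1 minus U: the point found
    for x with tolerance e / 2 serves all points within e / 2 of x. Outside that cube x itself is at
    distance at least 1 from U, whence rh <= 1. *)
Lemma exterior_points (U : set V) (rad e : R) : open U -> (forall x, U x -> cube rad x) ->
  locally_lipschitz_boundary U -> 0 < e ->
  exists2 rh : R, 0 < rh & forall x, ~ U x ->
    exists2 x', enorm (x' - x) <= e & forall y, U y -> rh <= enorm (y - x').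
Proof.
move=> oU Urad llb e0; have e20 : 0 < e / 2 by rewrite divr_gt0.
pose A : set V := cube (rad + 1) `&` ~` U.
have cA : compact A.
  by apply: compact_closedI; [exact: compact_cube|exact: open_closedC].
pose Q (rh : R) x := exists2 x', enorm (x' - x) <= e & forall y, U y -> rh <= enorm (y - x').
have : \forall rh \near 0^'+, A `<=` Q rh.
  move/compact_near_coveringP: cA; apply => x [_ Ux].
  have [x' [rh [rh0 xx' Ux']]] := point_exterior llb e20 Ux.
  exists ([set x2 | enorm (x2 - x) <= e / 2], [set r | r <= rh]); first split => /=.
  - apply/nbhs_ballP; exists (e / 2 / n.+1%:R) => /=; first by rewrite divr_gt0.
    move=> x2 h /=; rewrite -ler_sqr ?nnegrE ?enorm_ge0 ?(ltW e20)//.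
    rewrite sqr_enorm sqnormBC.
    have hc (i : 'I_n.+1) : (x - x2) ord0 i ^+ 2 <= (e / 2 / n.+1%:R) ^+ 2.
      have [_ /(_ ord0 i)] := h; rewrite /ball /= => hi.
      by rewrite !mxE -real_normK ?num_real//; apply: ler_pM => //; exact: ltW hi.
    rewrite /sqnorm (le_trans (ler_sum _ (fun i _ => hc i)))// sumr_const card_ord -[leLHS]mulr_natl.
    have := ltr0Sn R n; have : 1 <= n.+1%:R :> R by rewrite ler1n.
    move: (n.+1%:R : R) => k k1 k0; rewrite (_ : k * _ = (e / 2) ^+ 2 / k); last first.
      by field; rewrite gt_eqF.
    by rewrite ler_pdivrMr// ler_peMr// sqr_ge0.
  - exact: nbhs_right_le.
  move=> [x2 r] /= [x2e rr]; exists x' => [|y Uy]; last exact: le_trans rr (Ux' y Uy).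
  rewrite -ler_sqr ?nnegrE ?enorm_ge0 ?(ltW e0)// sqr_enorm.
  have -> : x' - x2 = (x' - x) + (x - x2) by rewrite addrA subrK.
  apply: (le_trans (sqnorm_add_le _ _)); rewrite [sqnorm (x - x2)]sqnormBC.
  have h1 : sqnorm (x' - x) <= (e / 2) ^+ 2.
    by rewrite -sqr_enorm ler_sqr ?nnegrE ?enorm_ge0 ?(ltW e20).
  have h2 : sqnorm (x2 - x) <= (e / 2) ^+ 2.
    by rewrite -sqr_enorm ler_sqr ?nnegrE ?enorm_ge0 ?(ltW e20).
  by lra.
move=> H; have [rh [rh0 rh1 AQ]] : exists rh : R, [/\ 0 < rh, rh <= 1 & A `<=` Q rh].
  near (0 : R)^'+ => rh; exists rh; split.
  - by near: rh; exact: nbhs_right_gt.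
  - by near: rh; exact: nbhs_right_le.
  - by near: rh.
exists rh => // x Ux; have [xc|xc] := pselect (cube (rad + 1) x); first exact: AQ.
exists x => [|y Uy].
  by rewrite subrr /enorm /sqnorm big1 ?sqrtr0 ?ltW// => i _; rewrite mxE expr0n.
have [i xi] : exists i, ~ (- (rad + 1) <= x ord0 i <= rad + 1).
  apply: contrapT => /forallNP h; apply: xc => i; rewrite !mxE.
  by have := h i => /contrapT.
have := Urad y Uy i; rewrite !mxE => /andP[y1 y2].
apply: (le_trans rh1); apply: le_trans (coord_le_enorm (y - x) i); rewrite !mxE.
rewrite leNgt ltr_norml; apply/negP => /andP[h1 h2]; apply: xi.
by apply/andP; split; lra.
Unshelve. all: by end_near.
Qed.

End Exterior.

Lemma gc_small (R : realType) (n : nat) (e : R) : 0 < e -> exists S : nat, gc n S.+1%:R <= e.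
Proof.
move=> e0; have ie0 : 0 < e^-1 by rewrite invr_gt0.
exists (Num.truncn (e^-1 ^+ 2)); set t : R := _.+1%:R.
have t1 : 1 <= t by rewrite ler1n.
have te : e^-1 ^+ 2 <= t by exact/ltW/truncnS_gt.
have pt : t <= 2 * pi * t by have := pi_ge2 R; nra.
have t0 : 0 < t by lra.
rewrite /gc -[leRHS]invrK lef_pV2 ?posrE ?exprn_gt0 ?sqrtr_gt0//; last by rewrite (lt_le_trans t0 pt).
apply: (@le_trans _ _ (Num.sqrt t)).
  by rewrite -[leLHS](ger0_norm (ltW ie0)) -sqrtr_sqr ler_wsqrtr.
apply: (le_trans (ler_wsqrtr pt)); rewrite exprS ler_peMr ?sqrtr_ge0// exprn_ege1//.
by have := ler_wsqrtr (le_trans t1 pt); rewrite sqrtr1.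
Qed.

Lemma opp_le_of_dist (R : realType) (a b q e C : R) :
  a - b <= e -> `|b - q| <= e * C -> `|a| <= e -> - q <= (2 + C) * e.
Proof. by rewrite !ler_norml => h1 /andP[_ h2] /andP[h3 _]; rewrite mulrDl [C * e]mulrC; lra. Qed.

(** * Bounds on the potential of the difference of the two laws, and the inequality for psi *)

Section Inequality.
Variables (R : realType) (n : nat).
Local Notation V := 'rV[R]_(n.+1).
Local Notation E := (Rd R n).
Variable lam : {sigma_finite_measure set E -> \bar R}.
Hypothesis lamE : is_lebesgue_d lam.
Context (dO : measure_display) (Omega : measurableType dO).
Variables (P : {measure set Omega -> \bar R}) (F : R -> set (set Omega))
  (W : R -> Omega -> V).
Hypotheses (Ffil : filtration F) (BM : brownian_motion lam P F W).
Hypotheses (Pfin : (P setT < +oo)%E) (Ppos : P setT != 0%E).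
Variable tau : Omega -> probability R R.
Hypothesis rst : randomized_stopping_time F tau.
Variables (U : set V) (rad : R).
Hypotheses (exitU : before_exit U W tau) (rad_ge0 : 0 <= rad) (Urad : forall x, U x -> cube rad x).
Hypotheses (oU : open U) (lipU : locally_lipschitz_boundary U).
Variables (nu : {measure set E -> \bar R}) (h m : V -> R) (Ch Cm : R).
Hypotheses (hb : bmeas h Ch) (h_ge0 : forall x, 0 <= h x) (h_int : rint lam h)
  (nuE : forall A : set E, measurable A -> nu A = (\int[lam]_(x in A) (h x)%:E)%E)
  (nufin : (nu setT < +oo)%E) (term : terminal_law P W tau nu).
Hypotheses (mb : bmeas m Cm) (m_ge0 : forall x, 0 <= m x) (m_int : rint lam m)
  (start : forall B : set E, measurable B ->
     P [set w | B (W 0 w)] = (\int[lam]_(x in B) (m x)%:E)%E).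
Local Notation hP := (heat lam).
Local Notation Occ := (occ P W tau).
Local Notation CV := (occ_mass lamE Ffil BM Pfin Ppos rst exitU rad_ge0 Urad).
Local Notation vpot := (vpot lam h m).
Local Notation defect := (defect h m).
Local Notation Cw := (Cm + Ch).
Implicit Types (x : V) (N S : nat).

Let lam_gauss (t : R) : 0 < t -> gauss lam t setT = 1%E.
Proof. exact: gauss_mass Ffil BM Pfin Ppos t. Qed.

Let db : bmeas defect Cw. Proof. exact: bmeas_defect. Qed.

Let approx := vpot_approx lamE Ffil BM Pfin Ppos rst hb h_ge0 h_int nuE nufin term
  mb m_ge0 m_int start.

Let CV0 : 0 <= CV. Proof. exact: occ_mass_ge0. Qed.

Let Cw0 : 0 <= Cw. Proof. exact: le_trans (normr_ge0 _) (db.2 0). Qed.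

Let JE N S : (S * N.+1)%:R * mesh R N = S%:R.
Proof. by rewrite natrM -mulrA natr_mesh mulr1. Qed.

Let grid_pos (th : R) N k : 0 < th -> 0 < th + grid R N k.
Proof. by move=> th0; rewrite ltr_wpDr// grid_ge0. Qed.

Lemma bmeas_vpot N S : bmeas (vpot N S) (S%:R * Cw).
Proof. by rewrite -(JE N S); apply: bmeas_psum => //; exact: mesh_gt0. Qed.

(** Of the two occupation terms the early one is nonnegative, and the late one involves a kernel at
    a time beyond S + 1, which is uniformly small. *)
Lemma hP_vpot_ge S (th e : R) : 0 < th -> 0 < e -> exists N0, forall N x, (N0 <= N)%N ->
  - (gc n S.+1%:R * CV) - e <= hP th (vpot N S.+1) x.
Proof.
move=> th0 e0; have [N0 N0P] := approx S.+1 th0 e0; exists N0 => N x /(N0P N x).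
have o1 : 0 <= Occ N (pk (th + grid R N 1) x).
  by apply: occ_ge0 => y; apply: pk_ge0; exact: grid_pos.
have S0 : 0 < S.+1%:R :> R by rewrite ltr0n.
have o2 : Occ N (pk (th + grid R N (S.+1 * N.+1).+1) x) <= gc n S.+1%:R * CV.
  have tp : 0 < th + grid R N (S.+1 * N.+1).+1 by exact: grid_pos.
  apply: (occ_le lamE Ffil BM Pfin Ppos rst exitU rad_ge0 Urad N (bmeas_pk x tp)).
    by rewrite ltW// gc_gt0.
  move=> y; apply: (le_trans (pk_le_gc _ _ tp)); apply: gc_le => //.
  rewrite gridS /grid JE; have := mesh_gt0 R N; lra.
rewrite ler_norml => /andP[h1 _]; move: h1 o1 o2.
by move: (Occ N _) (Occ N _) (heat _ _ _ _) (gc _ _ * _) => a b c p; lra.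
Qed.

Lemma hP_vpot_le S : exists N0, forall N x, (N0 <= N)%N ->
  hP 1 (vpot N S) x <= gc n 1 * CV + 1.
Proof.
have [N0 N0P] := approx S (@ltr01 R) (@ltr01 R); exists N0 => N x /(N0P N x).
have o1 : 0 <= Occ N (pk (1 + grid R N (S * N.+1).+1) x).
  by apply: occ_ge0 => y; apply: pk_ge0; exact: grid_pos.
have o2 : Occ N (pk (1 + grid R N 1) x) <= gc n 1 * CV.
  have tp : 0 < 1 + grid R N 1 by exact: grid_pos.
  apply: (occ_le lamE Ffil BM Pfin Ppos rst exitU rad_ge0 Urad N (bmeas_pk x tp)).
    by rewrite ltW// gc_gt0.
  move=> y; apply: (le_trans (pk_le_gc _ _ tp)); apply: gc_le => //.
  by have := grid_ge0 R N 1; lra.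
rewrite ler_norml => /andP[_ h1]; move: h1 o1 o2.
by move: (Occ N _) (Occ N _) (heat _ _ _ _) (gc _ _ * _) => a b c p; lra.
Qed.

(** The times up to 1 contribute at most the sup bound of [defect]; the remaining ones form P_1 of a
    shorter potential, controlled by the occupation at smoothing scale 1. The bound must not depend
    on S, which is chosen only after the threshold c. *)
Lemma vpot_le S : exists N0, forall N x, (N0 <= N)%N ->
  vpot N S.+1 x <= Cw + gc n 1 * CV + 1.
Proof.
have [N0 N0P] := hP_vpot_le S; exists N0 => N x /(N0P N x).
have m0 := mesh_gt0 R N.
rewrite /vpot mulSn (psumD lamE lam_gauss m0 db) natr_mesh => h1.
have := psum_le lamE lam_gauss m0 db N.+1 x; rewrite natr_mesh mul1r => h2.
have {}h2 := le_trans (ler_norm _) h2.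
move: h1 h2; move: (psum _ _ _ _ _) (heat _ _ _ _) (gc _ _ * _) (Cw) => a b c p; lra.
Qed.

(** At distance rh from U the kernel at time th + mesh <= 2 th is at most its prefactor at th times
    the exponential at 2 th, and [kap] is the ratio of the prefactors at th and 2 th. The
    contribution of time 0, when the path may be off U, has weight one mesh and is half of e. *)
Lemma hP_vpot_out S (th rh e : R) : 0 < th -> 0 < rh -> 0 < e -> exists N0, forall N x, (N0 <= N)%N ->
  (forall y, U y -> rh <= enorm (y - x)) ->
  hP th (vpot N S) x <= kap R n * pr n (2 * th) rh * CV + e.
Proof.
move=> th0 rh0 e0; have e20 : 0 < e / 2 by rewrite divr_gt0.
have [N0 N0P] := approx S th0 e20.
pose K := gc n th * fine (P setT) + 1.
have g0 : 0 < gc n th by exact: gc_gt0.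
have K0 : 0 < K by rewrite ltr_wpDl// mulr_ge0 ?fine_ge0// ltW.
have eK0 : 0 < e / 2 / K by rewrite divr_gt0.
have [N1 _ N1P] := near_infty_natSinv_lt (PosNum eK0).
have [N2 _ N2P] := near_infty_natSinv_lt (PosNum th0).
exists (maxn N0 (maxn N1 N2)) => N x; rewrite !geq_max => /and3P[hN0 hN1 hN2] far.
have m0 := mesh_gt0 R N.
have /= mK := N1P N hN1; have /= mth := N2P N hN2; rewrite -/(mesh R N) in mK mth.
have := N0P N x hN0.
have o1 : 0 <= Occ N (pk (th + grid R N (S * N.+1).+1) x).
  by apply: occ_ge0 => y; apply: pk_ge0; exact: grid_pos.
have tp : 0 < th + grid R N 1 by exact: grid_pos.
have gE : grid R N 1 = mesh R N by rewrite /grid mul1r.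
have o2 : Occ N (pk (th + grid R N 1) x) <= kap R n * pr n (2 * th) rh * CV + e / 2.
  apply: (le_trans (occ_le_out lamE Ffil BM Pfin Ppos rst exitU rad_ge0 Urad N
    (a := kap R n * pr n (2 * th) rh) (bmeas_pk x tp) _ _ _)).
  - apply: mulr_ge0; first by rewrite (le_trans ler01)// kap_ge1.
    by apply: ltW; apply: pr_gt0; rewrite mulr_gt0.
  - by rewrite ltW// gc_gt0.
  - move=> y Uy; rewrite /pk gauss_gcE /pr mulrA -gc_scale//.
    apply: ler_pM; [by rewrite ltW// gc_gt0|exact: expR_ge0| |].
      by apply: gc_le => //; rewrite lerDl grid_ge0.
    rewrite ler_expR gE mulNr lerN2.
    apply: ler_pM; [exact: sqr_ge0|by rewrite invr_ge0 !mulr_ge0// ltW| |].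
      by rewrite -sqr_enorm ler_sqr ?nnegrE ?enorm_ge0 ?(ltW rh0)//; exact: far.
    rewrite lef_pV2 ?posrE ?mulr_gt0 ?addr_gt0//; lra.
  rewrite lerD2l; apply: (@le_trans _ _ (mesh R N * K)).
    apply: ler_wpM2l; first exact: ltW.
    have : gc n (th + grid R N 1) * fine (P setT) <= gc n th * fine (P setT).
      apply: ler_wpM2r; first exact: fine_ge0.
      by apply: gc_le => //; rewrite lerDl grid_ge0.
    by rewrite /K; lra.
  by rewrite -ler_pdivlMr// ltW.
rewrite ler_norml => /andP[_ h1]; move: h1 o1 o2.
by move: (Occ N _) (Occ N _) (heat _ _ _ _) (kap _ _ * _ * _) => a b c p; lra.
Qed.

Variable psi : V -> \bar R.
Hypotheses (lamU : (lam U < +oo)%E) (psi_int : lam.-integrable (U : set E) psi)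
  (psi_sh : superharmonic_in lam U psi).
Local Notation psb := (psb U psi).

Lemma vpot_good (c kappa : R) S : 0 < c -> 0 < kappa -> gc n S.+1%:R * CV <= c / 16 ->
  exists N, [/\ mesh R N <= kappa,
    forall x, - (c / 4) <= vpot N S.+1 x,
    forall x, vpot N S.+1 x <= Cw + gc n 1 * CV + 1 &
    forall x, ~ U x -> vpot N S.+1 x <= c / 4].
Proof.
move=> c0 kap0 cS.
pose L := 4 * Cw * Cg R n * Num.sqrt S.+1%:R.
have C0 : 0 <= Cg R n by rewrite (le_trans ler01)// Cg_ge1.
have L0 : 0 <= L by rewrite !mulr_ge0// sqrtr_ge0.
have vL N x z : `|vpot N S.+1 (x + z) - vpot N S.+1 x| <= L * enorm z.
  have := psum_lipschitz lamE lam_gauss (mesh_gt0 R N) db (S.+1 * N.+1) x z.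
  by rewrite JE mulrAC.
have c160 : 0 < c / 16 by rewrite divr_gt0.
have L1 : 0 < L + 1 by rewrite ltr_wpDl.
pose eta := c / 16 / (L + 1); have eta0 : 0 < eta by rewrite divr_gt0.
have Leta : L * eta <= c / 16.
  rewrite /eta mulrA ler_pdivrMr// mulrC; apply: ler_wpM2l; first exact: ltW.
  by rewrite lerDl.
have [rh rh0 ext] := exterior_points oU Urad lipU eta0.
have [Cp Cp0 prC] := pr_small n rh0.
have k1 := kap_ge1 R n.
(* The three summands serve [lipth], [prth] and A >= 1 respectively, once th * A is small enough. *)
pose A := (L * (1 + 4 * kap R n)) ^+ 2 + 4 * (kap R n * Cp * CV) + 1.
have A1 : 1 <= A.
  by rewrite lerDr addr_ge0 ?sqr_ge0// !mulr_ge0// (le_trans ler01).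
pose th := Num.min (2^-1) (Num.min (c / 16) ((c / 16) ^+ 2) / A).
have A0 : 0 < A by lra.
have th0 : 0 < th by rewrite !lt_min invr_gt0 ltr0n/= divr_gt0// lt_min c160 exprn_gt0.
have th2 : th <= 2^-1 by rewrite ge_min lexx.
have thA : th * A <= Num.min (c / 16) ((c / 16) ^+ 2).
  by rewrite -ler_pdivlMr// /th ge_min lexx orbT.
have B0 : 0 <= 1 + 4 * kap R n by lra.
have lipth : L * ((1 + 4 * kap R n) * Num.sqrt th) <= c / 16.
  rewrite mulrA -ler_sqr ?nnegrE ?(ltW c160) ?mulr_ge0 ?sqrtr_ge0//.
  rewrite exprMn sqr_sqrtr ?(ltW th0)// mulrC.
  have : th * A <= (c / 16) ^+ 2 by rewrite (le_trans thA)// ge_min lexx orbT.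
  apply: le_trans; apply: ler_wpM2l; first exact: ltW.
  by rewrite /A -addrA lerDl addr_ge0// !mulr_ge0// (le_trans ler01).
have prth : kap R n * pr n (2 * th) rh * CV <= c / 16.
  have : th * A <= c / 16 by rewrite (le_trans thA)// ge_min lexx.
  apply: le_trans.
  have hp : pr n (2 * th) rh <= Cp * (2 * th) ^+ 2.
    by apply: prC; apply/andP; split; lra.
  have hp' : pr n (2 * th) rh <= 4 * Cp * th.
    apply: (le_trans hp); rewrite (_ : Cp * _ = 4 * Cp * th * th); last by ring.
    by apply: ler_piMr; [rewrite !mulr_ge0// ltW|lra].
  have k0 : 0 <= kap R n by lra.
  apply: (@le_trans _ _ (kap R n * (4 * Cp * th) * CV)).
    by apply: ler_wpM2r => //; exact: ler_wpM2l.
  rewrite (_ : _ * CV = th * (4 * (kap R n * Cp * CV))); last by ring.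
  apply: ler_wpM2l; first exact: ltW.
  have := sqr_ge0 (L * (1 + 4 * kap R n)); rewrite /A; lra.
have [N0 N0P] := hP_vpot_ge S th0 c160.
have [N1 N1P] := vpot_le S.
have [N2 N2P] := hP_vpot_out S.+1 th0 rh0 c160.
have [N3 _ N3P] := near_infty_natSinv_lt (PosNum kap0).
pose N := maxn (maxn N0 N1) (maxn N2 N3).
have [i0 i1 i2 i3] : [/\ (N0 <= N)%N, (N1 <= N)%N, (N2 <= N)%N & (N3 <= N)%N].
  by rewrite /N !leq_max !leqnn !orbT.
have close x : `|hP th (vpot N S.+1) x - vpot N S.+1 x| <= c / 16.
  exact: le_trans (hP_lip_diff lamE lam_gauss x th0 (bmeas_vpot N S.+1) (vL N)) lipth.
exists N; split.
- by apply: ltW; exact: N3P.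
- move=> x; have := close x; rewrite ler_norml => /andP[_ h1].
  have := N0P N x i0; move: h1 cS.
  by move: (heat _ _ _ _) (vpot N _ _) (gc _ _ * _) => a b q; lra.
- by move=> x; exact: N1P.
- move=> x Ux; have [x' xx' far] := ext x Ux.
  have h1 := N2P N x' i2 far.
  have := close x'; rewrite ler_norml => /andP[h2 _].
  have := vL N x' (x - x'); rewrite subrKC => h3.
  have h4 : L * enorm (x - x') <= L * eta.
    by apply: ler_wpM2l => //; rewrite /enorm sqnormBC.
  have h5 := le_trans (ler_norm _) h3.
  move: h1 h2 h4 h5 Leta prth.
  move: (heat _ _ _ _) (vpot N _ x) (vpot N _ x') (L * enorm _) (L * eta) (kap _ _ * _ * _).
  by move=> a b q p r s; lra.
Qed.

Lemma Rint_psb_defect : 0 <= \int[lam]_x (psb x * defect x).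
Proof.
have ipsb := rint_psb oU psi_int.
pose K := 2 + Cw; have K0 : 0 < K by rewrite /K; have := Cw0; lra.
suff main (e : R) : 0 < e -> - (\int[lam]_x (psb x * defect x)) <= K * e.
  rewrite -oppr_le0; apply/ler_addgt0Pr => e e0.
  have KE : K * (e / K) = e by rewrite mulrC divfK// gt_eqF.
  by rewrite add0r -KE; apply: main; exact: divr_gt0.
move=> e0; have gc10 : 0 <= gc n (1 : R) by rewrite ltW// gc_gt0.
(* [Cv] has to be fixed before the threshold c is known. The bound of [vpot_le] ends in + 1; the
   further 1 leaves room for the shift by c1 / 4, with c1 <= 1. *)
pose Cv := Cw + gc n 1 * CV + 2.
have Cv0 : 0 <= Cv.
  by apply: addr_ge0 => //; apply: addr_ge0; [exact: Cw0|exact: mulr_ge0].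
have [c [d0 [c0 d00 coreP]]] :=
  superharmonic_potential_le lamE lam_gauss oU lamU psi_int psi_sh Cv0 (addr_ge0 Cw0 Cw0) e0.
pose c1 := Num.min c 1.
have c10 : 0 < c1 by rewrite lt_min c0 ltr01.
have c11 : c1 <= 1 by rewrite ge_min lexx orbT.
have c1c : c1 <= c by rewrite ge_min lexx.
have c160 : 0 < c1 / 16 by rewrite divr_gt0.
pose D1 := \int[lam]_x `|defect x|.
have dint : rint lam defect by exact: rint_defect.
have D10 : 0 <= D1 by exact: Rint_ge0.
pose B := D1 * nrm1 lam U psi; have B0 : 0 <= B by rewrite mulr_ge0// nrm1_ge0.
have CV1 : 0 < CV + 1 by rewrite ltr_wpDl.
have B1 : 0 < B + 1 by rewrite ltr_wpDl.
(* S serves twice: it makes the potential nearly nonnegative, and it makes P_(S+1) defect negligible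
   against [psb], being at most [gc] times the L^1 norm of [defect]. *)
have g0 : 0 < Num.min (c1 / 16 / (CV + 1)) (e / (B + 1)) by rewrite lt_min !divr_gt0.
have [S gS] := gc_small n g0.
have S0 : 0 < S.+1%:R :> R by rewrite ltr0n.
have gS0 : 0 <= gc n (S.+1%:R : R) by rewrite ltW// gc_gt0.
have gS1 : gc n S.+1%:R * CV <= c1 / 16.
  have : gc n S.+1%:R * (CV + 1) <= c1 / 16.
    by rewrite -ler_pdivlMr// (le_trans gS)// ge_min lexx.
  by apply: le_trans; apply: ler_wpM2l => //; rewrite lerDl.
have gS2 : gc n S.+1%:R * B <= e.
  have : gc n S.+1%:R * (B + 1) <= e.
    by rewrite -ler_pdivlMr// (le_trans gS)// ge_min lexx orbT.
  by apply: le_trans; apply: ler_wpM2l => //; rewrite lerDl.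
have [_ psi_lsc _] := psi_sh.
have [th th0 l1P] := l1cont_psb lamE lam_gauss oU lamU psi_int psi_lsc e0.
have kap0 : 0 < Num.min d0 th by rewrite lt_min d00.
have [N [mN vlo vup vout]] := vpot_good c10 kap0 gS1.
have m0 := mesh_gt0 R N; set dl := mesh R N in mN m0.
have dld0 : dl <= d0 by rewrite (le_trans mN)// ge_min lexx.
have dlth : dl <= th by rewrite (le_trans mN)// ge_min lexx orbT.
have Sb : bmeas (hP S.+1%:R defect) Cw by exact: bmeas_hP.
(* By [psum_shift] this is the function whose image under P_d is the difference quotient of the
   potential; adding a constant to the potential does not change it. *)
pose wt x := hP S.+1%:R defect x - defect x.
have wb : bmeas wt (Cw + Cw) by exact: bmeasB.
(* The shift turns the lower bound - c1 / 4 into nonnegativity, and the bound c1 / 4 off U into c1 /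
   2 <= c / 2. *)
pose v x := vpot N S.+1 x + c1 / 4.
have v0 x : 0 <= v x by have := vlo x; rewrite /v; move: (vpot _ _ _) => a; lra.
have vb : bmeas v Cv.
  split.
    by apply: measurable_funD; [exact: (bmeas_vpot N S.+1).1|exact: measurable_cst].
  move=> x; rewrite ger0_norm//; have := vup x; rewrite /v /Cv.
  by move: (vpot _ _ _) (gc n 1 * _) (Cw) => a b q; lra.
have vE x : hP dl v x - v x = dl * hP dl wt x.
  rewrite /v (hPD lamE lam_gauss x m0 (bmeas_vpot N S.+1) (bmeas_cst n (c1 / 4))).
  rewrite (hP_cst lamE lam_gauss)// (hPB lamE lam_gauss x m0 Sb db).
  have [i iE] : exists i, (S.+1 * N.+1)%N = i.+1 by exists (N + S * N.+1)%N; rewrite mulSn addSn.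
  have := psum_shift lamE lam_gauss m0 db i x; rewrite -iE JE.
  rewrite -/(vpot N S.+1); move: (heat _ _ _ _) (vpot N _ x) (heat _ _ _ _) (heat _ _ _ _).
  by move=> a b p q <-; ring.
have vc x : ~ U x -> v x <= c / 2.
  by move=> /vout; rewrite /v; move: (vpot _ _ _) => a; lra.
have dl01 : 0 < dl <= d0 by rewrite m0.
have dl02 : 0 < dl <= th by rewrite m0.
have I1 := coreP dl v wt dl01 vb v0 wb vE vc.
have I2 := l1P dl Cw defect dl02 db.
have Db : bmeas (hP dl defect) Cw by exact: bmeas_hP.
have DSb : bmeas (hP dl (hP S.+1%:R defect)) (gc n S.+1%:R * D1).
  apply: bmeas_hP => //; split; first exact: Sb.1.
  move=> x; rewrite -RintZ; last exact: rint_norm.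
  apply: norm_Rint_le; [exact: rint_ipk|by apply: rintZ; exact: rint_norm|].
  move=> y; rewrite normrM (ger0_norm (pk_ge0 _ _ S0)) mulrC.
  by apply: ler_wpM2r => //; exact: pk_le_gc.
have I3 := Rint_psb_le oU psi_int DSb.
have i1 := Rint_Mb ipsb Db; have i2 := Rint_Mb ipsb db; have i3 := Rint_Mb ipsb DSb.
have E1 : \int[lam]_x (psb x * hP dl wt x) =
   \int[lam]_x (psb x * hP dl (hP S.+1%:R defect) x) - \int[lam]_x (psb x * hP dl defect x).
  rewrite -RintB//; apply: eq_Rint => x.
  by rewrite (hPB lamE lam_gauss x m0 Sb db) mulrBr.
have E2 : \int[lam]_x (psb x * (hP dl defect x - defect x)) =
   \int[lam]_x (psb x * hP dl defect x) - \int[lam]_x (psb x * defect x).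
  by rewrite -RintB//; apply: eq_Rint => x; rewrite mulrBr.
rewrite E1 in I1; rewrite E2 in I2.
have I3' : `|\int[lam]_x (psb x * hP dl (hP S.+1%:R defect) x)| <= e.
  by apply: (le_trans I3); rewrite -mulrA.
exact: opp_le_of_dist I1 I2 I3'.
Qed.

End Inequality.

(** * Weak duality *)

Section WeakDuality.
Variables (R : realType) (n : nat).
Local Notation V := 'rV[R]_(n.+1).
Local Notation E := (Rd R n).
Variable lam : {sigma_finite_measure set E -> \bar R}.

Section Density.
Variables (U : set V) (mu : {measure set E -> \bar R}) (m : V -> R) (C : R).
Hypotheses (oU : open U) (mb : bmeas m C) (m_ge0 : forall x, 0 <= m x)
  (mufin : (mu setT < +oo)%E)
  (muE : forall A : set E, measurable A -> mu A = (\int[lam]_(x in A) (m x)%:E)%E).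

Let mU : measurable (U : set E). Proof. exact: measurable_open. Qed.

(** On U the functions [psi] and [psb] differ only where [psi] is infinite. This set is null for
    [lam], hence for mu, which has a density. *)
Lemma integral_density_psb (psi : V -> \bar R) : lam.-integrable (U : set E) psi ->
  (\int[mu]_(x in (U : set E)) psi x = (\int[lam]_x (psb U psi x * m x))%R%:E)%E.
Proof.
move=> psi_int; pose pU := (psi : E -> \bar R) \_ (U : set E).
have mp : measurable_fun setT pU.
  have : lam.-integrable setT pU by exact/(integrable_mkcond (psi : E -> \bar R) mU).
  exact: measurable_int.
have ipsb := rint_psb oU psi_int; have im := Rint_Mb ipsb mb.
rewrite (RintE im); transitivity (\int[mu]_x pU x)%E; first exact: integral_mkcond.
rewrite [LHS]integralE.
have dens g := @ge0_integral_density _ _ _ mu lam m mufin mb.1 m_ge0 muE g.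
rewrite (dens _ (measurable_funepos mp))// (dens _ (measurable_funeneg mp))//.
transitivity (\int[lam]_x (pU x * (m x)%:E))%E.
  rewrite [RHS]integralE; congr (_ - _)%E; apply: eq_integral => x _.
    by rewrite !funeposE maxe_pMl// ?lee_fin// mul0e.
  by rewrite !funenegE maxe_pMl// ?lee_fin// mul0e mulNe.
apply: ae_eq_integral => //.
- by apply: emeasurable_funM => //; apply/measurable_EFinP; exact: mb.1.
- by apply/measurable_EFinP; exact: rint_measurable im.
have [N [mN N0 sN]] := psi_ae_fin oU psi_int; exists N; split=> //.
apply: subset_trans sN => x /=; apply: contra_not => fx _.
rewrite EFinM; congr (_ * _)%E; rewrite /pU; have [Ux|Ux] := pselect (U x).
  by rewrite psb_in// patchT ?inE// fineK//; exact: fx.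
by rewrite psb_out// patchN// notin_setE.
Qed.

End Density.

Lemma measurable_continuous_in (U : set V) (u : V -> R) : open U ->
  (forall x, U x -> {for x, continuous u}) -> measurable_fun (U : set E) (u : E -> R).
Proof.
move=> oU cu; apply: (measurability _ (RGenOInfty.measurableE R)).
move=> _ [_ [a ->] <-]; apply: measurable_open; rewrite openE => x [Ux ux].
apply: filterI; first exact: oU.
by apply: cu => //; apply: open_nbhs_nbhs; split => //; exact: interval_open.
Qed.

Lemma bounded_rint_in (U : set V) (f : V -> R) (C : R) : measurable (U : set E) ->
  (lam U < +oo)%E -> bmeas f C -> (forall x, ~ U x -> f x = 0) -> rint lam f.
Proof.
move=> mU lamU [mf fC] f0.
apply: (le_rint mf _ (rintZ C (rint_indic mU lamU))) => x.
rewrite indicE; have [Ux|Ux] := pselect (U x); first by rewrite mem_set// mulr1.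
by rewrite memNset// mulr0 f0// normr0.
Qed.

Lemma integral_null_mass (m g : V -> R) (C : R) : rint lam g -> bmeas m C ->
  (forall x, 0 <= m x) -> (\int[lam]_x (m x)%:E = 0)%E -> \int[lam]_x (g x * m x) = 0.
Proof.
move=> ig mb m0 im; have mm : measurable_fun setT (EFin \o (m : E -> R)).
  by apply/measurable_EFinP; exact: mb.1.
have /(ae_eq_integral_abs lam measurableT mm)[N [mN N0 sN]] :
    (\int[lam]_x `|(EFin \o (m : E -> R)) x| = 0)%E.
  by rewrite -im; apply: eq_integral => x _ /=; rewrite ger0_norm.
transitivity (\int[lam]_(x in setT) (0 : R)); last by rewrite /Rintegral integral0.
apply: (ae_eq_Rint (Rint_Mb ig mb)); first exact: measurable_cst.
exists N; split=> //; apply: subset_trans sN => x /=; apply: contra_not => mx.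
by have := mx Logic.I => -[] ->; rewrite mulr0.
Qed.

Variables (U : set V) (u f : V -> R) (mu : {measure set E -> \bar R}).
Hypotheses (lamE : is_lebesgue_d lam) (oU : open U) (bU : bounded_set U)
  (lipU : locally_lipschitz_boundary U).
Hypotheses (u_ge0 : forall x, U x -> 0 <= u x) (Cu : R) (u_le : forall x, U x -> u x <= Cu)
  (u_cont : forall x, U x -> {for x, continuous u}).
Hypotheses (mf : measurable_fun setT (f : E -> R)) (f_gt0 : forall x, 0 < f x)
  (Cf : R) (f_le : forall x, f x <= Cf).
Variables (m : V -> R) (Cm : R).
Hypotheses (mb : bmeas m Cm) (m_ge0 : forall x, 0 <= m x)
  (m_supp : forall x, ~ closure U x -> m x = 0)
  (muE : forall A : set E, measurable A -> mu A = (\int[lam]_(x in A) (m x)%:E)%E).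
Context (dO : measure_display) (Omega : measurableType dO).
Variables (P : {measure set Omega -> \bar R}) (F : R -> set (set Omega))
  (W : R -> Omega -> V).
Hypotheses (Ffil : filtration F) (BM : brownian_motion lam P F W)
  (start : forall B : set E, measurable B -> P [set w | B (W 0 w)] = mu B).

Let mU : measurable (U : set E). Proof. exact: measurable_open. Qed.

Let rad_ex : exists2 rad : R, 0 <= rad & forall x, U x -> cube rad x.
Proof.
have [M [Mr MU]] := bU; exists (`|M| + 1); first by rewrite addr_ge0.
move=> x Ux i; rewrite !mxE -ler_norml (le_trans (norm_coord_le x i))//.
by apply: MU => //; rewrite (le_lt_trans (ler_norm M))// ltrDl.
Qed.

Lemma sub_closure_cube (rad : R) : (forall x, U x -> cube rad x) -> closure U `<=` cube rad.
Proof.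
move=> Ur; have cc : closed (cube rad : set V).
  by apply: compact_closed; [exact: norm_hausdorff|exact: compact_cube].
by rewrite ((closure_id _).1 cc); exact: closure_subset.
Qed.

Let lamU : (lam U < +oo)%E.
Proof.
have [rad _ Ur] := rad_ex.
apply: le_lt_trans (lebesgue_box_lty lamE (const_mx (- rad)) (const_mx rad)).
by apply: le_measure; rewrite ?inE//; exact: measurable_box.
Qed.

Let m_int : rint lam m.
Proof.
have [rad _ Ur] := rad_ex.
apply: (@bounded_rint_in (cube rad) m Cm) => //; first exact: measurable_box.
  exact: (lebesgue_box_lty lamE).
by move=> x xr; apply: m_supp; apply: contra_not xr; exact: sub_closure_cube.
Qed.

Let mufin : (mu setT < +oo)%E.
Proof. by rewrite muE// -RintE// ltry. Qed.

Let PE : P setT = mu setT.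
Proof. by rewrite -start//. Qed.

Lemma weak_duality_pair (nu : {measure set E -> \bar R}) tau (phi : V -> R) (psi : V -> \bar R) :
  randomized_stopping_time F tau -> before_exit U W tau -> density_below lam nu f U ->
  terminal_law P W tau nu -> dual_feasible lam u U phi psi ->
  (\int[lam]_(y in (U : set E)) (phi y * f y)%:E - \int[mu]_(x in (U : set E)) psi x <=
   \int[nu]_(x in (U : set E)) (u x)%:E)%E.
Proof.
move=> rst exitU [h [mh hf nuE]] term [phi_int psi_int phi_le0 phi_psi psi_sh].
have h_ge0 x : 0 <= h x by case: (hf x).
have hU x : U x -> h x <= f x by move=> Ux; have [_] := hf x; rewrite asboolT.
have hU0 x : ~ U x -> h x = 0.
  by move=> Ux; have [h1] := hf x; rewrite asboolF// => h2; apply/le_anti; rewrite h1 h2.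
have hb : bmeas h Cf.
  split=> // x; rewrite ger0_norm//; have [Ux|Ux] := pselect (U x).
    exact: le_trans (hU x Ux) (f_le x).
  by rewrite hU0// (le_trans (ltW (f_gt0 x))).
have h_int : rint lam h by exact: bounded_rint_in hb hU0.
have nufin : (nu setT < +oo)%E by rewrite nuE// -(RintE h_int) ltry.
have psb_i := rint_psb oU psi_int.
have im := Rint_Mb psb_i mb; have ih := Rint_Mb psb_i hb.
have key : \int[lam]_x (psb U psi x * h x) <= \int[lam]_x (psb U psi x * m x).
  (* If P is null, [gauss_mass] gives nothing. But then mu is null, and so is nu by the terminal law
     tested on the constant 1; both integrals vanish. *)
  have [P0|P0] := eqVneq (P setT) 0%E.
    have m0 : (\int[lam]_x (m x)%:E = 0)%E by rewrite -muE// -PE.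
    have h0 : (\int[lam]_x (h x)%:E = 0)%E.
      have nu1 : (\int[nu]_x (cst (1 : R) x)%:E = nu setT)%E.
        transitivity (1 * nu setT)%E; last exact: mul1e.
        exact: (integral_cst nu (@measurableT _ E) 1%E).
      rewrite -nuE// -nu1 -(term _ (measurable_cst _) (fun=> ler01)).
      rewrite -[RHS](@integral_measure_zero _ Omega R setT
        (fun w => \int[tau w]_(t in @Rplus R) (cst (1 : R) (W t w))%:E)%E).
      apply: eq_measure_integral => A mA _; suff : P A = 0%E by [].
      by apply/eqP; rewrite eq_le measure_ge0 andbT -P0; apply: le_measure; rewrite ?inE.
    by rewrite (integral_null_mass psb_i mb)// (integral_null_mass psb_i hb).
  have [rad rad0 Ur] := rad_ex.
  have Pfin : (P setT < +oo)%E by rewrite PE.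
  have st (B : set E) : measurable B -> P [set w | B (W 0 w)] = (\int[lam]_(x in B) (m x)%:E)%E.
    by move=> mB; rewrite start// muE.
  have := Rint_psb_defect lamE Ffil BM Pfin P0 rst exitU rad0 Ur oU lipU hb h_ge0 h_int nuE
    nufin term mb m_ge0 m_int st lamU psi_int psi_sh.
  rewrite -subr_ge0 -RintB//.
  by under eq_Rintegral do rewrite mulrBr.
rewrite (integral_density_psb oU mb m_ge0 mufin muE psi_int).
pose ub : V -> R := (u : E -> R) \_ (U : set E).
have ubE x : U x -> ub x = u x by move=> Ux; rewrite /ub patchT// inE.
have ub0 x : 0 <= ub x.
  by rewrite /ub patchE; case: ifPn => // /set_mem Ux; exact: u_ge0.
have mub : measurable_fun setT (ub : E -> R).
  by apply/(measurable_restrict _ mU measurableT); rewrite setTI; exact: measurable_continuous_in.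
have ubb : bmeas ub `|Cu|.
  split=> // x; rewrite ger0_norm// /ub patchE; case: ifPn => [/set_mem Ux|_].
    exact: le_trans (u_le Ux) (ler_norm _).
  exact: normr_ge0.
have iu : rint lam (fun x => ub x * h x).
  by under eq_fun do rewrite mulrC; exact: Rint_Mb h_int ubb.
have -> : (\int[nu]_(x in (U : set E)) (u x)%:E = (\int[lam]_x (ub x * h x))%R%:E)%E.
  rewrite (RintE iu).
  have mE : measurable_fun setT (EFin \o (ub : E -> R)) by apply/measurable_EFinP.
  have E0 (x : E) : (0 <= (EFin \o (ub : E -> R)) x)%E by rewrite lee_fin.
  transitivity (\int[nu]_x (EFin \o (ub : E -> R)) x)%E; last first.
    by rewrite (ge0_integral_density nufin mh h_ge0 nuE mE E0); apply: eq_integral.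
  rewrite [LHS]integral_mkcond; apply: eq_integral => x _ /=.
  by rewrite /ub !patchE; case: ifP.
pose pb : V -> R := (phi : E -> R) \_ (U : set E).
have pbi : rint lam pb.
  have : lam.-integrable setT ((fun x : E => (phi x)%:E) \_ (U : set E)).
    exact/(integrable_mkcond (fun x : E => (phi x)%:E) mU).
  by apply: eq_integrable => // x _; rewrite /pb /= !patchE; case: ifP.
have pfi : rint lam (fun x => pb x * f x).
  apply: (rintM pbi mf (M := Cf)) => x; rewrite ger0_norm// ltW//.
have -> : (\int[lam]_(y in (U : set E)) (phi y * f y)%:E = (\int[lam]_x (pb x * f x))%R%:E)%E.
  rewrite (RintE pfi) [LHS]integral_mkcond; apply: eq_integral => x _ /=.
  by rewrite /pb !patchE; case: ifP => // _; rewrite mul0r.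
rewrite -EFinB lee_fin lerBlDr.
apply: (@le_trans _ _ (\int[lam]_x (ub x * h x + psb U psi x * h x))); last first.
  by rewrite RintD// lerD2l.
apply: ae_le_Rint => //; first exact: rintD.
have [N [mN N0 sN]] := psi_ae_fin oU psi_int; exists N; split=> //.
apply: subset_trans sN => x /=; apply: contra_not => fx.
have [Ux|Ux] := pselect (U x); last first.
  by rewrite /pb patchN ?notin_setE// hU0// !mulr0 mul0r addr0.
have pf := fx Ux; rewrite psb_in// ubE// /pb patchT ?inE//.
have := phi_psi x Ux; rewrite -[psi x]fineK// lee_fin.
have := phi_le0 x Ux; have := hU x Ux; have := h_ge0 x.
by rewrite /=; move: (phi x) (f x) (h x) (u x) (fine _) => a b c d e *; nra.
Qed.

End WeakDuality.

Theorem theorem4p1 (R : realType) (n : nat)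
  (lam : {measure set (Rd R n) -> \bar R})
  (U : set 'rV[R]_(n.+1)) (u f : 'rV[R]_(n.+1) -> R)
  (mu : {measure set (Rd R n) -> \bar R}) :
  is_lebesgue_d lam ->
  (* U bounded open with locally Lipschitz boundary *)
  open U -> bounded_set U -> locally_lipschitz_boundary U ->
  (* u : closure U -> [0,oo) bounded, smooth, Delta u < 0 in U *)
  (forall x, closure U x -> 0 <= u x) ->
  (exists C : R, forall x, closure U x -> u x <= C) ->
  smooth_on_closure U u ->
  (forall x, U x -> laplacian u x < 0) ->
  (* f : R^d -> (0,oo) bounded measurable *)
  measurable_fun setT (f : Rd R n -> R) ->
  (forall x, 0 < f x) -> (exists C : R, forall x, f x <= C) ->
  (* mu has a bounded density supported in closure U *)
  (exists m : Rd R n -> R, [/\ measurable_fun setT m,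
      exists C : R, forall x, 0 <= m x <= C,
      forall x, ~ closure U x -> m x = 0 &
      forall A : set (Rd R n), measurable A ->
        mu A = (\int[lam]_(x in A) (m x)%:E)%E]) ->
  (mu U <= \int[lam]_(x in (U : set (Rd R n))) (f x)%:E)%E ->
  (* any filtered space carrying a Brownian motion started with law mu *)
  forall (dO : measure_display) (Omega : measurableType dO)
    (P : {measure set Omega -> \bar R}) (F : R -> set (set Omega))
    (W : R -> Omega -> 'rV[R]_(n.+1)),
  filtration F -> brownian_motion lam P F W ->
  (forall B : set (Rd R n), measurable B ->
     P [set w | B (W 0 w)] = mu B) ->
  (dual_value lam mu f u U <= primal_value lam P F W f u U)%E.
Proof.
move=> lamE oU bU lipU u0 [Cu uC] [B [oB clB uB]] _ mf f0 [Cf fC] [m [mm [Cm mC] msupp muE]] _.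
move=> dO Omega P F W Ffil BM start.
have lam_sf := lebesgue_sigma_finite lamE.
pose lam' : {sigma_finite_measure set (Rd R n) -> \bar R} := HB.pack (Measure.sort lam)
  (isSigmaFinite.Build _ _ _ (Measure.sort lam) lam_sf)
  (isSFinite.Build _ _ _ (Measure.sort lam) (sfinite_measure_sigma_finite lam_sf)).
have UclU x : U x -> closure U x by exact: subset_closure.
apply: ge_ereal_sup => _ [[phi psi] /= feas <-].
apply: le_ereal_inf_tmp => _ [nu [tau [rst exitU dens term]] <-].
refine (@weak_duality_pair R n lam' U u f mu lamE oU bU lipU _ Cu _ _ mf f0 Cf fC m Cm _ _ msupp muE
  dO Omega P F W Ffil BM start nu tau phi psi rst exitU dens term feas).
- by move=> x /UclU; exact: u0.
- by move=> x /UclU; exact: uC.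
(* Smoothness along the empty list of directions is continuity of u itself. *)
- by move=> x /UclU /clB /(uB [::])[].
- by split=> // x; have /andP[m0 mx] := mC x; rewrite ger0_norm.
- by move=> x; have /andP[] := mC x.
Qed.
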